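(* Assume $(\mathrm R_0)$, $(\mathrm V_z)$, $(\mathrm V_u)$ and $(\mathrm E)$ (all spelled out in the context). Let $(q_\varepsilon)_\varepsilon\subset H^1(0,T;\mathcal Q)$ be a sequence of solutions to the Cauchy problem for $$\partial_{q'}\mathcal R_\varepsilon(q(t),q'(t))+\mathrm D_q\mathcal E(t,q(t))\ni0\quad\text{in }(0,T).$$ Choose nondecreasing surjective parameterizations $\mathsf t_\varepsilon:[0,S_\varepsilon]\to[0,T]$ and set $\mathsf q_\varepsilon(s)=(\mathsf u_\varepsilon(s),\mathsf z_\varepsilon(s)):=q_\varepsilon(\mathsf t_\varepsilon(s))$ for $s\in[0,S_\varepsilon]$. Suppose that $S_\varepsilon\to S$ as $\varepsilon\downarrow0$ up to a subsequence, and that there exist $q_0\in\mathcal Q$ and $m\in L^1(0,S)$ such that $\mathsf q_\varepsilon(0)\to q_0$ and $$m_\varepsilon:=\mathsf t_\varepsilon'+|\mathsf q_\varepsilon'|\rightharpoonup m\quad\text{weakly in }L^1(0,S)\text{ as }\varepsilon\downarrow0.$$ Then there exist a (not relabeled) subsequence and a parameterized curve $(\mathsf t,\mathsf q)\in\mathrm{AC}([0,S];[0,T]\times\mathcal Q)$ such that, as $\varepsilon\downarrow0$, $$(\mathsf t_\varepsilon,\mathsf q_\varepsilon)\to(\mathsf t,\mathsf q)\quad\text{in }C^0([0,S];[0,T]\times\mathcal Q),$$ $\mathsf t'+|\mathsf q'|\le m$ a.e. in $(0,S)$, and $(\mathsf t,\mathsf q)$ fulfills the (parameterized) energy identity $$\mathcal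 E(\mathsf t(s_2),\mathsf q(s_2))+\int_{s_1}^{s_2}\mathcal M_0(\mathsf q(r),\mathsf t'(r),\mathsf q'(r),-\mathrm D_q\mathcal E(\mathsf t(r),\mathsf q(r)))\,dr=\mathcal E(\mathsf t(s_1),\mathsf q(s_1))+\int_{s_1}^{s_2}\partial_t\mathcal E(\mathsf t(r),\mathsf q(r))\,\mathsf t'(r)\,dr$$ for all $0\le s_1\le s_2\le S$.
   Context: Let $T>0$, let $\alpha>0$ be a fixed parameter, $\mathcal Q=\mathbb R^n\times\mathbb R^m$, $q=(u,z)\in\mathcal Q$; velocities are written $q'=(u',z')$ and forces $\xi=(\eta,\zeta)\in\mathbb R^{n+m}$, with $\eta\in\mathbb R^n$, $\zeta\in\mathbb R^m$. $|\cdot|$ and $\langle\cdot,\cdot\rangle$ are Euclidean norm and scalar product. $\mathrm{AC}$ denotes absolutely continuous curves. Assumptions: $(\mathrm R_0)$: $\mathcal R_0\in C^0(\mathcal Q\times\mathbb R^m)$; for every $q\in\mathcal Q$, $\mathcal R_0(q,\cdot)$ is convex and positively homogeneous of degree 1; there are $C_{0,R},C_{1,R}>0$ with $C_{0,R}|z'|\le\mathcal R_0(q,z')\le C_{1,R}|z'|$ for all $(q,z')\in\mathcal Q\times\mathbb R^m$. $(\mathrm V_z)$: $\mathcal V_{\mathsf z}:\mathcal Q\times\mathbb R^m\to[0,\infty)$ is of the form $\mathcal V_{\mathsf z}(q;z')=\frac12\langle\mathbb V_{\mathsf z}(q)z',z'\rangle$ with $\mathbb V_{\mathsf z}\in C^0(\mathcal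 Q;\mathbb R^{m\times m})$, and there are $C_{0,V},C_{1,V}>0$ with $C_{0,V}|z'|^2\le\mathcal V_{\mathsf z}(q;z')\le C_{1,V}|z'|^2$ for all $q,z'$. $(\mathrm V_u)$: $\mathcal V_{\mathsf u}:\mathcal Q\times\mathbb R^n\to[0,\infty)$ is of the form $\mathcal V_{\mathsf u}(q;u')=\frac12\langle\mathbb V_{\mathsf u}(q)u',u'\rangle$ with $\mathbb V_{\mathsf u}\in C^0(\mathcal Q;\mathbb R^{n\times n})$, and there are $\widetilde C_{0,V},\widetilde C_{1,V}>0$ with $\widetilde C_{0,V}|u'|^2\le\mathcal V_{\mathsf u}(q;u')\le\widetilde C_{1,V}|u'|^2$ for all $q,u'$. $(\mathrm E)$: $\mathcal E\in C^1([0,T]\times\mathcal Q)$ is bounded from below by a positive constant; there are $C_{0,E},\widetilde C_{0,E},C_{1,E}>0$ with $\mathcal E(t,q)\ge C_{0,E}|q|^2-\widetilde C_{0,E}$ and $|\partial_t\mathcal E(t,q)|\le C_{1,E}\mathcal E(t,q)$ for all $(t,q)\in[0,T]\times\mathcal Q$. The viscous dissipation potential is $\mathcal R_\varepsilon(q,(u',z'))=\mathcal R_0(q,z')+\varepsilon\mathcal V_{\mathsf z}(q;z')+\varepsilon^\alpha\mathcal V_{\mathsf u}(q;u')$, and $\partial_{q'}\mathcal R_\varepsilon$ is its convex subdifferential in the second argument. $\mathcal V_{\mathsf u}^*(q;\cdot)$ is the convex conjugate of $\mathcal V_{\mathsf u}(q;\cdot)$, and $\mathcal W_{\mathsf z}^*(q;\cdot)$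 is the convex conjugate of $\mathcal R_0(q,\cdot)+\mathcal V_{\mathsf z}(q;\cdot)$. Define $\mathcal M_0:\mathcal Q\times[0,\infty)\times\mathcal Q\times\mathbb R^{n+m}\to[0,\infty]$ by $\mathcal M_0(q,\tau,(u',z'),(\eta,\zeta))=\mathcal R_0(q,z')+\mathcal M_0^{\rm red}(q,\tau,(u',z'),(\eta,\zeta))$, where: for $\tau>0$: $\mathcal M_0^{\rm red}=0$ if $\mathcal W_{\mathsf z}^*(q;\zeta)=\mathcal V_{\mathsf u}^*(q;\eta)=0$, and $\mathcal M_0^{\rm red}=\infty$ if $\mathcal W_{\mathsf z}^*(q;\zeta)+\mathcal V_{\mathsf u}^*(q;\eta)>0$; for $\tau=0$ and $\alpha>1$: $\mathcal M_0^{\rm red}=2\sqrt{\mathcal V_{\mathsf u}(q;u')}\sqrt{\mathcal V_{\mathsf u}^*(q;\eta)}$ if $\mathcal V_{\mathsf z}(q;z')=0$; $=2\sqrt{\mathcal V_{\mathsf z}(q;z')}\sqrt{\mathcal W_{\mathsf z}^*(q;\zeta)}$ if $\mathcal V_{\mathsf u}^*(q;\eta)=0$; $=\infty$ if $\mathcal V_{\mathsf z}(q;z')\,\mathcal V_{\mathsf u}^*(q;\eta)>0$; for $\tau=0$ and $\alpha=1$: $\mathcal M_0^{\rm red}=2\sqrt{\mathcal V_{\mathsf z}(q;z')+\mathcal V_{\mathsf u}(q;u')}\sqrt{\mathcal W_{\mathsf z}^*(q;\zeta)+\mathcal V_{\mathsf u}^*(q;\eta)}$; for $\tau=0$ and $\alpha\in(0,1)$: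 $\mathcal M_0^{\rm red}=2\sqrt{\mathcal V_{\mathsf u}(q;u')}\sqrt{\mathcal V_{\mathsf u}^*(q;\eta)}$ if $\mathcal W_{\mathsf z}^*(q;\zeta)=0$; $=2\sqrt{\mathcal V_{\mathsf z}(q;z')}\sqrt{\mathcal W_{\mathsf z}^*(q;\zeta)}$ if $\mathcal V_{\mathsf u}(q;u')=0$; $=\infty$ if $\mathcal V_{\mathsf u}(q;u')\,\mathcal W_{\mathsf z}^*(q;\zeta)>0$. *)

(* Defs.v *)
From HB Require Import structures.
From mathcomp Require Import all_boot all_order all_algebra.
From mathcomp Require Import all_classical all_reals all_analysis.

Set Implicit Arguments.
Unset Strict Implicit.
Unset Printing Implicit Defensive.

Import Order.TTheory GRing.Theory Num.Theory.
Import numFieldNormedType.Exports.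

Local Open Scope classical_set_scope.
Local Open Scope ring_scope.

Notation Qspace R n m := ('rV[R]_n * 'rV[R]_m)%type.

(* The library norms on 'rV[R]_k and on products are sup-norms, hence the
   separate Euclidean product and norm. *)
Definition dotv (R : realType) (k : nat) (u v : 'rV[R]_k) : R :=
  \sum_(i < k) u 0 i * v 0 i.

Definition enorm (R : realType) (k : nat) (u : 'rV[R]_k) : R :=
  Num.sqrt (dotv u u).

Definition dotQ (R : realType) (n m : nat) (p q : Qspace R n m) : R :=
  dotv p.1 q.1 + dotv p.2 q.2.

Definition enormQ (R : realType) (n m : nat) (q : Qspace R n m) : R :=
  Num.sqrt (dotQ q q).

Definition absolutely_continuous_on (R : realType) (V : zmodType)
    (N : V -> R) (a b : R) (f : R -> V) : Prop :=
  forall e : R, 0 < e -> exists2 d : R, 0 < d &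
    forall (k : nat) (l r : 'I_k -> R),
      (forall i, a <= l i /\ l i <= r i /\ r i <= b) ->
      trivIset [set: 'I_k] (fun i => `]l i, r i[%classic) ->
      \sum_(i < k) (r i - l i) < d ->
      \sum_(i < k) N (f (r i) - f (l i)) < e.

(* H^1(0,T;Q), through the continuous representatives. *)
Definition H1_curve (R : realType) (n m : nat) (T : R) (q : R -> Qspace R n m)
    : Prop :=
  absolutely_continuous_on (@enormQ R n m) 0 T q /\
  (\int[@lebesgue_measure R]_(t in `]0%R, T[) (enormQ (derive1 q t) ^+ 2)%:E
     < +oo)%E.

(* f_ k, f in L^1(D) and f_ k -> f in the duality with L^oo(D). *)
Definition weak_cvg_L1 (R : realType) (D : set R) (f_ : nat -> R -> R)
    (f : R -> R) : Prop :=
  let mu := @lebesgue_measure R in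
  [/\ forall k, mu.-integrable D (EFin \o f_ k),
      mu.-integrable D (EFin \o f) &
      forall g : R -> R, measurable_fun D g ->
        (exists M : R, {ae mu, forall x, D x -> `|g x| <= M}) ->
        (fun k => \int[mu]_(x in D) (f_ k x * g x)) @ \oo -->
        \int[mu]_(x in D) (f x * g x)].

(* Constant extension to [Se, +oo[ of a curve given on [0, Se]. *)
Definition freeze (R : realType) (V : Type) (Se : R) (f : R -> V) (s : R) : V :=
  f (Num.min s Se).

Definition subdifferential (R : realType) (n m : nat) (f : Qspace R n m -> R)
    (v : Qspace R n m) : set (Qspace R n m) :=
  [set xi | forall w, f v + dotQ xi (w - v) <= f w].

Definition conjugate (R : realType) (k : nat) (f : 'rV[R]_k -> R)
    (xi : 'rV[R]_k) : \bar R :=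
  ereal_sup (range (fun v => (dotv xi v - f v)%:E)).

(* (1/2) <A v, v>; vectors are rows, so that A v is v *m A^T. *)
Definition quadpot (R : realType) (k : nat) (A : 'M[R]_k) (v : 'rV[R]_k) : R :=
  2^-1 * dotv (v *m A^T) v.

Definition assumption_R0 (R : realType) (n m : nat)
    (R0 : Qspace R n m -> 'rV[R]_m -> R) : Prop :=
  [/\ continuous (fun p : Qspace R n m * 'rV[R]_m => R0 p.1 p.2),
      forall q, convex_function [set: 'rV[R]_m] (R0 q),
      forall q (l : R) (v : 'rV[R]_m), 0 < l -> R0 q (l *: v) = l * R0 q v &
      exists C0 C1 : R, [/\ 0 < C0, 0 < C1 &
        forall q v, C0 * enorm v <= R0 q v /\ R0 q v <= C1 * enorm v]].

Definition assumption_V (R : realType) (n m k : nat)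
    (VV : Qspace R n m -> 'M[R]_k) : Prop :=
  continuous VV /\
  exists C0 C1 : R, [/\ 0 < C0, 0 < C1 &
    forall q v, C0 * enorm v ^+ 2 <= quadpot (VV q) v /\
                quadpot (VV q) v <= C1 * enorm v ^+ 2].

Definition difference_quotient_t (R : realType) (n m : nat)
    (E : R -> Qspace R n m -> R) (t : R) (q : Qspace R n m) (s : R) : R :=
  (s - t)^-1 * (E s q - E t q).

(* Time derivative relative to [0,T], hence one-sided at 0 and at T. *)
Definition dtE (R : realType) (n m : nat) (T : R)
    (E : R -> Qspace R n m -> R) (t : R) (q : Qspace R n m) : R :=
  lim (difference_quotient_t E t q @ within `[0, T]%classic (dnbhs t)).

Definition DqE (R : realType) (n m : nat)
    (E : R -> Qspace R n m -> R) (t : R) (q : Qspace R n m) : Qspace R n m :=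
  (\row_(i < n) 'D_((delta_mx 0 i, 0) : Qspace R n m) (E t) q,
   \row_(j < m) 'D_((0, delta_mx 0 j) : Qspace R n m) (E t) q).

Definition C1_energy (R : realType) (n m : nat) (T : R)
    (E : R -> Qspace R n m -> R) : Prop :=
  let D : set (R * Qspace R n m) := `[0, T]%classic `*` setT in
  (forall t q, t \in `[0, T] ->
     cvg (difference_quotient_t E t q @ within `[0, T]%classic (dnbhs t)) /\
     differentiable (E t) q) /\
  [/\ {within D, continuous (fun p => E p.1 p.2)},
      {within D, continuous (fun p => dtE T E p.1 p.2)} &
      {within D, continuous (fun p => DqE E p.1 p.2)}].

Definition assumption_E (R : realType) (n m : nat) (T : R)
    (E : R -> Qspace R n m -> R) : Prop :=
  [/\ C1_energy T E,
      exists2 c : R, 0 < c & forall t q, t \in `[0, T] -> c <= E t q,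
      exists C0 C0' : R, [/\ 0 < C0, 0 < C0' &
        forall t q, t \in `[0, T] -> C0 * enormQ q ^+ 2 - C0' <= E t q] &
      exists2 C1 : R, 0 < C1 &
        forall t q, t \in `[0, T] -> `|dtE T E t q| <= C1 * E t q].

Definition Reps (R : realType) (n m : nat) (alpha : R)
    (R0 : Qspace R n m -> 'rV[R]_m -> R)
    (VVz : Qspace R n m -> 'M[R]_m) (VVu : Qspace R n m -> 'M[R]_n)
    (eps : R) (q v : Qspace R n m) : R :=
  R0 q v.2 + eps * quadpot (VVz q) v.2 + eps `^ alpha * quadpot (VVu q) v.1.

Definition cauchy_solution (R : realType) (n m : nat) (T alpha : R)
    (R0 : Qspace R n m -> 'rV[R]_m -> R)
    (VVz : Qspace R n m -> 'M[R]_m) (VVu : Qspace R n m -> 'M[R]_n)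
    (E : R -> Qspace R n m -> R)
    (eps : R) (qin : Qspace R n m) (q : R -> Qspace R n m) : Prop :=
  [/\ H1_curve T q, q 0 = qin &
      {ae @lebesgue_measure R, forall t, t \in `]0, T[ ->
        exists2 xi,
          subdifferential (Reps alpha R0 VVz VVu eps (q t)) (derive1 q t) xi &
          xi + DqE E t (q t) = 0}].

(* Absolute continuity is what makes the a.e. derivative of the
   parameterization its distributional derivative. *)
Definition parameterization (R : realType) (T Se : R) (t : R -> R) : Prop :=
  [/\ absolutely_continuous_on (fun x : R => `|x|) 0 Se t,
      {in `[0, Se] &, {homo t : x y / x <= y}},
      set_fun `[0, Se]%classic `[0, T]%classic t &
      set_surj `[0, Se]%classic `[0, T]%classic t].

Local Open Scope ereal_scope.

(* Meant for 0 <= tau. The conditions of the displayed cases for tau = 0 may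
   hold simultaneously; both values are then 0, so their order is immaterial. *)
Definition M0red (R : realType) (n m : nat) (alpha : R)
    (R0 : Qspace R n m -> 'rV[R]_m -> R)
    (VVz : Qspace R n m -> 'M[R]_m) (VVu : Qspace R n m -> 'M[R]_n)
    (q : Qspace R n m) (tau : R) (v xi : Qspace R n m) : \bar R :=
  let Vz := (quadpot (VVz q) v.2)%:E in
  let Vu := (quadpot (VVu q) v.1)%:E in
  let Wzs := conjugate (fun z => (R0 q z + quadpot (VVz q) z)%R) xi.2 in
  let Vus := conjugate (quadpot (VVu q)) xi.1 in
  if (0 < tau)%R then
    if (Wzs == 0) && (Vus == 0) then 0 else +oo
  else if (1 < alpha)%R then
    if Vz == 0 then 2%:E * sqrte Vu * sqrte Vus
    else if Vus == 0 then 2%:E * sqrte Vz * sqrte Wzs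
    else +oo
  else if alpha == 1%R then
    2%:E * sqrte (Vz + Vu) * sqrte (Wzs + Vus)
  else
    if Wzs == 0 then 2%:E * sqrte Vu * sqrte Vus
    else if Vu == 0 then 2%:E * sqrte Vz * sqrte Wzs
    else +oo.

Definition M0 (R : realType) (n m : nat) (alpha : R)
    (R0 : Qspace R n m -> 'rV[R]_m -> R)
    (VVz : Qspace R n m -> 'M[R]_m) (VVu : Qspace R n m -> 'M[R]_n)
    (q : Qspace R n m) (tau : R) (v xi : Qspace R n m) : \bar R :=
  (R0 q v.2)%:E + M0red alpha R0 VVz VVu q tau v xi.

Definition energy_identity (R : realType) (n m : nat) (T alpha : R)
    (R0 : Qspace R n m -> 'rV[R]_m -> R)
    (VVz : Qspace R n m -> 'M[R]_m) (VVu : Qspace R n m -> 'M[R]_n)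
    (E : R -> Qspace R n m -> R)
    (t : R -> R) (q : R -> Qspace R n m) (s1 s2 : R) : Prop :=
  let mu := @lebesgue_measure R in
  (E (t s2) (q s2))%:E
  + \int[mu]_(r in `[s1, s2])
      M0 alpha R0 VVz VVu (q r) (derive1 t r) (derive1 q r) (- DqE E (t r) (q r))%R
  = (E (t s1) (q s1))%:E
  + \int[mu]_(r in `[s1, s2]) (dtE T E (t r) (q r) * derive1 t r)%:E.

(* Main.v *)
Require Import Defs.
From HB Require Import structures.
From mathcomp Require Import all_boot all_order all_algebra.
From mathcomp Require Import all_classical all_reals all_analysis.
From mathcomp Require Import measurable_realfun ring lra.

(** By the chain rule for the energy along absolutely continuous curves, the
    energy identity on every interval follows by integration from the pointwise
    identity
      M0 (q, t', q', - DqE (t, q)) = - < DqE (t, q), q' >   a.e. in (0, S)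
    ([energy_identity_of_pointwise]). The left side dominates the right one at
    every point: this is the Fenchel-Young inequality for the viscous potentials,
    optimized over rescalings of the velocity ([M0_ge]). The content of the theorem
    is the opposite inequality, a consequence of the viscous inclusions.

    Fix a viscous solution, its velocity v and its force xi = - DqE. Evaluating the
    subdifferential inequality at the vector with components wu / eps^alpha and
    wz / eps, for fixed wu and wz, gives ([subdifferential_lower_bound])
      R0 (vz) + eps Vz (vz) + eps^alpha Vu (vu) + A / eps + B / eps^alpha <= < xi, v >
    where A and B are the values at wz and wu of the expressions whose suprema
    define the conjugates of R0 + Vz and of Vu at xi. By the inequality of the
    arithmetic and geometric means, the viscous terms dominate
    C + kap sqrt (a Vz (vz) + b Vu (vu)) for all small eps, where the admissible
    constants reflect how eps compares with eps^alpha. The outcome is a family of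
    bounds of the form
      N (v) + C <= < xi, v >,   N sublinear,
    stable under perturbation of the base point ([viscous_velocity_bound]), where v is
    the velocity in physical time. In the limit each becomes
      N (q') + C t' <= - < DqE, q' >   ([lower_bounds_limit]),
    and suitable constants recover all cases of M0 ([M0_le]): arbitrarily large C or
    kap produce the infinite values, kap close to twice the root of a conjugate the
    finite ones.

    The bounds pass to the limit because N is sublinear. Integrated in time over a
    short interval, they become an inequality between N of an increment of the curve
    and increments of energy, time and arc length, without derivatives
    ([sublinear_mean_value], [interval_estimate]); uniform convergence is enough to
    take the limit, and dividing by the length of the interval gives the bound on
    the derivatives.

    For the compactness, increments of (t_eps, q_eps) are dominated by increments of
    the primitives of the speeds m_eps, which converge pointwise, by weak
    convergence, to the absolutely continuous primitive of m. A cluster point for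
    pointwise convergence is then dominated by this primitive and is approximated
    uniformly ([uniform_selection]); the domination also yields t' + |q'| <= m.

    All this rests on the fundamental theorem of calculus for absolutely continuous
    functions ([AC_FTC]). It is reduced, through the variation function, to
    nondecreasing functions, whose Stieltjes measure is absolutely continuous and
    has a Radon-Nikodym density ([monotone_AC_density]). *)

Set Implicit Arguments.
Unset Strict Implicit.
Unset Printing Implicit Defensive.
Import Order.TTheory GRing.Theory Num.Theory.
Import numFieldNormedType.Exports.
Local Open Scope classical_set_scope.
Local Open Scope ring_scope.

(** * Absolutely continuous functions and their variation *)

Local Notation ACR a b f := (absolutely_continuous_on (fun x => `|x|) a b f).

(** An order form of disjointness: unlike disjointness of the open intervals, it
    constrains degenerate ones too, and it passes to subintervals. *)
Definition apart (R : realType) (p q : R * R) : bool :=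
  (p.2 <= q.1) || (q.2 <= p.1).

(** Families are lists, in which an interval can be replaced by the pieces of a
    subdivision. *)
Definition subitvs (R : realType) (a b : R) (s : seq (R * R)) : Prop :=
  all (fun p => [&& a <= p.1, p.1 <= p.2 & p.2 <= b]) s /\
  pairwise (@apart R) s.

Lemma AC_seq (R : realType) (V : zmodType) (N : V -> R) (a b : R) (f : R -> V) :
  absolutely_continuous_on N a b f ->
  forall e : R, 0 < e -> exists2 d : R, 0 < d &
    forall s, subitvs a b s -> \sum_(p <- s) (p.2 - p.1) < d ->
      \sum_(p <- s) N (f p.2 - f p.1) < e.
Proof.
move=> ACf e e0; have [d d0 dP] := ACf e e0; exists d => // s [/allP sab ssep].
have sumE (F : R * R -> R) :
    \sum_(i < size s) F (nth (0, 0) s i) = \sum_(p <- s) F p.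
  by rewrite (big_nth (0, 0)) big_mkord.
rewrite -(sumE (fun p => p.2 - p.1)) => sd.
rewrite -(sumE (fun p => N (f p.2 - f p.1))).
apply: (dP _ (fun i => (nth (0, 0) s i).1) (fun i => (nth (0, 0) s i).2)) => //.
  by move=> i; have /sab/and3P[] : nth (0, 0) s i \in s by exact: mem_nth.
have key (i j : 'I_(size s)) : (i < j)%N ->
    apart (nth (0, 0) s i) (nth (0, 0) s j).
  by move=> ij; move/(pairwiseP (0, 0)) : ssep; apply => //; rewrite inE.
apply/trivIsetP => i j _ _ ij.
apply/seteqP; split => // x [] /=; rewrite !in_itv/= => /andP[x1 x2] /andP[x3 x4].
have [lij|lij|/val_inj eij] := ltngtP i j; last by rewrite eij eqxx in ij.
- by have /orP[h|h] := key _ _ lij; lra.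
- by have /orP[h|h] := key _ _ lij; lra.
Qed.

Lemma AC_unif (R : realType) (V : zmodType) (N : V -> R) (a b : R) (f : R -> V) :
  absolutely_continuous_on N a b f ->
  forall e : R, 0 < e -> exists2 d : R, 0 < d &
    forall x y, a <= x -> x <= y -> y <= b -> y - x < d -> N (f y - f x) < e.
Proof.
move=> ACf e e0; have [d d0 dP] := AC_seq ACf e0; exists d => // x y ax xy yb xyd.
have := dP [:: (x, y)]; rewrite !big_seq1/=; apply => //.
by split => //=; rewrite ax xy yb.
Qed.

Fixpoint steps (R : realType) (x : R) (p : seq R) : seq (R * R) :=
  if p is y :: p' then (x, y) :: steps y p' else [::].

Lemma sum_steps (R : realType) (F : R -> R -> R) (x : R) (p : seq R) :
  \sum_(u <- steps x p) F u.1 u.2 =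
  \sum_(0 <= n < size p) F (nth x (x :: p) n) (nth x (x :: p) n.+1).
Proof.
have gen z : \sum_(u <- steps x p) F u.1 u.2 =
  \sum_(0 <= n < size p) F (nth z (x :: p) n) (nth z (x :: p) n.+1).
  elim: p x => [|y p IH] x /=; first by rewrite big_nil big_geq.
  by rewrite big_cons big_nat_recl//= IH.
exact: gen.
Qed.

Lemma variation_steps (R : realType) (f : R -> R) (x y : R) (p : seq R) :
  variation x y f p = \sum_(u <- steps x p) `|f u.2 - f u.1|.
Proof.
rewrite (sum_steps (fun a b => `|f b - f a|)) /variation.
apply: eq_big_nat => i /andP[_ ip] /=.
by rewrite (set_nth_default x) ?(set_nth_default x y)//= ltnS ltnW.
Qed.

Lemma steps_itv (R : realType) (x : R) (p : seq R) : path <%R x p ->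
  subitvs x (last x p) (steps x p) /\
  \sum_(u <- steps x p) (u.2 - u.1) = last x p - x.
Proof.
elim: p x => [|y p IH] x /=; first by split; rewrite ?big_nil ?subrr.
move=> /andP[xy yp]; have [[sall spw] ssum] := IH _ yp.
have xyW := ltW xy.
have ylast : y <= last y p.
  clear -yp; elim: p y yp => //= z p IH y /andP[yz /IH]; apply: le_trans.
  exact: ltW.
split; last by rewrite big_cons ssum/=; ring.
split => /=.
- rewrite lexx xyW ylast/=; apply/allP => u /(allP sall) /and3P[yu -> ->].
  by rewrite (le_trans xyW yu).
- rewrite spw andbT; apply/allP => u /(allP sall) /and3P[h _ _].
  by rewrite /apart/= h.
Qed.

(** When the intervals of a family are replaced one after the other by subdivisions,
    the family keeps its total length and remains disjoint. Hence the modulus of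
    absolute continuity also controls the sums of total variations. In the induction,
    t collects the intervals that are already subdivided. *)
Lemma AC_totvar_seq (R : realType) (a b : R) (f : R -> R) :
  ACR a b f -> forall e : R, 0 < e -> exists2 d : R, 0 < d &
    forall s t, subitvs a b (s ++ t) -> \sum_(p <- s ++ t) (p.2 - p.1) < d ->
      (\sum_(p <- s) total_variation p.1 p.2 f +
       (\sum_(p <- t) `|f p.2 - f p.1|)%:E <= e%:E)%E.
Proof.
move=> ACf e e0; have [d d0 dP] := AC_seq ACf e0; exists d => // s.
elim: s => [|p s IH] t st sd.
  by rewrite big_nil add0e lee_fin ltW//; exact: dP.
rewrite big_cons -addeA.
set rest := (X in (_ + X <= _)%E).
have step q : itv_partition p.1 p.2 q ->
    ((variation p.1 p.2 f q)%:E + rest <= e%:E)%E.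
  move=> [pq /eqP lq].
  have [[qall qpw] qsum] := steps_itv pq; rewrite lq in qall qpw qsum.
  rewrite variation_steps /rest addeCA -EFinD -big_cat/=.
  apply: IH; last first.
    move: sd; rewrite /= !big_cons !big_cat/= qsum.
    by rewrite addrCA.
  case: st => /= /andP[/and3P[p1 p2 p3]] stall /andP[pst stpw]; split.
    move: stall; rewrite !all_cat => /andP[-> ->]; rewrite andbT/=.
    apply/allP => u /(allP qall)/and3P[u1 u2 u3].
    by rewrite u2 (le_trans p1 u1) (le_trans u3 p3).
  move: pst stpw; rewrite all_cat !pairwise_cat => /andP[ps pt].
  move=> /and3P[rst ws wt]; rewrite ws wt qpw /= andbT.
  have sub w (u : R * R) : u \in steps p.1 q -> apart p w -> apart u w.
    move=> /(allP qall)/and3P[u1 u2 u3] /orP[h|h]; apply/orP; [left|right].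
      exact: le_trans h.
    exact: le_trans h u1.
  rewrite allrel_catr rst andbT; apply/andP; split; apply/allrelP => u w us ws'.
    rewrite /apart orbC; apply: (sub u) => //; exact: (allP ps).
  by apply: (sub w) => //; exact: (allP pt).
have p12 : p.1 <= p.2 by case: st => /= /andP[/and3P[]].
have restfin : rest \is a fin_num.
  have : (rest <= e%:E)%E.
    rewrite /rest; apply: IH.
      case: st => /= /andP[_ stall] /andP[_ stpw]; by split.
    apply: le_lt_trans sd; rewrite /= big_cons lerDr subr_ge0//.
  have rest0 : (0 <= rest)%E.
    apply: adde_ge0; last by rewrite lee_fin sumr_ge0.
    rewrite big_seq; apply: sume_ge0 => i si; apply: total_variation_ge0.
    case: st => /= /andP[_ /allP stall] _.
    by have /stall/and3P[] : i \in s ++ t by rewrite mem_cat si.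
  by move=> re; rewrite ge0_fin_numE// (le_lt_trans re)// ltry.
rewrite -leeBrDr//; apply: ge_ereal_sup => _ [_ [q pq <-] <-].
by rewrite leeBrDr//; exact: step.
Qed.

(** A bounded interval splits into finitely many pieces on each of which the total
    variation is at most 1, by absolute continuity with tolerance 1. *)
Lemma AC_totvar_fin (R : realType) (a b : R) (f : R -> R) :
  ACR a b f -> forall x y, a <= x -> x <= y -> y <= b ->
    total_variation x y f \is a fin_num.
Proof.
move=> ACf; have [d d0 dP] := AC_totvar_seq ACf ltr01.
have short x y : a <= x -> x <= y -> y <= b -> y - x < d ->
    (total_variation x y f <= 1)%E.
  move=> ax xy yb xyd; have := dP [:: (x, y)] [::].
  rewrite /= !big_seq1 big_nil adde0; apply => //.
  by split => //=; rewrite ax xy yb.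
have many k x y : a <= x -> x <= y -> y <= b -> y - x <= k%:R * (d / 2) ->
    (total_variation x y f <= k%:R%:E)%E.
  elim: k x y => [|k IH] x y ax xy yb.
    rewrite mul0r subr_le0 => yx.
    have -> : x = y by apply/eqP; rewrite eq_le xy yx.
    by rewrite total_variationxx.
  move=> le; have [xyd|xyd] := leP (y - x) (d / 2).
    apply: (le_trans (short _ _ ax xy yb _)).
      by apply: (le_lt_trans xyd); rewrite ltr_pdivrMr// ltr_pMr// ltr1n.
    by rewrite lee_fin ler1n.
  have xz : x <= x + d / 2 by rewrite lerDl divr_ge0// ltW.
  have zy : x + d / 2 <= y by lra.
  rewrite (total_variationD _ xz zy) -[k.+1%:R]nat1r EFinD; apply: leeD.
    apply: short => //; first exact: le_trans yb.
    by rewrite [x + _]addrC addrK; lra.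
  apply: IH => //; first exact: le_trans xz.
  by move: le; rewrite -[k.+1%:R]natr1; lra.
move=> x y ax xy yb; rewrite ge0_fin_numE ?total_variation_ge0//.
pose k := Num.bound ((y - x) / (d / 2)).
apply: (le_lt_trans (many k x y ax xy yb _)); last exact: ltry.
rewrite -ler_pdivrMr ?divr_gt0//; apply/ltW/archi_boundP.
by rewrite divr_ge0 ?subr_ge0// divr_ge0// ltW.
Qed.

Definition varfun (R : realType) (a : R) (f : R -> R) (x : R) : R :=
  fine (total_variation a x f).

Lemma varfunB (R : realType) (a b : R) (f : R -> R) : ACR a b f ->
  forall x y, a <= x -> x <= y -> y <= b ->
  (varfun a f y - varfun a f x)%:E = total_variation x y f.
Proof.
move=> ACf x y ax xy yb; have ay := le_trans ax xy; have xb := le_trans xy yb.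
rewrite EFinB !fineK; do 1?exact: (AC_totvar_fin ACf).
rewrite (total_variationD _ ax xy) addeAC subee ?add0e//.
exact: (AC_totvar_fin ACf).
Qed.

Lemma varfun_ge (R : realType) (a b : R) (f : R -> R) : ACR a b f ->
  forall x y, a <= x -> x <= y -> y <= b ->
  `|f y - f x| <= varfun a f y - varfun a f x.
Proof.
move=> ACf x y ax xy yb; rewrite -lee_fin (varfunB ACf)//.
exact: total_variation_ge.
Qed.

Lemma trivIset_apart (R : realType) k (l r : 'I_k -> R) (i j : 'I_k) :
  trivIset [set: 'I_k] (fun i => `]l i, r i[%classic) -> i != j ->
  l i < r i -> l j < r j -> apart (l i, r i) (l j, r j).
Proof.
move=> tI ij li lj; rewrite /apart/= leNgt [X in _ || X]leNgt -negb_and.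
apply/negP => /andP[h1 h2].
move/trivIsetP : tI => /(_ i j I I ij)/seteqP.
move=> [/(_ ((Num.max (l i) (l j) + Num.min (r i) (r j)) / 2)) h _].
by apply: h; split; rewrite /= in_itv/=;
  case: (leP (l i) (l j)) => ?; case: (leP (r i) (r j)) => ?; lra.
Qed.

(** Degenerate members may lie inside other members without breaking disjointness of
    the open intervals, but not [apart]; they are dropped, as they contribute nothing
    to the sums of interest. *)
Lemma family_subitvs (R : realType) (a b : R) k (l r : 'I_k -> R) :
  (forall i, a <= l i /\ l i <= r i /\ r i <= b) ->
  trivIset [set: 'I_k] (fun i => `]l i, r i[%classic) ->
  subitvs a b [seq (l i, r i) | i <- enum 'I_k & l i < r i] /\
  forall F : R -> R -> R, (forall x, F x x = 0) ->
    \sum_(p <- [seq (l i, r i) | i <- enum 'I_k & l i < r i]) F p.1 p.2 =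
    \sum_(i < k) F (l i) (r i).
Proof.
move=> lr tI; split; last first.
  move=> F F0; rewrite big_map big_filter big_enum_cond big_mkcond/=.
  apply: eq_bigr => i _; case: ltP => // h.
  have [_ [h' _]] := lr i; have -> : l i = r i by apply/eqP; rewrite eq_le h h'.
  by rewrite F0.
split.
  by apply/allP => _ /mapP[i _ ->] /=; have [-> [-> ->]] := lr i.
rewrite pairwise_map.
set s := [seq i <- enum 'I_k | l i < r i].
have us : uniq s by rewrite filter_uniq// enum_uniq.
have sP i : i \in s -> l i < r i by rewrite mem_filter => /andP[].
have sall : all (mem s) s by apply/allP.
move: us; rewrite uniq_pairwise; apply: (sub_in_pairwise _ sall).
move=> i j /= /sP li /sP lj ij; exact: trivIset_apart tI ij li lj.
Qed.

(** Increments of the variation function are total variations, whose sums are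
    controlled by [AC_totvar_seq]. *)
Lemma AC_varfun (R : realType) (a b : R) (f : R -> R) :
  ACR a b f -> ACR a b (varfun a f).
Proof.
move=> ACf e e0; have e20 : 0 < e / 2 by rewrite divr_gt0.
have [d d0 dP] := AC_totvar_seq ACf e20; exists d => // k l r lr tI.
have [ss sF] := family_subitvs lr tI.
rewrite -(sF (fun x y => y - x)) ?subrr//; last by move=> ?; rewrite subrr.
rewrite -(sF (fun x y => `|varfun a f y - varfun a f x|)); last first.
  by move=> x; rewrite subrr normr0.
move: ss; set s := map _ _ => ss sd.
apply: (@le_lt_trans _ _ (e / 2)); last by rewrite ltr_pdivrMr// ltr_pMr// ltr1n.
rewrite -lee_fin -sumEFin.
have := dP s [::]; rewrite cats0 big_nil adde0 => /(_ ss sd); apply: le_trans.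
rewrite big_seq [leRHS]big_seq; apply: lee_sum => p ps.
have [/allP sall _] := ss; have /and3P[p1 p2 p3] := sall _ ps.
rewrite ger0_norm; first by rewrite (varfunB ACf).
by apply: le_trans (varfun_ge ACf _ _ _).
Qed.

Lemma AC_sub (R : realType) (a b : R) (f g : R -> R) :
  ACR a b f -> ACR a b g -> ACR a b (fun x => f x - g x).
Proof.
move=> ACf ACg e e0; have e20 : 0 < e / 2 by rewrite divr_gt0.
have [d1 d10 dP1] := ACf _ e20; have [d2 d20 dP2] := ACg _ e20.
exists (Num.min d1 d2); first by rewrite lt_min d10.
move=> k l r lr tI; rewrite lt_min => /andP[/(dP1 _ _ _ lr tI) h1 /(dP2 _ _ _ lr tI) h2].
rewrite (splitr e); apply: le_lt_trans (ltrD h1 h2).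
rewrite -big_split/=; apply: ler_sum => i _.
have -> : f (r i) - g (r i) - (f (l i) - g (l i)) =
          (f (r i) - f (l i)) - (g (r i) - g (l i)) by ring.
exact: ler_normB.
Qed.

(** * Densities of absolutely continuous functions *)

(** Components of an open set come as abstract intervals, whereas absolute
    continuity speaks of endpoints. *)
Lemma interval_endpoints (R : realType) (a b : R) (J : set R) :
  is_interval J -> J `<=` `]a, b[ -> J !=set0 ->
  exists x y, [/\ x <= y, `]x, y[ `<=` J & J `<=` `[x, y]].
Proof.
move=> iJ Jab [j Jj]; exists (inf J), (sup J).
have hs : has_sup J.
  by split; [exists j|exists b => z /Jab /=; rewrite in_itv/= => /andP[_ /ltW]].
have hi : has_inf J.
  by split; [exists j|exists a => z /Jab /=; rewrite in_itv/= => /andP[/ltW]].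
have sub z : J z -> inf J <= z /\ z <= sup J.
  by move=> Jz; split; [apply: ge_inf Jz; exact: hi.2|apply: ub_le_sup Jz; exact: hs.2].
split.
- by have [h1 h2] := sub _ Jj; exact: le_trans h2.
- move=> z /=; rewrite in_itv/= => /andP[iz zs].
  have [u Ju uz] := inf_lt hi.1 iz; have [v Jv zv] := sup_gt hs.1 zs.
  by apply: (iJ u v) => //; rewrite !ltW.
- by move=> z /sub[? ?] /=; rewrite in_itv/=; apply/andP.
Qed.

Section monotone_AC.
Context (R : realType) (a b : R) (F : R -> R).
Hypotheses (ab : a <= b) (ACF : ACR a b F).
Hypothesis (ndF : forall x y, a <= x -> x <= y -> y <= b -> F x <= F y).

(* F is extended by constants outside [a, b], so that its Stieltjes measure is
   defined on the whole line. *)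
Let clamp (x : R) := Num.max a (Num.min x b).
Let G x := F (clamp x).

Let clampP x : a <= clamp x /\ clamp x <= b.
Proof. by rewrite /clamp le_max lexx ge_max ab ge_min lexx orbT. Qed.

Let clamp_le x y : x <= y -> clamp x <= clamp y /\ clamp y - clamp x <= y - x.
Proof.
move=> xy; rewrite /clamp; move: ab.
by case: (leP x b) => ?; case: (leP y b) => ?; case: (leP a x) => ?;
  case: (leP a y) => ?; case: (leP a b) => ?; split; lra.
Qed.

Let clamp_id x : a <= x -> x <= b -> clamp x = x.
Proof. by move=> ax xb; rewrite /clamp min_l// max_r. Qed.

Let G_nd : {homo G : x y / x <= y}.
Proof.
by move=> x y /clamp_le[h _]; apply: ndF => //; [exact: (clampP x).1|exact: (clampP y).2].
Qed.

Let G_unif (e : R) : 0 < e -> exists2 d : R, 0 < d & forall x y, `|x - y| < d -> `|G x - G y| < e.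
Proof.
move=> e0; have [d d0 dP] := AC_unif ACF e0; exists d => // x y.
wlog xy : x y / y <= x.
  move=> h; have [/h //|/ltW/h] := leP y x.
  by rewrite distrC => h' /h'; rewrite distrC.
rewrite ger0_norm ?subr_ge0// => xyd; have [h1 h2] := clamp_le xy.
apply: dP => //; [exact: (clampP y).1|exact: (clampP x).2|].
exact: le_lt_trans xyd.
Qed.

Let G_continuous : continuous G.
Proof.
move=> x; apply/cvgrPdist_lt => e /G_unif[d d0 dP]; near=> y; apply: dP.
by near: y; exists d.
Unshelve. all: by end_near. Qed.

Let G_rc : right_continuous G.
Proof. exact: right_continuousW. Qed.

Let Gc : cumulative R R := HB.pack G (isCumulative.Build R _ R G G_nd G_rc).

Let nu : {measure set (measurableTypeR R) -> \bar R} := lebesgue_stieltjes_measure Gc.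
Local Notation mu := (@lebesgue_measure R).

Let nu_ocitv x y : x <= y -> nu `]x, y]%classic = (G y - G x)%:E.
Proof.
move=> xy; rewrite /nu.
rewrite /= /lebesgue_stieltjes_measure /measure_extension.
rewrite measurable_mu_extE/=; last exact: is_ocitv.
by rewrite wlength_itv_bnd.
Qed.

Let nu_ccitv x y : x <= y -> (nu `[x, y]%classic <= (G y - G x)%:E)%E.
Proof.
move=> xy; apply/lee_addgt0Pr => e e0.
have [d d0 dP] := G_unif e0.
have sub : `[x, y] `<=` `]x - d / 2, y].
  move=> z /=; rewrite !in_itv/= => /andP[xz ->]; rewrite andbT.
  by apply: lt_le_trans xz; rewrite ltrBlDr ltrDl divr_gt0.
apply: (@le_trans _ _ (nu `]x - d / 2, y]%classic)).
  by apply: le_measure => //; rewrite inE; exact: measurable_itv.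
rewrite nu_ocitv; last by rewrite lerBlDr ler_wpDr// divr_ge0// ltW.
rewrite -EFinD lee_fin.
have := dP x (x - d / 2); rewrite subKr gtr0_norm ?divr_gt0//.
rewrite ltr_pdivrMr// ltr_pMr// ltr1n => /(_ isT)/ltW.
by move/ler_normlP => [_]; lra.
Qed.

Let mab : measurable (`]a, b]%classic : set (measurableTypeR R)).
Proof. exact: measurable_itv. Qed.

Let nuab_fin : (nu `]a, b]%classic < +oo)%E.
Proof. by rewrite nu_ocitv// ltry. Qed.

Let nuab : {finite_measure set (measurableTypeR R) -> \bar R} := mfrestr mab nuab_fin.

(** An open set is the disjoint union of countably many intervals. Absolute
    continuity bounds the sum of the increments of F over any finitely many of them,
    hence the Stieltjes measure. The bound b + 1 leaves room for open neighbourhoods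
    of subsets of ]a, b]. *)
Let open_small e : 0 < e -> exists2 d : R, 0 < d & forall U, open U ->
  U `<=` `]a, (b + 1)[ -> (mu U < d%:E)%E -> (nu U <= e%:E)%E.
Proof.
move=> e0; have [d d0 dP] := ACF e0; exists d => // U oU Uab Ud.
pose I := open_disjoint_itv oU.
have UI : U = \bigcup_i I i by exact: open_disjoint_itv_bigcup.
have IU i : I i `<=` U by rewrite [X in _ `<=` X]UI; exact: bigcup_sup.
have tI : trivIset setT I by exact: open_disjoint_itv_trivIset.
have mI i : measurable (I i : set (measurableTypeR R)).
  by apply: open_measurable; exact: open_disjoint_itv_open.
have ends i : exists p : R * R, [/\ p.1 <= p.2, `]p.1, p.2[ `<=` I i,
    (nu (I i) <= (G p.2 - G p.1)%:E)%E & ((p.2 - p.1)%:E <= mu (I i))%E].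
  have [->|/set0P I0] := eqVneq (I i) set0.
    by exists (a, a); rewrite /= !measure0 !subrr; split => // x /=; rewrite in_itv/=; lra.
  have Iab : I i `<=` `]a, (b + 1)[ by move=> z /IU /Uab.
  have Ii : is_interval (I i) by exact: open_disjoint_itv_is_interval.
  have [x [y [xy xyI Ixy]]] := interval_endpoints Ii Iab I0.
  exists (x, y); split => //=.
    apply: (le_trans _ (nu_ccitv xy)); apply: le_measure => //; rewrite inE.
      exact: mI.
    exact: measurable_itv.
  apply: (@le_trans _ _ (mu `]x, y[%classic)).
    by rewrite lebesgue_measure_itv/= lte_fin; case: ltP => // yx; rewrite lee_fin subr_le0.
  by apply: le_measure => //; rewrite inE//; exact: measurable_itv.
have {ends}[p pP] := choice ends.
rewrite [X in nu X]UI measure_bigcup//.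
apply: lime_le.
  by apply: is_cvg_nneseries => *; exact: measure_ge0.
apply: nearW => k.
apply: (@le_trans _ _ (\sum_(0 <= i < k | i \in [set: nat]) (G (p i).2 - G (p i).1)%:E)%E).
  by apply: lee_sum => i _; have [] := pP i.
rewrite sumEFin lee_fin.
have -> : \sum_(0 <= i < k | i \in [set: nat]) (G (p i).2 - G (p i).1) =
    \sum_(i < k) `|F (clamp (p i).2) - F (clamp (p i).1)|.
  rewrite big_mkord; apply: eq_big => [i|i _]; first by rewrite in_setT.
  by rewrite ger0_norm// subr_ge0; apply: G_nd; have [] := pP i.
apply/ltW/(dP k (fun i => clamp (p i).1) (fun i => clamp (p i).2)).
- move=> i; split; first exact: (clampP _).1.
  by split; [have [h _ _ _] := pP i; exact: (clamp_le h).1|exact: (clampP _).2].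
- apply/trivIsetP => i j _ _ ij; apply/seteqP; split => // z [].
  have sub l : `]clamp (p l).1, clamp (p l).2[%classic z -> I l z.
    have [_ pI _ _] := pP l.
    move=> zl; apply: pI; move: zl; rewrite /= !in_itv/= => /andP[].
    rewrite /clamp gt_max lt_max gt_min !lt_min => /andP[az h1] /orP[h2|/andP[-> h3]].
      by move: az; rewrite ltNge (ltW h2).
    by case/orP: h1 => [->//|]; rewrite ltNge (ltW h3).
  move=> /sub zi /sub zj.
  have /trivIsetP/(_ (val i) (val j) Logic.I Logic.I ij)/seteqP[/(_ z) h _] := tI.
  exact: h.
- rewrite -lte_fin; apply: le_lt_trans Ud.
  apply: (@le_trans _ _ (\sum_(i < k) mu (I i))%E).
    rewrite -sumEFin; apply: lee_sum => i _; have [h _ _] := pP i.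
    by apply: le_trans; rewrite lee_fin; exact: (clamp_le h).2.
  rewrite -(@measure_bigsetU_ord _ _ _ mu k xpredT (fun i => I i)) => [|i|]; last 2 first.
  - exact: mI.
  - by apply/trivIsetP => i j _ _ ij; move/trivIsetP : tI; apply.
  apply: le_measure; rewrite ?inE.
  - by apply: bigsetU_measurable => i _; exact: mI.
  - exact: open_measurable.
  - by rewrite [X in _ `<=` X]UI; exact: bigsetU_bigcup.
Qed.

(** By outer regularity, a null set lies in open sets of arbitrarily small Lebesgue
    measure, to which [open_small] applies. *)
Let nuab_dominated : null_dominates mu nuab.
Proof.
apply/null_content_dominatesP => A mA A0.
apply/eqP; rewrite eq_le measure_ge0 andbT.
apply/lee_addgt0Pr => e e0; rewrite add0e.
have [d d0 dP] := open_small e0.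
set D := A `&` `]a, b].
have mD : measurable D by apply: measurableI => //; exact: measurable_itv.
have D0 : mu D = 0%E by apply: (subset_measure0 (B := A)) => // x [].
have [|U [oU DU Ud]] := lebesgue_regularity_outer mD _ d0; first by rewrite [ltLHS]D0.
pose U' := U `&` `]a, (b + 1)[.
have oU' : open U' by apply: openI => //; exact: interval_open.
have mU := open_measurable oU; have mU' := open_measurable oU'.
apply: (@le_trans _ _ (nu U')).
  apply: le_measure; rewrite ?inE// => x [Ax xab].
  split; first by apply: DU; split.
  by move: xab; rewrite /= !in_itv/= => /andP[? ?]; apply/andP; split; lra.
apply: dP => // [x []//|]; apply: le_lt_trans Ud.
apply: (@le_trans _ _ (mu (U `\` D `|` D))).
  apply: le_measure; rewrite ?inE//; first by apply: measurableU => //; exact: measurableD.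
  by move=> x [Ux _]; have [|] := pselect (D x); [right|left].
apply: (le_trans (measureU2 _ _ _)) => //; first exact: measurableD.
by rewrite [X in (_ + X)%E]D0 adde0.
Qed.

(** The density is the Radon-Nikodym derivative of the Stieltjes measure of F. *)
Lemma monotone_AC_density : exists g : R -> R,
  mu.-integrable setT (EFin \o g) /\
  forall x y, a <= x -> x <= y -> y <= b ->
    (F y - F x)%:E = (\int[mu]_(t in `]x, y]) (g t)%:E)%E.
Proof.
have [g [_ gfin gint gE]] := radon_nikodym_sigma_finite nuab_dominated.
have gfine : EFin \o (fine \o g) = g by apply/funext => x /=; rewrite fineK.
exists (fine \o g); rewrite gfine; split=> // x y ax xy yb.
under eq_integral do rewrite fineK//.
rewrite -gE; last exact: measurable_itv.
rewrite /nuab /= /mfrestr /mrestr (_ : _ `&` _ = `]x, y]%classic); last first.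
  apply/seteqP; split => [z []//|z /= zxy]; split => //.
  by move: zxy; rewrite !in_itv/= => /andP[? ?]; apply/andP; split; lra.
have ay := le_trans ax xy; have xb := le_trans xy yb.
by rewrite -/nu nu_ocitv// /G !clamp_id.
Qed.

End monotone_AC.

Lemma aeW (R : realType) (P Q : R -> Prop) : (forall x, P x -> Q x) ->
  {ae @lebesgue_measure R, forall x, P x} -> {ae @lebesgue_measure R, forall x, Q x}.
Proof. by move=> PQ; apply: filterS => //; exact: (ae_filter_ringOfSetsType (@lebesgue_measure R)). Qed.

Lemma aeI (R : realType) (P Q : R -> Prop) :
  {ae @lebesgue_measure R, forall x, P x} -> {ae @lebesgue_measure R, forall x, Q x} ->
  {ae @lebesgue_measure R, forall x, P x /\ Q x}.
Proof. by apply: filterI => //; exact: (ae_filter_ringOfSetsType (@lebesgue_measure R)). Qed.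

Lemma aeT (R : realType) (P : R -> Prop) :
  (forall x, P x) -> {ae @lebesgue_measure R, forall x, P x}.
Proof. by move=> h; apply: nearW => //; exact: (ae_filter_ringOfSetsType (@lebesgue_measure R)). Qed.

Lemma ae_neq (R : realType) (c : R) : {ae @lebesgue_measure R, forall x, x != c}.
Proof.
exists [set c]; split; first exact: measurable_set1.
  exact: lebesgue_measure_set1.
by move=> x /= /negP; rewrite negbK => /eqP.
Qed.

Lemma ae_Rintegral_ge0 (R : realType) (D : set (measurableTypeR R)) (f : R -> R) :
  measurable D -> (@lebesgue_measure R).-integrable D (EFin \o f) ->
  {ae @lebesgue_measure R, forall x, D x -> 0 <= f x} ->
  0 <= \int[@lebesgue_measure R]_(x in D) f x.
Proof.
move=> mD intf f0; have mf := measurable_int _ intf.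
have E : (\int[@lebesgue_measure R]_(x in D) (f x)%:E =
          \int[@lebesgue_measure R]_(x in D) maxe (f x)%:E 0)%E.
  apply: ae_eq_integral => //; first exact: measurable_maxe.
  apply: aeW f0 => x f0 Dx /=; rewrite max_l// lee_fin; exact: f0.
rewrite /Rintegral E; apply: fine_ge0; apply: integral_ge0 => x _.
by rewrite le_max lexx orbT.
Qed.

Lemma ae_le_Rintegral (R : realType) (D : set (measurableTypeR R)) (f g : R -> R) :
  measurable D -> (@lebesgue_measure R).-integrable D (EFin \o f) ->
  (@lebesgue_measure R).-integrable D (EFin \o g) ->
  {ae @lebesgue_measure R, forall x, D x -> f x <= g x} ->
  \int[@lebesgue_measure R]_(x in D) f x <= \int[@lebesgue_measure R]_(x in D) g x.
Proof.
move=> mD intf intg fg; rewrite -subr_ge0 -RintegralB//.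
apply: ae_Rintegral_ge0 => //.
  by have := integrableB mD intg intf; apply: eq_integrable.
by apply: aeW fg => x fg Dx; rewrite subr_ge0; exact: fg.
Qed.

(** On [a, b] the function f differs by a constant from the primitive of g started
    at - oo, to which the Lebesgue differentiation theorem applies. *)
Lemma derive_of_density (R : realType) (a b : R) (f g : R -> R) :
  (@lebesgue_measure R).-integrable setT (EFin \o g) ->
  (forall x y, a <= x -> x <= y -> y <= b ->
    f y - f x = \int[@lebesgue_measure R]_(t in `]x, y]) g t) ->
  {ae @lebesgue_measure R, forall x, x \in `]a, b[ -> is_derive x (1 : R) f (g x)}.
Proof.
move=> intg fE; set mu := @lebesgue_measure R.
have intS y : mu.-integrable `]-oo, y] (EFin \o g).
  by apply: integrableS intg => //; exact: measurable_itv.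
have locg : locally_integrable setT g.
  by apply: open_integrable_locally => //; exact: openT.
pose G x := \int[mu]_(t in `]-oo, x]) g t.
have := FTC1Ny intS locg; apply: aeW => x; rewrite -/mu => -[dG G'] xab.
have Gx : is_derive x (1 : R) G (g x) by rewrite -G' derive1E; exact: DeriveDef.
have GE y z : a <= y -> y <= z -> z <= b -> f z - f y = G z - G y.
  by move=> ay yz zb; rewrite fE// /G Rintegral_itvB.
move: (xab); rewrite in_itv/= => /andP[ax xb].
have dK : is_derive x (1 : R) (G + cst (f x - G x)) (g x).
  by rewrite -[g x]addr0; apply: is_deriveD.
apply: near_eq_is_derive dK; near=> y.
have : y \in `]a, b[ by near: y; exact: near_in_itvoo.
rewrite in_itv/= => /andP[ay yb] /=.
rewrite !fctE; have [xy|/ltW xy] := leP x y.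
  by have := GE x y (ltW ax) xy (ltW yb); lra.
by have := GE y x (ltW ay) xy (ltW xb); lra.
Unshelve. all: by end_near. Qed.

(** f is the difference of its variation function and of the excess of the latter
    over f, which are both nondecreasing and absolutely continuous. *)
Lemma AC_density (R : realType) (a b : R) (f : R -> R) : a <= b -> ACR a b f ->
  exists g : R -> R, (@lebesgue_measure R).-integrable setT (EFin \o g) /\
  forall x y, a <= x -> x <= y -> y <= b ->
    f y - f x = \int[@lebesgue_measure R]_(t in `]x, y]) g t.
Proof.
move=> ab ACf; have ACv := AC_varfun ACf; have ACw := AC_sub ACv ACf.
have nd1 x y : a <= x -> x <= y -> y <= b -> varfun a f x <= varfun a f y.
  by move=> ax xy yb; rewrite -subr_ge0; apply: le_trans (varfun_ge ACf ax xy yb).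
have nd2 x y : a <= x -> x <= y -> y <= b ->
    varfun a f x - f x <= varfun a f y - f y.
  move=> ax xy yb; have := varfun_ge ACf ax xy yb.
  by move/(le_trans (ler_norm _)); lra.
have [g1 [i1 g1E]] := monotone_AC_density ab ACv nd1.
have [g2 [i2 g2E]] := monotone_AC_density ab ACw nd2.
exists (fun x => g1 x - g2 x); split.
  by have := integrableB measurableT i1 i2; apply: eq_integrable.
move=> x y ax xy yb.
have sub (g : R -> R) : (@lebesgue_measure R).-integrable setT (EFin \o g) ->
    (@lebesgue_measure R).-integrable `]x, y] (EFin \o g).
  by apply: integrableS => //; exact: measurable_itv.
rewrite RintegralB//; do ?[exact: measurable_itv|exact: sub].
by rewrite /Rintegral -g1E// -g2E//=; ring.
Qed.

Lemma AC_FTC (R : realType) (a b : R) (f : R -> R) : a <= b -> ACR a b f ->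
  exists g : R -> R, [/\ (@lebesgue_measure R).-integrable setT (EFin \o g),
    forall x y, a <= x -> x <= y -> y <= b ->
      f y - f x = \int[@lebesgue_measure R]_(t in `]x, y]) g t &
    {ae @lebesgue_measure R, forall x, x \in `]a, b[ -> is_derive x (1 : R) f (g x)}].
Proof.
move=> ab ACf; have [g [ig gE]] := AC_density ab ACf.
by exists g; split => //; exact: derive_of_density.
Qed.

Lemma AC_derive_le0 (R : realType) (a b : R) (f : R -> R) : ACR a b f ->
  {ae @lebesgue_measure R, forall x, x \in `]a, b[ ->
     forall d : R, is_derive x (1 : R) f d -> d <= 0} ->
  forall x y, a <= x -> x <= y -> y <= b -> f y <= f x.
Proof.
move=> ACf f'0 x y ax xy yb.
have ab : a <= b by exact: le_trans (le_trans xy yb).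
have [g [ig gE g']] := AC_FTC ab ACf.
rewrite -subr_le0 gE//; set mu := @lebesgue_measure R.
have mE : measurable (`]x, y]%classic : set (measurableTypeR R)) by exact: measurable_itv.
have igE : mu.-integrable `]x, y] (EFin \o g) by apply: integrableS ig.
have i0 : mu.-integrable `]x, y] (EFin \o cst 0) by exact: integrable0.
apply: (le_trans (ae_le_Rintegral mE igE i0 _)); last by rewrite Rintegral_cst// mul0r.
apply: aeW (aeI (aeI g' f'0) (ae_neq b)) => z [[g'z f'z] zb] /=.
rewrite in_itv/= => /andP[xz zy].
have zab : z \in `]a, b[.
  by rewrite in_itv/= (le_lt_trans ax xz) lt_neqAle zb (le_trans zy yb).
exact: f'z (g'z zab).
Qed.

(** * Euclidean structure and coordinates of the state space *)

Lemma is_derive1_cvg (R : realType) (V : normedModType R) (f : R -> V) (t : R) (d : V) :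
  is_derive t (1 : R) f d <->
  (h^-1 *: (f (h + t) - f t) @[h --> (0 : R)^'] --> d).
Proof.
have E : (fun h : R => h^-1 *: ((f \o shift t) (h *: (1 : R)) - f t)) =
         (fun h => h^-1 *: (f (h + t) - f t)).
  by apply/funext => h /=; rewrite [_ *: 1]mulr1.
split.
  by case; rewrite /derivable /derive E => c <-.
move=> h; apply: DeriveDef; rewrite /derivable /derive E.
  by apply/cvg_ex; exists d.
exact: cvg_lim.
Qed.

Lemma is_derive1_unique (R : realType) (V : normedModType R) (f : R -> V) (t : R) (d d' : V) :
  is_derive t (1 : R) f d -> is_derive t (1 : R) f d' -> d = d'.
Proof. by move=> h h'; rewrite -(@derive_val _ _ _ _ _ _ _ h) (@derive_val _ _ _ _ _ _ _ h'). Qed.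

Lemma is_derive1_val (R : realType) (V : normedModType R) (f : R -> V) (t : R) (d : V) :
  is_derive t (1 : R) f d -> derive1 f t = d.
Proof. by move=> h; rewrite derive1E; apply: derive_val. Qed.

Lemma cvg_sumr (R : realType) (V : normedModType R) (T I : Type) (F : set_system T)
  (FF : Filter F) (r : seq I) (f : I -> T -> V) (l : I -> V) :
  (forall i, f i x @[x --> F] --> l i) ->
  \sum_(i <- r) f i x @[x --> F] --> \sum_(i <- r) l i.
Proof.
move=> h; elim: r => [|i r IH].
  under eq_fun do rewrite big_nil; rewrite big_nil; exact: cvg_cst.
under eq_fun do rewrite big_cons.
by rewrite big_cons; apply: cvgD.
Qed.

Section coordinates.
Context (R : realType) (n m : nat).
Local Notation Q := (Qspace R n m).
Local Notation K := ('I_n + 'I_m)%type.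

(** Coordinates are indexed by one finite type, so that both components of the state
    are treated at once. *)
Definition crd (k : K) (q : Q) : R :=
  match k with inl i => q.1 0 i | inr j => q.2 0 j end.

Definition bas (k : K) : Q :=
  match k with inl i => (delta_mx 0 i, 0) | inr j => (0, delta_mx 0 j) end.

Lemma crdD k p q : crd k (p + q) = crd k p + crd k q.
Proof. by case: k => i /=; rewrite mxE. Qed.
Lemma crdB k p q : crd k (p - q) = crd k p - crd k q.
Proof. by case: k => i /=; rewrite !mxE. Qed.
Lemma crdZ k (a : R) q : crd k (a *: q) = a * crd k q.
Proof. by case: k => i /=; rewrite mxE. Qed.

Lemma crd_expand (q : Q) : q = \sum_k crd k q *: bas k.
Proof.
rewrite big_sumType/=.
have -> : \sum_(i < n) q.1 0 i *: ((delta_mx 0 i, 0) : Q) = (q.1, 0).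
  rewrite [in RHS](row_sum_delta q.1).
  elim/big_rec2: _ => [//|i y x _ ->]; congr pair; rewrite /= ?scaler0 ?addr0//.
have -> : \sum_(i < m) q.2 0 i *: ((0, delta_mx 0 i) : Q) = (0, q.2).
  rewrite [in RHS](row_sum_delta q.2).
  elim/big_rec2: _ => [//|i y x _ ->]; congr pair; rewrite /= ?scaler0 ?addr0//.
by rewrite [LHS]surjective_pairing; congr pair; rewrite /= ?addr0 ?add0r.
Qed.

Lemma dotQ_crd (p q : Q) : dotQ p q = \sum_k crd k p * crd k q.
Proof. by rewrite big_sumType. Qed.

Lemma dotQC (p q : Q) : dotQ p q = dotQ q p.
Proof. by rewrite !dotQ_crd; apply: eq_bigr => k _; rewrite mulrC. Qed.
Lemma dotQDl (p q r : Q) : dotQ (p + q) r = dotQ p r + dotQ q r.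
Proof. by rewrite !dotQ_crd -big_split/=; apply: eq_bigr => k _; rewrite crdD mulrDl. Qed.
Lemma dotQZl (a : R) (p q : Q) : dotQ (a *: p) q = a * dotQ p q.
Proof. by rewrite !dotQ_crd mulr_sumr; apply: eq_bigr => k _; rewrite crdZ mulrA. Qed.
Lemma dotQDr (p q r : Q) : dotQ p (q + r) = dotQ p q + dotQ p r.
Proof. by rewrite dotQC dotQDl !(dotQC p). Qed.
Lemma dotQZr (a : R) (p q : Q) : dotQ p (a *: q) = a * dotQ p q.
Proof. by rewrite dotQC dotQZl (dotQC p). Qed.
Lemma dotQNl (p q : Q) : dotQ (- p) q = - dotQ p q.
Proof. by rewrite -scaleN1r dotQZl mulN1r. Qed.
Lemma dotQBr (p q r : Q) : dotQ p (q - r) = dotQ p q - dotQ p r.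
Proof. by rewrite dotQDr -scaleN1r dotQZr mulN1r. Qed.
Lemma dotQ_ge0 (p : Q) : 0 <= dotQ p p.
Proof. by rewrite dotQ_crd; apply: sumr_ge0 => k _; rewrite -expr2 sqr_ge0. Qed.

(** For C > 0, this is the inequality at the minimizer - B / C. For C < 0 the
    polynomial is negative at one of two opposite large arguments, and for C = 0 a
    nonzero slope makes it negative somewhere, so that B = 0. *)
Lemma quadratic_ge0_discr (A B C : R) :
  (forall x : R, 0 <= A + x * (2 * B) + x ^+ 2 * C) -> B ^+ 2 <= A * C.
Proof.
move=> h; have A0 : 0 <= A by have := h 0; rewrite mul0r expr0n/= mul0r !addr0.
have [C0|C0|C0] := ltgtP C 0.
- exfalso; pose s := 1 + A / - C.
  have sC : s * - C = - C + A by rewrite /s; field; rewrite lt_eqF.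
  have s1 : 1 <= s by rewrite /s lerDl divr_ge0// oppr_ge0 ltW.
  have := h s; have := h (- s); rewrite sqrrN.
  have : - C + A <= s ^+ 2 * - C by rewrite expr2 -mulrA sC ler_peMl//; lra.
  lra.
- have := h (- B / C).
  have -> : A + - B / C * (2 * B) + (- B / C) ^+ 2 * C = (A * C - B ^+ 2) / C.
    by field; rewrite gt_eqF.
  by rewrite pmulr_lge0 ?invr_gt0// subr_ge0.
- rewrite C0 mulr0; have [->|B0] := eqVneq B 0; first by rewrite expr0n.
  exfalso; have := h (- (A + 1) / (2 * B)); rewrite C0 mulr0 addr0.
  have -> : - (A + 1) / (2 * B) * (2 * B) = - (A + 1) by field.
  lra.
Qed.

Lemma dotQ_CS (p q : Q) : dotQ p q <= enormQ p * enormQ q.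
Proof.
have [|d0] := leP (dotQ p q) 0.
  by move/le_trans; apply; rewrite mulr_ge0 ?sqrtr_ge0.
have : dotQ p q ^+ 2 <= dotQ p p * dotQ q q.
  apply: quadratic_ge0_discr => x.
  have := dotQ_ge0 (p + x *: q).
  rewrite !dotQDl !dotQDr !dotQZl !dotQZr (dotQC q p) expr2; lra.
rewrite -sqrtrM ?dotQ_ge0// => h.
by rewrite -[leLHS]gtr0_norm// -sqrtr_sqr ler_wsqrtr.
Qed.

Lemma enormQ_ge0 (p : Q) : 0 <= enormQ p. Proof. exact: sqrtr_ge0. Qed.
Lemma sqr_enormQ (p : Q) : enormQ p ^+ 2 = dotQ p p.
Proof. by rewrite sqr_sqrtr ?dotQ_ge0. Qed.
Lemma enormQZ (a : R) (p : Q) : enormQ (a *: p) = `|a| * enormQ p.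
Proof. by rewrite /enormQ dotQZl dotQZr mulrA -expr2 sqrtrM ?sqr_ge0// sqrtr_sqr. Qed.
Lemma enormQD (p q : Q) : enormQ (p + q) <= enormQ p + enormQ q.
Proof.
rewrite -[leRHS]ger0_norm ?addr_ge0 ?enormQ_ge0// -sqrtr_sqr ler_wsqrtr//.
rewrite sqrrD !sqr_enormQ dotQDl !dotQDr (dotQC q p).
have := dotQ_CS p q; rewrite mulr2n; lra.
Qed.
Lemma enormQN (p : Q) : enormQ (- p) = enormQ p.
Proof. by rewrite -scaleN1r enormQZ normrN1 mul1r. Qed.

Lemma crd_le_enormQ k (p : Q) : `|crd k p| <= enormQ p.
Proof.
rewrite -sqrtr_sqr ler_wsqrtr// dotQ_crd (bigD1 k)//= expr2 lerDl.
by apply: sumr_ge0 => i _; rewrite -expr2 sqr_ge0.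
Qed.

Lemma enormQ_le_sum (p : Q) : enormQ p <= \sum_k `|crd k p|.
Proof.
rewrite -[leRHS]ger0_norm ?sumr_ge0// -sqrtr_sqr ler_wsqrtr// dotQ_crd expr2.
rewrite mulr_suml; apply: ler_sum => k _.
apply: le_trans (ler_norm _) _; rewrite normrM ler_wpM2l// (bigD1 k)//= lerDl.
by rewrite sumr_ge0.
Qed.

Lemma crd_continuous k : continuous (crd k).
Proof.
case: k => i q /=.
- apply: (@cvg_comp _ _ _ (fun q : Q => q.1) (fun u : 'rV[R]_n => u 0 i) _ (nbhs q.1)).
    exact: cvg_fst.
  exact: coord_continuous.
- apply: (@cvg_comp _ _ _ (fun q : Q => q.2) (fun u : 'rV[R]_m => u 0 i) _ (nbhs q.2)).
    exact: cvg_snd.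
  exact: coord_continuous.
Qed.

Lemma cvg_crd (T : Type) (F : set_system T) (FF : Filter F) (u : T -> Q) (d : Q) :
  (forall k, crd k (u x) @[x --> F] --> crd k d) <-> (u x @[x --> F] --> d).
Proof.
split => [h|h k]; last exact: cvg_comp h (@crd_continuous k d).
rewrite [d]crd_expand.
have -> : u = (fun x => \sum_k crd k (u x) *: bas k).
  by apply/funext => x; exact: crd_expand.
by apply: cvg_sumr => k; apply: cvgZr_tmp.
Qed.

Lemma enormQ_continuous : continuous (@enormQ R n m).
Proof.
move=> q; apply: (@cvg_comp _ _ _ (fun q : Q => dotQ q q) Num.sqrt _ (nbhs (dotQ q q))).
  have -> : (fun q : Q => dotQ q q) = (fun q : Q => \sum_k crd k q * crd k q).
    by apply/funext => x; rewrite dotQ_crd.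
  rewrite dotQ_crd; apply: cvg_sumr => k.
  by apply: cvgM; exact: crd_continuous.
exact: sqrt_continuous.
Qed.

Lemma is_derive_crd (q : R -> Q) (t : R) (d : Q) :
  (forall k, is_derive t (1 : R) (crd k \o q) (crd k d)) <-> is_derive t (1 : R) q d.
Proof.
have E k : (fun h : R => h^-1 *: ((crd k \o q) (h + t) - (crd k \o q) t)) =
           (fun h => crd k (h^-1 *: (q (h + t) - q t))).
  by apply/funext => h; rewrite crdZ crdB.
split => [h|/is_derive1_cvg/cvg_crd h k]; apply/is_derive1_cvg.
  by apply/cvg_crd => k; have /is_derive1_cvg := h k; rewrite E.
by rewrite E.
Qed.

End coordinates.

(** * Calculus along absolutely continuous curves *)

Section AC_closure.
Context (R : realType) (a b : R).

Lemma AC_dom (V : zmodType) (N : V -> R) (f : R -> V) (F : R -> R) :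
  (forall x y, a <= x -> x <= y -> y <= b -> N (f y - f x) <= F y - F x) ->
  ACR a b F -> absolutely_continuous_on N a b f.
Proof.
move=> fF ACF e /ACF[d d0 dP]; exists d => // k l r lr tI /(dP _ _ _ lr tI).
apply: le_lt_trans; apply: ler_sum => i _; have [al [lri rb]] := lr i.
exact: le_trans (fF _ _ al lri rb) (ler_norm _).
Qed.

Lemma AC_scale (c : R) (f : R -> R) : ACR a b f -> ACR a b (fun x => c * f x).
Proof.
move=> ACf e e0; have c0 : 0 < `|c| + 1 by rewrite ltr_wpDl.
have [d d0 dP] := ACf _ (divr_gt0 e0 c0); exists d => // k l r lr tI /(dP _ _ _ lr tI).
rewrite ltr_pdivlMr// => h; apply: le_lt_trans h; rewrite mulr_suml.
by apply: ler_sum => i _; rewrite -mulrBr normrM mulrC ler_wpM2l// lerDl.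
Qed.

Lemma AC_cst (c : R) : ACR a b (fun=> c).
Proof.
move=> e e0; exists 1 => // k l r _ _ _; rewrite big1// => i _.
by rewrite subrr normr0.
Qed.

Lemma AC_id : ACR a b id.
Proof.
move=> e e0; exists e => // k l r lr _; apply: le_lt_trans; apply: ler_sum => i _.
by have [_ [h _]] := lr i; rewrite ger0_norm// subr_ge0.
Qed.

Lemma AC_add (f g : R -> R) : ACR a b f -> ACR a b g -> ACR a b (fun x => f x + g x).
Proof.
move=> ACf /(AC_scale (-1)) /(AC_sub ACf).
by congr absolutely_continuous_on; apply/funext => x; rewrite mulN1r opprK.
Qed.

Lemma AC_sum (I : Type) (r : seq I) (f : I -> R -> R) :
  (forall i, ACR a b (f i)) -> ACR a b (fun x => \sum_(i <- r) f i x).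
Proof.
move=> ACf; elim: r => [|i r IH].
  have -> : (fun x => \sum_(i <- [::]) f i x) = (fun=> 0).
    by apply/funext => x; rewrite big_nil.
  exact: AC_cst.
have -> : (fun x => \sum_(j <- i :: r) f j x) =
          (fun x => f i x + \sum_(j <- r) f j x).
  by apply/funext => x; rewrite big_cons.
exact: AC_add.
Qed.

Lemma AC_subitv (V : zmodType) (N : V -> R) (f : R -> V) (a' b' : R) :
  a <= a' -> b' <= b -> absolutely_continuous_on N a b f ->
  absolutely_continuous_on N a' b' f.
Proof.
move=> aa bb ACf e /ACf[d d0 dP]; exists d => // k l r lr; apply: dP => i.
by have [? [? ?]] := lr i; split; [exact: le_trans aa _|split => //; exact: le_trans bb].
Qed.

Lemma AC_comp_mono (V : zmodType) (N : V -> R) (f : R -> V) (a' b' : R) (tau : R -> R) :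
  N 0 = 0 -> absolutely_continuous_on N a' b' f ->
  (forall x, a <= x -> x <= b -> a' <= tau x /\ tau x <= b') ->
  (forall x y, a <= x -> x <= y -> y <= b -> tau x <= tau y) ->
  ACR a b tau -> absolutely_continuous_on N a b (f \o tau).
Proof.
move=> N0 ACf tauab nd ACt e e0.
have [d1 d10 dP1] := ACf _ e0; have [d d0 dP] := ACt _ d10.
exists d => // k l r lr tI rld.
apply: (dP1 k (tau \o l) (tau \o r)).
- move=> i; have [al [lri rb]] := lr i => /=; split; [|split].
  + exact: (tauab _ al (le_trans lri rb)).1.
  + exact: nd.
  + exact: (tauab _ (le_trans al lri) rb).2.
- apply/trivIsetP => i j _ _ ij; apply/seteqP; split => // z [] /=.
  rewrite !in_itv/= => /andP[z1 z2] /andP[z3 z4].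
  have lri (u : 'I_k) : tau (l u) < tau (r u) -> l u < r u.
    move=> h; have [_ [h' _]] := lr u; rewrite lt_neqAle h' andbT.
    by apply/eqP => E; move: h; rewrite E ltxx.
  have /lri li := lt_trans z1 z2; have /lri lj := lt_trans z3 z4.
  have [al1 [_ br1]] := lr i; have [al2 [_ br2]] := lr j.
  have /orP[h|h] := trivIset_apart tI ij li lj.
  + by have := nd _ _ (le_trans al1 (ltW li)) h (le_trans (ltW lj) br2); lra.
  + by have := nd _ _ (le_trans al2 (ltW lj)) h (le_trans (ltW li) br1); lra.
- apply: le_lt_trans (dP _ _ _ lr tI rld); apply: ler_sum => i _; exact: ler_norm.
Qed.

End AC_closure.

Lemma cvg_dnbhs_right (R : realType) (T : topologicalType) (f : R -> T) (x : R) (l : T) :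
  f y @[y --> x^'] --> l -> f y @[y --> x^'+] --> l.
Proof.
move=> fl A /fl[e e0 eP]; exists e => // y xye xy; apply: eP => //=.
by rewrite gt_eqF.
Qed.

Section sublinear.
Context (R : realType) (n m : nat).
Local Notation Q := (Qspace R n m).

Definition sublinear (N : Q -> R) : Prop :=
  [/\ forall x y, N (x + y) <= N x + N y,
      forall (l : R) x, 0 <= l -> N (l *: x) = l * N x &
      exists2 C : R, 0 <= C & forall x, N x <= C * enormQ x].

Lemma sublinear_lip (N : Q -> R) : sublinear N ->
  exists2 C : R, 0 <= C & forall x y, `|N x - N y| <= C * enormQ (x - y).
Proof.
move=> [ND _ [C C0 NC]]; exists C => // x y.
have h u v : N u - N v <= C * enormQ (u - v).
  rewrite lerBlDr; apply: (@le_trans _ _ (N (u - v) + N v)).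
    by have := ND (u - v) v; rewrite subrK.
  by rewrite lerD2r.
by rewrite ler_norml h andbT lerNl opprB -[x - y]opprB enormQN h.
Qed.

Lemma sublinear_continuous (N : Q -> R) : sublinear N -> continuous N.
Proof.
move=> /sublinear_lip[C C0 NC] x; apply/cvgrPdist_le => e e0.
have : C * enormQ (x - y) @[y --> x] --> C * enormQ (x - x).
  apply: cvgM; first exact: cvg_cst.
  apply: (@cvg_comp _ _ _ (fun y => x - y) (@enormQ R n m) _ (nbhs (x - x))).
    by apply: cvgB; [exact: cvg_cst|exact: cvg_id].
  exact: enormQ_continuous.
rewrite subrr -[0](scale0r (0 : Q)) enormQZ normr0 mul0r mulr0 => h.
near=> y; apply: (le_trans (NC _ _)).
by near: y; exact: (cvgr_le _ h _ e0).
Unshelve. all: by end_near. Qed.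

(** Only right difference quotients pass through N, which is homogeneous for
    nonnegative factors. *)
Lemma sublinear_slope (N : Q -> R) (q : R -> Q) (t : R) (d : Q) : sublinear N ->
  is_derive t (1 : R) q d -> h^-1 * N (q (h + t) - q t) @[h --> (0 : R)^'+] --> N d.
Proof.
move=> Nsub /is_derive1_cvg/cvg_dnbhs_right qd.
have Nc : N (h^-1 *: (q (h + t) - q t)) @[h --> (0 : R)^'+] --> N d.
  by apply: (cvg_comp _ _ qd); exact: sublinear_continuous.
apply: cvg_trans Nc; apply: near_eq_cvg; near=> h => /=.
have h0 : 0 < h by near: h; exact: nbhs_right_gt.
by case: Nsub => _ NZ _; rewrite NZ// invr_ge0 ltW.
Unshelve. all: by end_near. Qed.

Lemma sublinear_derive_le (N : Q -> R) (q : R -> Q) (F : R -> R) (t : R) (d : Q) (dF : R) :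
  sublinear N -> is_derive t (1 : R) q d -> is_derive t (1 : R) F dF ->
  (\forall h \near (0 : R)^'+, N (q (h + t) - q t) <= F (h + t) - F t) -> N d <= dF.
Proof.
move=> Nsub /(sublinear_slope Nsub) qd /is_derive1_cvg/cvg_dnbhs_right Fd NF.
apply: ler_cvg_to qd Fd _; near=> h.
apply: ler_wpM2l; last by near: h.
by rewrite invr_ge0; apply: ltW; near: h; exact: nbhs_right_gt.
Unshelve. all: by end_near. Qed.

Lemma sublinear_derive_ge (N : Q -> R) (q : R -> Q) (F : R -> R) (t : R) (d : Q) (dF : R) :
  sublinear N -> is_derive t (1 : R) q d -> is_derive t (1 : R) F dF ->
  (\forall h \near (0 : R)^'+, F (h + t) - F t <= N (q (h + t) - q t)) -> dF <= N d.
Proof.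
move=> Nsub /(sublinear_slope Nsub) qd /is_derive1_cvg/cvg_dnbhs_right Fd NF.
apply: ler_cvg_to Fd qd _; near=> h.
apply: ler_wpM2l; last by near: h.
by rewrite invr_ge0; apply: ltW; near: h; exact: nbhs_right_gt.
Unshelve. all: by end_near. Qed.

Lemma sublinear_enormQ : sublinear (@enormQ R n m).
Proof.
split; [exact: enormQD|by move=> l x l0; rewrite enormQZ ger0_norm|].
by exists 1 => // x; rewrite mul1r.
Qed.

Section curve.
Context (a b : R) (q : R -> Q).
Hypothesis ACq : absolutely_continuous_on (@enormQ R n m) a b q.

Lemma AC_crd k : ACR a b (crd k \o q).
Proof.
move=> e e0; have [d d0 dP] := ACq e0; exists d => // j l r lr tI /(dP _ _ _ lr tI).
by apply: le_lt_trans; apply: ler_sum => i _; rewrite -crdB; exact: crd_le_enormQ.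
Qed.

(** This function dominates the increments of the curve and makes results on real
    functions, differentiability almost everywhere above all, available for the
    length of curves. *)
Definition curve_var (t : R) : R := \sum_k varfun a (crd k \o q) t.

Lemma AC_curve_var : ACR a b curve_var.
Proof. by apply: AC_sum => k; apply: AC_varfun; exact: AC_crd. Qed.

Lemma curve_var_ge x y : a <= x -> x <= y -> y <= b ->
  enormQ (q y - q x) <= curve_var y - curve_var x.
Proof.
move=> ax xy yb; apply: (le_trans (enormQ_le_sum _)).
rewrite -sumrB; apply: ler_sum => k _; rewrite crdB.
exact: (varfun_ge (AC_crd k)).
Qed.

Lemma AC_curve_derive : a <= b ->
  {ae @lebesgue_measure R, forall x, x \in `]a, b[ -> exists d, is_derive x (1 : R) q d}.
Proof.
move=> ab; have : forall k, exists g : R -> R, {ae @lebesgue_measure R, forall x, x \in `]a, b[ ->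
    is_derive x (1 : R) (crd k \o q) (g x)}.
  by move=> k; have [g [_ _ gP]] := AC_FTC ab (AC_crd k); exists g.
move=> /choice[g gP].
have := filter_forall (ae_filter_ringOfSetsType (@lebesgue_measure R)) gP.
apply: aeW => x h xab; pose d : Q := (\row_i g (inl i) x, \row_j g (inr j) x).
exists d; apply/is_derive_crd => -[] k; rewrite /= mxE; exact: h.
Qed.

Lemma curve_var_derive x d l : x \in `]a, b[ ->
  is_derive x (1 : R) q d -> is_derive x (1 : R) curve_var l -> enormQ d <= l.
Proof.
rewrite in_itv/= => /andP[ax xb] qd Vl.
apply: (sublinear_derive_le sublinear_enormQ qd Vl).
near=> h; have h0 : 0 < h by near: h; exact: nbhs_right_gt.
apply: curve_var_ge; [exact: ltW|by rewrite lerDr ltW|].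
rewrite -lerBrDr; near: h; apply: nbhs_right_le; rewrite subr_gt0//.
Unshelve. all: by end_near. Qed.

(** The function F x = N (q x - q a) - f x is absolutely continuous, and subadditivity
    of N bounds its right difference quotients by those of N along q minus those of
    f. So F has a nonpositive derivative almost everywhere and F b <= F a = - f a. *)
Lemma sublinear_mean_value (N : Q -> R) (f : R -> R) : a <= b -> sublinear N -> ACR a b f ->
  {ae @lebesgue_measure R, forall x, x \in `]a, b[ -> forall d df,
     is_derive x (1 : R) q d -> is_derive x (1 : R) f df -> N d <= df} ->
  N (q b - q a) <= f b - f a.
Proof.
move=> ab Nsub ACf h; have [C C0 NC] := sublinear_lip Nsub.
pose F x := N (q x - q a) - f x.
have ACF : ACR a b F.
  apply: (@AC_dom _ _ _ _ _ _ (fun x => C * curve_var x + varfun a f x)); last first.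
    by apply: AC_add; [apply: AC_scale; exact: AC_curve_var|exact: AC_varfun].
  move=> x y ax xy yb; rewrite /F.
  have -> : N (q y - q a) - f y - (N (q x - q a) - f x) =
    (N (q y - q a) - N (q x - q a)) - (f y - f x) by ring.
  apply: (le_trans (ler_normB _ _)).
  have h1 := varfun_ge ACf ax xy yb.
  have h2 := NC (q y - q a) (q x - q a).
  rewrite opprB addrA subrK in h2.
  have h3 := ler_wpM2l C0 (curve_var_ge ax xy yb).
  by have := le_trans h2 h3; lra.
have [g [_ _ fd]] := AC_FTC ab ACf.
have : F b <= F a.
  apply: (AC_derive_le0 ACF) => //.
  apply: aeW (aeI (aeI h fd) (AC_curve_derive ab)) => x [[hx fdx] qdx] xab dF Fd.
  have [d qd] := qdx xab; have {}fdx := fdx xab.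
  have Nd := hx xab _ _ qd fdx.
  rewrite -(subr0 dF); apply: (@le_trans _ _ (N d - g x)); last by rewrite subr_le0.
  have Gd : is_derive x (1 : R) (F + f) (dF + g x) by apply: is_deriveD.
  suff : dF + g x <= N d by rewrite subr0; lra.
  apply: (sublinear_derive_ge Nsub qd Gd); near=> e.
  rewrite !fctE /F !subrK lerBlDr; case: Nsub => ND _ _.
  by have := ND (q (e + x) - q x) (q x - q a); rewrite addrA subrK.
rewrite /F subrr -[0](scale0r (0 : Q)); case: Nsub => _ -> // _; rewrite mul0r; lra.
Unshelve. all: by end_near. Qed.

End curve.
End sublinear.

(** * The energy along curves *)

Section energy.
Context (R : realType) (n m : nat) (T : R) (E : R -> Qspace R n m -> R).
Local Notation Q := (Qspace R n m).
Hypothesis hE : C1_energy T E.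

Let D : set (R * Q) := `[0, T]%classic `*` setT.

Let dtEc (t : R) (q : Q) : t \in `[0, T] ->
  difference_quotient_t E t q s @[s --> within `[0, T]%classic (dnbhs t)] --> dtE T E t q.
Proof. by move=> /(hE.1 t q)[]. Qed.

Lemma dtE_is_derive (t : R) (q : Q) : t \in `]0, T[ ->
  is_derive t (1 : R) (E ^~ q) (dtE T E t q).
Proof.
rewrite in_itv/= => /andP[t0 tT]; apply/is_derive1_cvg.
have tI : t \in `[0, T] by rewrite in_itv/= !ltW.
have /cvgrPdist_lt h := @dtEc t q tI; apply/cvgrPdist_lt => e /h[r r0 rP].
near=> s; have s0 : s != 0 by near: s; exact: nbhs_dnbhs_neq.
have := rP (s + t); rewrite /difference_quotient_t addrK; apply.
- rewrite /= opprD addrCA subrr addr0 normrN; near: s; exact: dnbhs0_lt.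
- by rewrite -subr_eq0 addrK.
- rewrite /= in_itv/=.
  have : `|s| < Num.min t (T - t) by near: s; apply: dnbhs0_lt; rewrite lt_min t0 subr_gt0.
  by rewrite lt_min ltr_norml (ltr_norml _ (T - t)); lra.
Unshelve. all: by end_near. Qed.

(** The bound on c - x is what makes the time difference quotients at a moving state
    converge in [E_chain]. *)
Lemma dtE_mean (q : Q) (x y : R) : x \in `[0, T] -> y \in `[0, T] ->
  exists c, [/\ c \in `[0, T], `|c - x| <= `|y - x| &
    E y q - E x q = dtE T E c q * (y - x)].
Proof.
have gen u v : u < v -> u \in `[0, T] -> v \in `[0, T] ->
    exists2 c, c \in `]u, v[ & E v q - E u q = dtE T E c q * (v - u).
  rewrite !in_itv/= => uv /andP[u0 uT] /andP[v0 vT].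
  apply: (@MVT _ (E ^~ q) (fun c => dtE T E c q)) => //.
    move=> c; rewrite in_itv/= => /andP[uc cv]; apply: dtE_is_derive.
    by rewrite in_itv/= (le_lt_trans u0 uc) (lt_le_trans cv vT).
  have [_ [Ec _ _]] := hE.
  apply/subspace_continuousP => c /= cuv.
  have cT : D (c, q).
    by split => //=; move: cuv; rewrite !in_itv/= => /andP[? ?]; apply/andP; split; lra.
  move/subspace_continuousP : Ec => /(_ _ cT) /cvgrPdist_lt h.
  apply/cvgrPdist_lt => e /h[[A B] /= [[r r0 rA] qB] AB].
  exists r => //= z zr zuv; apply: (AB (z, q)).
    by split => /=; [exact: rA|exact: nbhs_singleton].
  by split => //=; move: zuv; rewrite !in_itv/= => /andP[? ?]; apply/andP; split; lra.
move=> xT yT; have [xy|yx|->] := ltgtP x y.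
- have [c + ->] := gen _ _ xy xT yT; rewrite in_itv/= => /andP[xc cy].
  exists c; split => //; first by move: xT yT; rewrite !in_itv/=; lra.
  by rewrite !gtr0_norm ?subr_gt0//; lra.
- have [c + cE] := gen _ _ yx yT xT; rewrite in_itv/= => /andP[yc cx].
  exists c; split => //; first by move: xT yT; rewrite !in_itv/=; lra.
    by rewrite !ltr0_norm ?subr_lt0//; lra.
  by move: cE; lra.
- by exists y; split => //; rewrite !subrr mulr0.
Qed.

Lemma E_directional (q v : Q) (t : R) : t \in `[0, T] ->
  'd (E t) q v = dotQ (DqE E t q) v.
Proof.
move=> tT; have [_ dE] := hE.1 t q tT.
rewrite {1}[v]crd_expand linear_sum dotQ_crd; apply: eq_bigr => k _.
rewrite linearZ/= -deriveE// mulrC; congr (_ * _).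
by case: k => i; rewrite /= mxE.
Qed.

Lemma E_q_derive (t : R) (q : R -> Q) (s : R) (v : Q) : t \in `[0, T] ->
  is_derive s (1 : R) q v ->
  is_derive s (1 : R) (E t \o q) (dotQ (DqE E t (q s)) v).
Proof.
move=> tT qv; have [_ dE] := hE.1 t (q s) tT.
have dq : differentiable q s by apply/derivable1_diffP; apply: ex_derive.
have dEq : differentiable (E t \o q) s by exact: differentiable_comp.
have -> : dotQ (DqE E t (q s)) v = 'D_1 (E t \o q) s.
  rewrite deriveE// diff_comp//= -E_directional//; congr ('d _ _ _).
  by rewrite -deriveE//; apply/esym/derive_val.
by apply: DeriveDef => //; exact/derivable1_diffP.
Qed.

(** Time may touch 0 or T, where E is differentiable in time from one side only, so
    that E is not known to be jointly differentiable. The increment is therefore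
    split: its time part is handled by the mean value theorem and continuity of
    dtE, its state part by differentiability of E (t s). *)
Lemma E_chain (t : R -> R) (q : R -> Q) (s : R) (tau : R) (v : Q) :
  (\forall x \near s, t x \in `[0, T]) ->
  is_derive s (1 : R) t tau -> is_derive s (1 : R) q v ->
  is_derive s (1 : R) (fun x => E (t x) (q x))
    (dtE T E (t s) (q s) * tau + dotQ (DqE E (t s) (q s)) v).
Proof.
move=> tT td qd; have tsT := nbhs_singleton tT.
have tc : {for s, continuous t}.
  by apply: differentiable_continuous; apply/derivable1_diffP; apply: ex_derive.
have qc : {for s, continuous q}.
  by apply: differentiable_continuous; apply/derivable1_diffP; apply: ex_derive.
pose sl h := if t (h + s) == t s then dtE T E (t s) (q s) else
  (t (h + s) - t s)^-1 * (E (t (h + s)) (q (h + s)) - E (t s) (q (h + s))).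
have shift0 : (fun h : R => h + s) @ (0 : R)^' --> s.
  have : (fun h : R => h + s) @ (0 : R) --> s.
    by rewrite -[X in _ --> X]add0r; apply: cvgD; [exact: cvg_id|exact: cvg_cst].
  by apply: cvg_trans; apply: cvg_app; exact: cvg_within.
have tsc : t (h + s) @[h --> (0 : R)^'] --> t s by apply: (cvg_comp _ _ shift0).
have qsc : q (h + s) @[h --> (0 : R)^'] --> q s by apply: (cvg_comp _ _ shift0).
have slc : sl h @[h --> (0 : R)^'] --> dtE T E (t s) (q s).
  have [_ [_ Ec _]] := hE; have Ds : D (t s, q s) by split.
  move/subspace_continuousP : Ec => /(_ _ Ds) /cvgrPdist_lt Ec.
  apply/cvgrPdist_lt => e e0; rewrite /sl.
  have [[A B] /= [[r r0 rA] qB] AB] := Ec _ e0.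
  near=> h; case: eqVneq => [_|hs]; first by rewrite subrr normr0.
  have hT : t (h + s) \in `[0, T] by near: h; exact: shift0 tT.
  have [c [cT cts ->]] := dtE_mean (q (h + s)) tsT hT.
  rewrite mulrC mulfK ?subr_eq0//; apply: (AB (c, q (h + s))); last by split.
  split => /=.
    apply: rA; rewrite /ball_/= distrC; apply: le_lt_trans cts _.
    by rewrite distrC; near: h; move/cvgrPdist_lt : tsc; exact.
  by near: h; exact: qsc.
have /is_derive1_cvg Eq := E_q_derive tsT qd.
apply/is_derive1_cvg; move/is_derive1_cvg : td => td.
apply: cvg_trans (cvgD (cvgM slc td) Eq); apply: near_eq_cvg; near=> h.
rewrite !fctE /GRing.scale/= mulrCA -mulrDr; congr (_ * _); rewrite /sl.
case: eqVneq => [->|hs]; first by rewrite subrr mulr0 add0r.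
by rewrite mulrAC mulVf ?subr_eq0// mul1r addrA subrK.
Unshelve. all: by end_near. Qed.

Lemma box_compact (B : R) : compact [set q : Q | forall k, `|crd k q| <= B].
Proof.
have seg l : compact [set v : 'rV[R]_l | forall i, `[- B, B]%classic (v ord0 i)].
  exact: (@rV_compact _ _ (fun=> `[- B, B]%classic) (fun=> @segment_compact R (- B) B)).
have -> : [set q : Q | forall k, `|crd k q| <= B] =
    [set v : 'rV[R]_n | forall i, `[- B, B]%classic (v ord0 i)] `*`
    [set v : 'rV[R]_m | forall i, `[- B, B]%classic (v ord0 i)].
  apply/seteqP; split => [q qB|q [q1 q2] [] i] /=.
  - by split => i /=; rewrite in_itv/= -ler_norml; [exact: (qB (inl i))|exact: (qB (inr i))].
  - by rewrite ler_norml; have := q1 i; rewrite /= in_itv/=.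
  - by rewrite ler_norml; have := q2 i; rewrite /= in_itv/=.
exact: compact_setX.
Qed.

Lemma within_bounded (F : R * Q -> R) (B : R) : {within D, continuous F} ->
  exists2 L : R, 0 <= L & forall t q, t \in `[0, T] -> (forall k, `|crd k q| <= B) ->
    `|F (t, q)| <= L.
Proof.
move=> Fc; pose K := `[0, T]%classic `*` [set q : Q | forall k, `|crd k q| <= B].
have Kc : compact K by apply: compact_setX; [exact: segment_compact|exact: box_compact].
have KD : K `<=` D by move=> -[t q] [].
have /compact_bounded[L [Lr LP]] := continuous_compact (continuous_subspaceW KD Fc) Kc.
exists (`|L| + 1); first by rewrite addr_ge0.
move=> t q tT qB; apply: LP; first by rewrite ltr_pwDr// ler_norm.
by exists (t, q).
Qed.

(** Both partial derivatives are bounded on the compact set of admissible times and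
    states in a box; the mean value theorem is applied in time, then along a segment
    of the box. *)
Lemma E_lipschitz (B : R) : exists2 L : R, 0 <= L & forall x y p p',
  x \in `[0, T] -> y \in `[0, T] ->
  (forall k, `|crd k p| <= B) -> (forall k, `|crd k p'| <= B) ->
  `|E y p' - E x p| <= L * (`|y - x| + enormQ (p' - p)).
Proof.
have [_ [_ dtc dqc]] := hE.
have dqc' : {within D, continuous (fun z => enormQ (DqE E z.1 z.2))}.
  apply/subspace_continuousP => z Dz; move/subspace_continuousP : dqc => /(_ z Dz) h.
  by apply: (cvg_comp _ _ h); exact: enormQ_continuous.
have [L1 L10 L1P] := within_bounded B dtc.
have [L2 L20 L2P] := within_bounded B dqc'.
exists (L1 + L2); first exact: addr_ge0.
move=> x y p p' xT yT pB p'B.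
have h1 : `|E y p - E x p| <= L1 * `|y - x|.
  have [c [cT _ ->]] := dtE_mean p xT yT; rewrite normrM ler_wpM2r//.
  exact: (L1P c p).
have h2 : `|E y p' - E y p| <= L2 * enormQ (p' - p).
  pose g (s : R) := p + s *: (p' - p).
  have gd (s : R) : is_derive s (1 : R) g (p' - p).
    apply/is_derive1_cvg; apply: cvg_near_cst; near=> h.
    rewrite /g opprD addrACA subrr add0r -scalerBl addrK scalerA mulVf ?scale1r//.
    by near: h; exact: nbhs_dnbhs_neq.
  have gE (s : R) : is_derive s (1 : R) (E y \o g) (dotQ (DqE E y (g s)) (p' - p)).
    exact: E_q_derive.
  have gc : {within `[0, 1], continuous (E y \o g)}.
    apply: derivable_within_continuous => s _.
    by have := gE s => h; apply: ex_derive.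
  have [c + ] := MVT ltr01 (fun s _ => gE s) gc.
  rewrite in_itv/= subr0 mulr1 /g scale1r scale0r addr0 [p + (p' - p)]addrC subrK => /andP[c0 c1] ->.
  have : `|dotQ (DqE E y (g c)) (p' - p)| <= enormQ (DqE E y (g c)) * enormQ (p' - p).
    rewrite ler_norml dotQ_CS andbT lerNl -dotQNl -(enormQN (DqE E y (g c))).
    exact: dotQ_CS.
  move/le_trans; apply; rewrite ler_wpM2r ?enormQ_ge0//.
  apply: le_trans (ler_norm _) _; apply: (L2P y (g c)) => // k.
  have -> : crd k (g c) = (1 - c) * crd k p + c * crd k p'.
    by rewrite crdD crdZ crdB; ring.
  apply: (le_trans (ler_normD _ _)); rewrite !normrM (ger0_norm (ltW c0)) ger0_norm; last by lra.
  have : (1 - c) * `|crd k p| <= (1 - c) * B by rewrite ler_wpM2l//; lra.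
  have : c * `|crd k p'| <= c * B by rewrite ler_wpM2l//; lra.
  lra.
have -> : E y p' - E x p = (E y p' - E y p) + (E y p - E x p) by ring.
apply: (le_trans (ler_normD _ _)).
have := enormQ_ge0 (p' - p); have := normr_ge0 (y - x); nra.
Unshelve. all: by end_near. Qed.

(** A curve of finite length stays in a box, on which the energy is Lipschitz. *)
Lemma AC_energy (a b : R) (t : R -> R) (q : R -> Q) :
  a <= b -> ACR a b t -> (forall x, a <= x -> x <= b -> t x \in `[0, T]) ->
  absolutely_continuous_on (@enormQ R n m) a b q ->
  ACR a b (fun x => E (t x) (q x)).
Proof.
move=> ab ACt tT ACq.
pose B := enormQ (q a) + (curve_var a q b - curve_var a q a).
have qB x k : a <= x -> x <= b -> `|crd k (q x)| <= B.
  move=> ax xb; apply: (le_trans (crd_le_enormQ _ _)).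
  have -> : q x = q a + (q x - q a) by rewrite addrC subrK.
  apply: (le_trans (enormQD _ _)); rewrite lerD2l.
  apply: (le_trans (curve_var_ge ACq (lexx a) ax xb)).
  rewrite lerD2r -subr_ge0.
  by apply: le_trans (curve_var_ge ACq ax xb (lexx b)); exact: enormQ_ge0.
have [L L0 LP] := E_lipschitz B.
apply: (@AC_dom _ _ _ _ _ _ (fun x => L * (varfun a t x + curve_var a q x))); last first.
  by apply/AC_scale/AC_add; [exact: AC_varfun|exact: AC_curve_var].
move=> x y ax xy yb; have ay := le_trans ax xy; have xb := le_trans xy yb.
apply: (le_trans (LP _ _ _ _ (tT _ ax xb) (tT _ ay yb) _ _)).
- by move=> k; exact: qB.
- by move=> k; exact: qB.
rewrite -mulrBr ler_wpM2l// opprD addrACA lerD//.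
- exact: (varfun_ge ACt).
- exact: (curve_var_ge ACq).
Qed.
End energy.

(** * Selection of uniformly convergent subsequences *)

(** By the theorem of Tychonoff, a bounded sequence of functions has a cluster point
    for pointwise convergence, approximated infinitely often at any finitely many
    points at once. *)
Lemma pointwise_cluster (R : realType) (J : choiceType) (B : R) (v : nat -> J -> R) :
  (forall k j, `|v k j| <= B) -> exists w : J -> R,
  forall (I : finType) (p : I -> J) (e : R) (N : nat), 0 < e ->
    exists2 k, (N <= k)%N & forall i, `|w (p i) - v k (p i)| < e.
Proof.
move=> vB.
have := @tychonoff J (fun=> R) (fun=> `[- B, B]%classic) (fun=> @segment_compact R (- B) B).
move=> /(_ (v @ \oo) _)[|w [_ wcl]].
  by exists 0%N => // k _ j /=; rewrite in_itv/= -ler_norml.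
exists w => I p e N e0.
pose near_at i := @proj J (fun=> R) (p i) @^-1` [set x : R | `|w (p i) - x| < e].
have near_w i : nbhs (w : prod_topology (fun _ : J => R)) (near_at i).
  apply: proj_continuous.
  by exists e => //= x.
have nbw := filter_forall (nbhs_filter w) near_w.
have vN : (v @ \oo) [set v k | k in [set k | (N <= k)%N]].
  by exists N => // k /= Nk; exists k.
by have [_ [[k Nk <-] h]] := wcl _ _ vN nbw; exists k.
Qed.

Lemma grid_cell (R : realType) (h s : R) (L : nat) : (0 < L)%N -> 0 <= s -> s <= L%:R * h ->
  exists2 i, (i < L)%N & i%:R * h <= s <= i.+1%:R * h.
Proof.
move=> L0 s0; case: L L0 => // L _; elim: L => [|L IH] sL.
  by exists 0%N => //; rewrite mul0r s0.
have [/IH[i iL ih]|/ltW sL'] := leP s (L.+1%:R * h); last by exists L.+1 => //; rewrite sL'.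
by exists i => //; exact: ltn_trans iL _.
Qed.

(** The point s lies between two grid points x and y. The functions w and v are
    compared at x, and their increments from x to s are bounded by increments of M
    and N from x to y. *)
Lemma dominated_close (R : realType) (e wx ws vx vs Mx My Ms Nx Ny Ns : R) :
  `|ws - wx| <= Ms - Mx -> `|vs - vx| <= Ns - Nx -> Ns <= Ny -> My - Mx < e / 8 ->
  Ms <= My -> `|Mx - Nx| < e / 8 -> `|My - Ny| < e / 8 -> `|wx - vx| < e / 8 ->
  `|ws - vs| < e.
Proof.
rewrite !ltr_norml !ler_norml => /andP[? ?] /andP[? ?] ? ? ? /andP[? ?] /andP[? ?] /andP[? ?].
by apply/andP; split; lra.
Qed.

Lemma limit_dominated (R : realType) (e wx wy vx vy Mx My Nx Ny : R) :
  `|vy - vx| <= Ny - Nx -> `|Mx - Nx| < e / 4 -> `|My - Ny| < e / 4 ->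
  `|wx - vx| < e / 4 -> `|wy - vy| < e / 4 -> `|wy - wx| <= My - Mx + e.
Proof.
rewrite !ltr_norml !ler_norml => /andP[? ?] /andP[? ?] /andP[? ?] /andP[? ?] /andP[? ?].
by apply/andP; split; lra.
Qed.

(** A compactness theorem of Helly type. Let w be a cluster point for pointwise
    convergence. The increments of every v k are dominated by those of M_ k, hence
    the increments of w by those of the absolutely continuous limit M. On a grid that
    is fine for M, closeness at the grid points then gives closeness everywhere, and
    the subsequence is extracted with tolerances 1 / (k + 1). *)
Lemma uniform_selection (R : realType) (C : finType) (S B : R)
    (v : nat -> C -> R -> R) (M_ : nat -> R -> R) (M : R -> R) :
  0 <= S ->
  (forall k c s, 0 <= s -> s <= S -> `|v k c s| <= B) ->
  (forall k c x y, 0 <= x -> x <= y -> y <= S ->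
    `|v k c y - v k c x| <= M_ k y - M_ k x) ->
  (forall k x y, 0 <= x -> x <= y -> y <= S -> M_ k x <= M_ k y) ->
  (forall x, 0 <= x -> x <= S -> M_ k x @[k --> \oo] --> M x) ->
  ACR 0 S M ->
  exists psi : nat -> nat, {homo psi : i j / (i < j)%N} /\
  exists w : C -> R -> R, forall e : R, 0 < e -> \forall k \near \oo,
    forall c s, 0 <= s -> s <= S -> `|w c s - v (psi k) c s| < e.
Proof.
move=> S0 vB vM M_nd MM ACM.
(* The product of Tychonoff needs bounds at all indices, also outside [0, S]. *)
pose clamp (s : R) := if (0 <= s) && (s <= S) then s else 0.
have clampP s : 0 <= clamp s /\ clamp s <= S.
  by rewrite /clamp; case: ifP => [/andP[]|].
have [|w0 w0P] := @pointwise_cluster R (C * R)%type B (fun k j => v k j.1 (clamp j.2)).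
  by move=> k j; apply: vB; have [] := clampP j.2.
pose w c s := w0 (c, s).
have wP (I : finType) (p : I -> C * R) (e : R) (N : nat) : 0 < e ->
    (forall i, 0 <= (p i).2 /\ (p i).2 <= S) ->
    exists2 k, (N <= k)%N & forall i, `|w (p i).1 (p i).2 - v k (p i).1 (p i).2| < e.
  move=> e0 pS; have [k Nk kP] := w0P I p e N e0; exists k => // i.
  have := kP i; rewrite /w -surjective_pairing /clamp.
  by have [-> ->] := pS i.
have M_near (x e : R) : 0 < e -> 0 <= x -> x <= S -> \forall k \near \oo, `|M x - M_ k x| < e.
  by move=> e0 x0 xS; move/cvgrPdist_lt : (MM x x0 xS); exact.
have wM c x y : 0 <= x -> x <= y -> y <= S -> `|w c y - w c x| <= M y - M x.
  move=> x0 xy yS; apply/ler_addgt0Pr => e e0; have e40 : 0 < e / 4 by rewrite divr_gt0.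
  have y0 := le_trans x0 xy; have xS := le_trans xy yS.
  have [N _ NP] : \forall k \near \oo, `|M x - M_ k x| < e / 4 /\ `|M y - M_ k y| < e / 4.
    by apply: filterI; exact: M_near.
  have [|k Nk kP] := wP bool (fun b => (c, if b then x else y)) (e / 4) N e40.
    by case.
  have [Nx Ny] := NP k Nk.
  exact: limit_dominated (vM k c x y x0 xy yS) Nx Ny (kP true) (kP false).
(* The grid has step h < d, the modulus of M for e / 8. *)
have unif (e : R) (N : nat) : 0 < e -> exists2 k, (N <= k)%N &
    forall c s, 0 <= s -> s <= S -> `|w c s - v k c s| < e.
  move=> e0; have e80 : 0 < e / 8 by rewrite divr_gt0.
  have [d d0 dP] := AC_unif ACM e80.
  pose L := (Num.bound (S / d)).+1; pose h := S / L%:R.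
  have L0 : 0 < L%:R :> R by rewrite ltr0n.
  have h0 : 0 <= h by rewrite divr_ge0// ltW.
  have hd : h < d.
    rewrite /h ltr_pdivrMr// mulrC -ltr_pdivrMr//.
    apply: lt_trans (archi_boundP _) _; first by rewrite divr_ge0// ltW.
    by rewrite ltr_nat.
  have LhS : L%:R * h = S by rewrite /h mulrC divfK// gt_eqF.
  have gS (i : 'I_L.+1) : 0 <= i%:R * h /\ i%:R * h <= S.
    split; first by rewrite mulr_ge0.
    by rewrite -LhS ler_wpM2r// ler_nat -ltnS.
  have [N1 _ N1P] : \forall k \near \oo, forall i : 'I_L.+1, `|M (i%:R * h) - M_ k (i%:R * h)| < e / 8.
    by apply: filter_forall => i; have [? ?] := gS i; exact: M_near.
  have [|k kN kP] := wP (C * 'I_L.+1)%type (fun j => (j.1, j.2%:R * h)) (e / 8) (maxn N N1) e80.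
    by move=> j /=.
  exists k; first by apply: leq_trans kN; rewrite leq_maxl.
  move=> c s s0 sS.
  have [i iL /andP[is1 is2]] : exists2 i, (i < L)%N & i%:R * h <= s <= i.+1%:R * h.
    by apply: grid_cell => //; rewrite LhS.
  pose i0 : 'I_L.+1 := Ordinal (ltnW iL : (i < L.+1)%N); pose i1 : 'I_L.+1 := Ordinal (iL : (i.+1 < L.+1)%N).
  have kN1 : (N1 <= k)%N by apply: leq_trans kN; rewrite leq_maxr.
  have [x0 _] := gS i0; have [_ yS] := gS i1; rewrite /= in x0 yS.
  have h1 : M (i.+1%:R * h) - M (i%:R * h) < e / 8.
    apply: le_lt_trans (ler_norm _) _; apply: dP => //; first exact: le_trans is1 is2.
    by rewrite -mulrBl -natrB// subSnn mul1r.
  have h2 : M s <= M (i.+1%:R * h).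
    by rewrite -subr_ge0; apply: le_trans (wM c _ _ s0 is2 yS).
  exact: dominated_close (wM c _ _ x0 is1 sS) (vM k c _ _ x0 is1 sS) (M_nd k _ _ s0 is2 yS)
    h1 h2 (N1P _ kN1 i0) (N1P _ kN1 i1) (kP (c, i0)).
have /choice[h hP] : forall iN : nat * nat, exists k, (iN.2 <= k)%N /\
    forall c s, 0 <= s -> s <= S -> `|w c s - v k c s| < iN.1.+1%:R^-1.
  by move=> [i N]; have [|k Nk kP] := unif (i.+1%:R^-1) N; [rewrite invr_gt0 ltr0n|exists k].
pose psi := fix psi k := if k is k'.+1 then h (k, (psi k').+1) else h (0, 0)%N.
exists psi; split.
  apply: homo_ltn; first exact: ltn_trans.
  by move=> k /=; exact: (hP (k.+1, (psi k).+1)).1.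
exists w => e e0; near=> k => c s s0 sS.
apply: (@lt_trans _ _ k.+1%:R^-1).
  have -> : psi k = h (k, if k is k'.+1 then (psi k').+1 else 0%N) by case: (k).
  exact: (hP (k, _)).2.
near: k; exact: near_infty_natSinv_lt (PosNum e0).
Unshelve. all: by end_near. Qed.

(** * Primitives of integrable functions *)

(** Absolute continuity of the integral with respect to the measure of its domain. *)
Lemma AC_of_density (R : realType) (a b : R) (f g : R -> R) :
  (@lebesgue_measure R).-integrable setT (EFin \o g) ->
  (forall x y, a <= x -> x <= y -> y <= b ->
    f y - f x = \int[@lebesgue_measure R]_(t in `]x, y]) g t) ->
  ACR a b f.
Proof.
move=> intg fE e e0; set mu := @lebesgue_measure R.
have [d [d0 dP]] := integral_normr_continuous intg e0.
exists d => // k l r lr tI rld.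
pose J i : set (measurableTypeR R) := `]l i, r i[%classic.
have mJ i : measurable (J i) by exact: measurable_itv.
pose A := \big[setU/set0]_(i < k) J i.
have mA : measurable A by apply: bigsetU_measurable => i _; exact: mJ.
have intng : mu.-integrable setT (EFin \o (fun x => `|g x|)).
  exact: integrable_norm.
have intS (D : set (measurableTypeR R)) (u : R -> R) : measurable D ->
    mu.-integrable setT (EFin \o u) -> mu.-integrable D (EFin \o u).
  by move=> mD; apply: integrableS.
have step i : `|f (r i) - f (l i)| <= \int[mu]_(x in J i) `|g x|.
  have [al [lri rb]] := lr i; rewrite fE//.
  apply: (le_trans (le_normr_Rintegral _ _)).
  - exact: measurable_itv.
  - by apply: intS => //; exact: measurable_itv.
  by rewrite -Rintegral_itv_bndo_bndc//; exact: intS.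
apply: (le_lt_trans (ler_sum _ (fun i _ => step i))).
have -> : \sum_(i < k) \int[mu]_(x in J i) `|g x| = \int[mu]_(x in A) `|g x|.
  rewrite [RHS]/Rintegral ge0_integral_bigsetU//=.
  - rewrite -[LHS]/(fine (_)%:E) -sumEFin; congr fine; apply: eq_bigr => i _.
    by rewrite fineK//; apply: integrable_fin_num => //; exact: intS.
  - exact: index_enum_uniq.
  - exact: sub_trivIset tI.
  - by apply: measurable_int; exact: intS.
apply: dP => //; rewrite /A measure_bigsetU_ord//.
apply: le_lt_trans (_ : ((\sum_(i < k) (r i - l i))%:E < _)%E); last by rewrite lte_fin.
rewrite -sumEFin; apply: lee_sum => i _; rewrite [leLHS](lebesgue_measure_itv `]l i, r i[)/= lte_fin.
by case: ltP => // h; rewrite lee_fin subr_ge0; have [_ []] := lr i.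
Qed.

Definition prim (R : realType) (D : set R) (f : R -> R) (x : R) : R :=
  \int[@lebesgue_measure R]_(s in `]0, x]) (f \_ D) s.

Section primitive.
Context (R : realType) (D : set (measurableTypeR R)) (mD : measurable D).
Local Notation mu := (@lebesgue_measure R).

Lemma integrable_patch (f : R -> R) : mu.-integrable D (EFin \o f) ->
  mu.-integrable setT (EFin \o (f \_ D)).
Proof. by move/(integrable_mkcond _ mD); rewrite restrict_EFin. Qed.

Lemma prim_density (f : R -> R) (x y : R) : mu.-integrable D (EFin \o f) -> 0 <= x -> x <= y ->
  prim D f y - prim D f x = \int[mu]_(s in `]x, y]) (f \_ D) s.
Proof.
move=> /integrable_patch fi x0 xy; rewrite /prim Rintegral_itvB//.
by apply: integrableS fi => //; exact: measurable_itv.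
Qed.

Lemma prim_AC (f : R -> R) (b : R) : mu.-integrable D (EFin \o f) -> ACR 0 b (prim D f).
Proof.
move=> fi; apply: (AC_of_density (integrable_patch fi)) => x y x0 xy _.
exact: prim_density.
Qed.

Lemma prim_derive (f : R -> R) (b : R) : mu.-integrable D (EFin \o f) ->
  {ae mu, forall x, x \in `]0, b[ -> is_derive x (1 : R) (prim D f) ((f \_ D) x)}.
Proof.
move=> fi; apply: (derive_of_density (integrable_patch fi)) => x y x0 xy _.
exact: prim_density.
Qed.

(** Weak convergence is tested with the indicator of ]0, x]. *)
Lemma weak_cvg_prim (f_ : nat -> R -> R) (f : R -> R) (x : R) : weak_cvg_L1 D f_ f ->
  prim D (f_ k) x @[k --> \oo] --> prim D f x.
Proof.
move=> [_ _ h]; pose I : set (measurableTypeR R) := `]0, x]%classic.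
have mI : measurable I by exact: measurable_itv.
have E u : prim D u x = \int[mu]_(s in D) (u s * \1_I s).
  rewrite /prim [LHS]Rintegral_mkcond [RHS]Rintegral_mkcond.
  apply: eq_Rintegral => s _; rewrite !patchE indicE -/I.
  by case: (s \in D); case: (s \in I); rewrite ?mulr1 ?mulr0.
rewrite E; under eq_fun do rewrite E; apply: h.
  exact: measurable_indic.
exists 1; apply: aeT => s _; rewrite indicE ger0_norm ?ler0n//.
by case: (s \in I).
Qed.
End primitive.

(** This is the mean value inequality for the Euclidean norm, compared with the
    primitive of f minus t. *)
Lemma increment_le_prim (R : realType) (n m : nat) (S : R) (t : R -> R)
    (q : R -> Qspace R n m) (f : R -> R) :
  ACR 0 S t -> absolutely_continuous_on (@enormQ R n m) 0 S q ->
  (@lebesgue_measure R).-integrable `]0, S[ (EFin \o f) ->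
  {ae @lebesgue_measure R, forall s, s \in `]0, S[ ->
    derive1 t s + enormQ (derive1 q s) <= f s} ->
  forall x y, 0 <= x -> x <= y -> y <= S ->
    t y - t x + enormQ (q y - q x) <= prim `]0, S[ f y - prim `]0, S[ f x.
Proof.
move=> ACt ACq fi hf x y x0 xy yS; have S0 := le_trans (le_trans x0 xy) yS.
have mS : measurable (`]0, S[%classic : set (measurableTypeR R)) by exact: measurable_itv.
pose P := prim `]0, S[ f.
have ACP : ACR 0 S P := prim_AC mS S fi.
have := @sublinear_mean_value R n m x y q (AC_subitv x0 yS ACq) (@enormQ R n m) (fun s => P s - t s)
  xy (@sublinear_enormQ R n m) (AC_subitv x0 yS (AC_sub ACP ACt)).
suff : {ae @lebesgue_measure R, forall s, s \in `]x, y[ -> forall d df,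
     is_derive s (1 : R) q d -> is_derive s (1 : R) (fun s => P s - t s) df -> enormQ d <= df}.
  by move=> h /(_ h); rewrite /P; lra.
have [g [_ _ gP]] := AC_FTC S0 ACt.
apply: aeW (aeI (aeI hf gP) (prim_derive mS S fi)) => s [[h1 h2] h3] sxy d df qd fd.
have sS : s \in `]0, S[.
  by move: sxy; rewrite !in_itv/= => /andP[? ?]; apply/andP; split; lra.
have {}h1 := h1 sS; have {}h2 := h2 sS; have {}h3 := h3 sS.
have h4 : is_derive s (1 : R) (P - t) ((f \_ `]0, S[) s - g s) by exact: is_deriveB.
rewrite (is_derive1_unique fd h4) patchE mem_set//.
by rewrite (is_derive1_val qd) (is_derive1_val h2) in h1; lra.
Qed.

(** * Dissipation potentials and their conjugates *)

Section dotv_theory.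
Context (R : realType) (k : nat).
Implicit Types (u v w : 'rV[R]_k) (A : 'M[R]_k).

Lemma dotvC u v : dotv u v = dotv v u.
Proof. by apply: eq_bigr => i _; rewrite mulrC. Qed.
Lemma dotvDl u v w : dotv (u + v) w = dotv u w + dotv v w.
Proof. by rewrite /dotv -big_split; apply: eq_bigr => i _; rewrite mxE mulrDl. Qed.
Lemma dotvZl (a : R) u v : dotv (a *: u) v = a * dotv u v.
Proof. by rewrite /dotv mulr_sumr; apply: eq_bigr => i _; rewrite mxE mulrA. Qed.
Lemma dotvDr u v w : dotv u (v + w) = dotv u v + dotv u w.
Proof. by rewrite dotvC dotvDl !(dotvC u). Qed.
Lemma dotvZr (a : R) u v : dotv u (a *: v) = a * dotv u v.
Proof. by rewrite dotvC dotvZl (dotvC u). Qed.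
Lemma dotv0 u : dotv u 0 = 0.
Proof. by rewrite -(scale0r (0 : 'rV[R]_k)) dotvZr mul0r. Qed.
Lemma dotv_ge0 u : 0 <= dotv u u.
Proof. by apply: sumr_ge0 => i _; rewrite -expr2 sqr_ge0. Qed.
Lemma sqr_enorm u : enorm u ^+ 2 = dotv u u.
Proof. by rewrite sqr_sqrtr ?dotv_ge0. Qed.

Lemma quadpotZ A (a : R) v : quadpot A (a *: v) = a ^+ 2 * quadpot A v.
Proof. by rewrite /quadpot -scalemxAl dotvZl dotvZr; ring. Qed.

Lemma quadpot0 A : quadpot A 0 = 0.
Proof. by rewrite -(scale0r (0 : 'rV[R]_k)) quadpotZ expr0n mul0r. Qed.

(** The cross term symmetrizes the form, as A is an arbitrary matrix. *)
Lemma quadpot_expand A u v : exists G : R, forall s : R,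
  quadpot A (u + s *: v) = quadpot A u + s * (2 * G) + s ^+ 2 * quadpot A v.
Proof.
exists (4^-1 * (dotv (u *m A^T) v + dotv (v *m A^T) u)) => s.
by rewrite /quadpot mulmxDl -scalemxAl !dotvDl !dotvDr !dotvZl !dotvZr; field.
Qed.

Lemma dotv_young (c : R) u v : 0 < c ->
  dotv u v <= c * enorm v ^+ 2 + (4 * c)^-1 * enorm u ^+ 2.
Proof.
move=> c0; rewrite !sqr_enorm /dotv !mulr_sumr -big_split/=; apply: ler_sum => i _.
rewrite -subr_ge0.
have -> : c * (v 0 i * v 0 i) + (4 * c)^-1 * (u 0 i * u 0 i) - u 0 i * v 0 i =
   c * (v 0 i - (2 * c)^-1 * u 0 i) ^+ 2 by field; rewrite gt_eqF.
by rewrite mulr_ge0 ?sqr_ge0// ltW.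
Qed.

(** By the Young inequality the supremum is finite, and the vector 0 makes it
    nonnegative. The last item provides approximate maximizers. *)
Lemma conjugate_fin (f : 'rV[R]_k -> R) (xi : 'rV[R]_k) (c : R) :
  0 < c -> f 0 = 0 -> (forall v, c * enorm v ^+ 2 <= f v) ->
  exists W : R, [/\ 0 <= W, conjugate f xi = W%:E,
    forall v, dotv xi v - f v <= W &
    forall r : R, r < W -> exists v, r < dotv xi v - f v].
Proof.
move=> c0 f0 fc.
have ub v : dotv xi v - f v <= (4 * c)^-1 * enorm xi ^+ 2.
  by have := dotv_young xi v c0; have := fc v; lra.
have le v : ((dotv xi v - f v)%:E <= conjugate f xi)%E.
  by apply: ereal_sup_ubound; exists v.
have conj0 : (0 <= conjugate f xi)%E by have := le 0; rewrite dotv0 f0 subrr.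
have fin : conjugate f xi \is a fin_num.
  rewrite ge0_fin_numE//; apply: (@le_lt_trans _ _ ((4 * c)^-1 * enorm xi ^+ 2)%:E).
    by apply: ge_ereal_sup => _ [v _ <-]; rewrite lee_fin.
  exact: ltry.
exists (fine (conjugate f xi)); split.
- exact: fine_ge0.
- by rewrite fineK.
- by move=> v; rewrite -lee_fin fineK.
- move=> r; rewrite -lte_fin fineK// => /ereal_sup_gt[_ [v _ <-]].
  by rewrite lte_fin => rv; exists v.
Qed.

End dotv_theory.

(** The discriminant of s |-> F (x + s y) gives the Cauchy-Schwarz inequality for the
    form F, hence the triangle inequality for its square root. *)
Lemma sqrt_quadratic_subadd (R : realType) (V : lmodType R) (F : V -> R) :
  (forall x, 0 <= F x) ->
  (forall x y, exists G : R, forall s : R, F (x + s *: y) = F x + s * (2 * G) + s ^+ 2 * F y) ->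
  forall x y, Num.sqrt (F (x + y)) <= Num.sqrt (F x) + Num.sqrt (F y).
Proof.
move=> F0 FG x y; have [G GE] := FG x y.
have disc : G ^+ 2 <= F x * F y by apply: quadratic_ge0_discr => s; rewrite -GE.
have GF : G <= Num.sqrt (F x) * Num.sqrt (F y).
  by rewrite -sqrtrM// (le_trans (ler_norm _))// -sqrtr_sqr ler_wsqrtr.
rewrite -[leRHS]ger0_norm ?addr_ge0 ?sqrtr_ge0// -sqrtr_sqr ler_wsqrtr//.
rewrite sqrrD !sqr_sqrtr//; have := GE 1; rewrite scale1r mul1r expr1n mul1r => ->.
by rewrite mulr2n; lra.
Qed.

Section potentials.
Context (R : realType) (n m : nat).
Local Notation Q := (Qspace R n m).
Context (R0 : Q -> 'rV[R]_m -> R) (VVz : Q -> 'M[R]_m) (VVu : Q -> 'M[R]_n).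
Hypotheses (hR : assumption_R0 R0) (hz : assumption_V VVz) (hu : assumption_V VVu).

Lemma R0_0 q : R0 q 0 = 0.
Proof.
have [_ _ _ [C0 [C1 [_ _ /(_ q 0)]]]] := hR.
by rewrite /enorm dotv0 sqrtr0 !mulr0; lra.
Qed.

Lemma R0_ge0 q v : 0 <= R0 q v.
Proof.
have [_ _ _ [C0 [C1 [C00 _ /(_ q v)[h _]]]]] := hR.
by apply: le_trans h; rewrite mulr_ge0 ?sqrtr_ge0// ltW.
Qed.

Lemma R0_homog q (l : R) v : 0 <= l -> R0 q (l *: v) = l * R0 q v.
Proof.
have [_ _ h _] := hR; rewrite le_eqVlt => /predU1P[<-|]; last exact: h.
by rewrite scale0r R0_0 mul0r.
Qed.

(** Convexity at the midpoint of 2 u and 2 v, and homogeneity. *)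
Lemma R0_subadd q u v : R0 q (u + v) <= R0 q u + R0 q v.
Proof.
have [_ hc _ _] := hR.
have h0 : 0 <= 2^-1 :> R by rewrite invr_ge0.
have h1 : 2^-1 <= 1 :> R by rewrite invf_le1// ler1n.
have : R0 q (2^-1 *: (2 *: u) + (1 - 2^-1) *: (2 *: v)) <=
    2^-1 * R0 q (2 *: u) + (1 - 2^-1) * R0 q (2 *: v).
  exact: (hc q (Itv01 h0 h1) (2 *: u) (2 *: v) (in_setT _) (in_setT _)).
have -> : 1 - 2^-1 = 2^-1 :> R by field.
by rewrite !scalerA !mulVf// !scale1r !R0_homog// !mulrA !mulVf// !mul1r.
Qed.

Lemma quadpot_ge0 k (VV : Q -> 'M[R]_k) : assumption_V VV -> forall q v, 0 <= quadpot (VV q) v.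
Proof.
move=> [_ [C0 [C1 [C00 _ h]]]] q v; have [+ _] := h q v; apply: le_trans.
by rewrite mulr_ge0 ?sqr_ge0// ltW.
Qed.

(** The velocity part of the bounds that survive the limit: the rate-independent
    dissipation, and a multiple of a norm built from the two viscous potentials. *)
Definition qnorm (kap a b : R) (q : Q) (w : Q) : R :=
  R0 q w.2 + kap * Num.sqrt (a * quadpot (VVz q) w.2 + b * quadpot (VVu q) w.1).

Section qnorm.
Context (kap a b : R).
Hypotheses (kap0 : 0 <= kap) (a0 : 0 <= a) (b0 : 0 <= b).

Let F (q w : Q) := a * quadpot (VVz q) w.2 + b * quadpot (VVu q) w.1.

Let F_ge0 q w : 0 <= F q w.
Proof. by rewrite addr_ge0// mulr_ge0//; exact: quadpot_ge0. Qed.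

Lemma qnorm_homog q (l : R) w : 0 <= l -> qnorm kap a b q (l *: w) = l * qnorm kap a b q w.
Proof.
move=> l0; rewrite /qnorm/= R0_homog// !quadpotZ.
rewrite [a * _]mulrCA [b * _]mulrCA -mulrDr sqrtrM ?sqr_ge0// sqrtr_sqr ger0_norm//.
by ring.
Qed.

Lemma enorm_le_enormQ (w : Q) : enorm w.1 <= enormQ w /\ enorm w.2 <= enormQ w.
Proof. by split; rewrite ler_wsqrtr// /dotQ ?lerDl ?lerDr dotv_ge0. Qed.

Lemma qnorm_sublinear q : sublinear (qnorm kap a b q).
Proof.
split.
- move=> x y; rewrite /qnorm.
  have h1 := R0_subadd q x.2 y.2.
  have h2 : Num.sqrt (F q (x + y)) <= Num.sqrt (F q x) + Num.sqrt (F q y).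
    apply: sqrt_quadratic_subadd; first exact: F_ge0.
    move=> {h1}x {}y; have [G1 G1E] := quadpot_expand (VVz q) x.2 y.2.
    have [G2 G2E] := quadpot_expand (VVu q) x.1 y.1.
    by exists (a * G1 + b * G2) => s; rewrite /F/= G1E G2E; ring.
  have := ler_wpM2l kap0 h2; rewrite /F mulrDr /=; lra.
- by move=> l x; exact: qnorm_homog.
have [_ _ _ [C0 [C1 [C00 C10 R0C]]]] := hR.
have [_ [D0 [Cz [D00 Cz0 zC]]]] := hz; have [_ [D1 [Cu [D10 Cu0 uC]]]] := hu.
exists (C1 + kap * Num.sqrt (a * Cz + b * Cu)).
  by rewrite addr_ge0 ?(ltW C10)// mulr_ge0 ?sqrtr_ge0.
move=> x; rewrite /qnorm mulrDl; have [x1 x2] := enorm_le_enormQ x.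
apply: lerD.
  by apply: (le_trans (R0C q x.2).2); rewrite ler_wpM2l// ltW.
rewrite -mulrA ler_wpM2l// -[enormQ x]ger0_norm ?enormQ_ge0// -sqrtr_sqr -sqrtrM; last first.
  by rewrite addr_ge0// mulr_ge0// ltW.
rewrite ler_wsqrtr// mulrDl -!mulrA; apply: lerD; rewrite ler_wpM2l//.
- apply: (le_trans (zC q x.2).2); rewrite ler_wpM2l ?(ltW Cz0)//.
  by rewrite ler_sqr// nnegrE sqrtr_ge0.
- apply: (le_trans (uC q x.1).2); rewrite ler_wpM2l ?(ltW Cu0)//.
  by rewrite ler_sqr// nnegrE sqrtr_ge0.
Qed.

End qnorm.
End potentials.

(** * The limit integrand: bounds from below and from above *)

(** The optimal factor is l = c / (2 V). *)
Lemma quad_opt (R : realType) (c V W : R) : 0 <= V -> 0 <= W ->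
  (forall l : R, 0 <= l -> l * c - l ^+ 2 * V <= W) -> c <= 2 * Num.sqrt V * Num.sqrt W.
Proof.
move=> V0 W0 h; have [c0|c0] := leP c 0.
  by apply: (le_trans c0); rewrite !mulr_ge0 ?sqrtr_ge0.
have [V00|V00] := eqVneq V 0.
  have := h ((W + 1) / c); rewrite V00 mulr0 subr0 divfK ?gt_eqF// divr_ge0 ?(ltW c0)//; last by lra.
  by move=> /(_ isT); lra.
have {V00}V0 : 0 < V by rewrite lt_neqAle eq_sym V00.
have c4 : c ^+ 2 <= 4 * (V * W).
  have := h (c / (2 * V)); rewrite divr_ge0 ?(ltW c0)//; last by rewrite mulr_ge0// ltW.
  move=> /(_ isT).
  have -> : c / (2 * V) * c - (c / (2 * V)) ^+ 2 * V = c ^+ 2 / (4 * V) by field; rewrite gt_eqF.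
  by rewrite ler_pdivrMr ?mulr_gt0// => /le_trans; apply; rewrite le_eqVlt; apply/orP; left; apply/eqP; ring.
rewrite -[c]gtr0_norm// -sqrtr_sqr -mulrA -sqrtrM ?(ltW V0)//.
have -> : 2 = Num.sqrt (2 ^+ 2) :> R by rewrite sqrtr_sqr ger0_norm.
by rewrite -sqrtrM ?sqr_ge0// ler_wsqrtr//; apply: (le_trans c4); rewrite ler_wpM2r ?mulr_ge0 ?(ltW V0)//; lra.
Qed.

(** The minimum over X of e1 X - kap sqrt X is - kap^2 / (4 e1), by completing the
    square in sqrt X; the hypothesis says that it is at least - B / e2. *)
Lemma am_gm_sqrt (R : realType) (kap e1 e2 B X : R) :
  0 < e1 -> 0 < e2 -> 0 <= X -> kap ^+ 2 * e2 <= 4 * B * e1 ->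
  kap * Num.sqrt X <= e1 * X + B / e2.
Proof.
move=> e10 e20 X0 h.
have h1 : kap ^+ 2 / (4 * e1) <= B / e2.
  rewrite ler_pdivrMr ?mulr_gt0// mulrAC ler_pdivlMr//; lra.
rewrite -{2}[X]sqr_sqrtr//; set s := Num.sqrt X.
have : 0 <= e1 * (s - kap / (2 * e1)) ^+ 2 by rewrite mulr_ge0 ?sqr_ge0 ?ltW.
have -> : e1 * (s - kap / (2 * e1)) ^+ 2 = e1 * s ^+ 2 - kap * s + kap ^+ 2 / (4 * e1).
  by field; rewrite gt_eqF.
lra.
Qed.

(** The levels allowed in the velocity bounds lie strictly below the conjugates; this
    passage to the limit recovers the conjugates themselves. *)
Lemma le_scaled_limit (R : realType) (r x c : R) :
  (forall l : R, 0 <= l -> l < 1 -> r + l * x <= c) -> r + x <= c.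
Proof.
move=> h; apply/ler_addgt0Pr => e e0; have [x0|x0] := leP x 0.
  by have := h 0 (lexx _) ltr01; lra.
pose l := Num.max 0 (1 - e / x).
have l0 : 0 <= l by rewrite le_max lexx.
have l1 : l < 1 by rewrite gt_max ltr01 ltrBlDr ltrDl divr_gt0.
have : (1 - e / x) * x <= l * x by rewrite ler_wpM2r ?(ltW x0)// le_max lexx orbT.
by rewrite mulrBl divfK ?gt_eqF//; have := h l l0 l1; lra.
Qed.

Section vanishing_viscosity_integrand.
Context (R : realType) (n m : nat) (alpha : R).
Local Notation Q := (Qspace R n m).
Context (R0 : Q -> 'rV[R]_m -> R) (VVz : Q -> 'M[R]_m) (VVu : Q -> 'M[R]_n).
Hypotheses (hR : assumption_R0 R0) (hz : assumption_V VVz) (hu : assumption_V VVu).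

Lemma conjugate_z_fin q (zeta : 'rV[R]_m) : exists W : R, [/\ 0 <= W,
    conjugate (fun z => R0 q z + quadpot (VVz q) z) zeta = W%:E,
    forall v, dotv zeta v - (R0 q v + quadpot (VVz q) v) <= W &
    forall A : R, A < W -> exists v, A < dotv zeta v - (R0 q v + quadpot (VVz q) v)].
Proof.
have [_ [C0 [C1 [C00 _ zC]]]] := hz.
apply: (conjugate_fin zeta C00); first by rewrite (R0_0 hR) quadpot0 addr0.
by move=> v; apply: (le_trans (zC q v).1); rewrite lerDr; exact: (R0_ge0 hR).
Qed.

Lemma conjugate_u_fin q (eta : 'rV[R]_n) : exists X : R, [/\ 0 <= X,
    conjugate (quadpot (VVu q)) eta = X%:E,
    forall v, dotv eta v - quadpot (VVu q) v <= X &
    forall A : R, A < X -> exists v, A < dotv eta v - quadpot (VVu q) v].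
Proof.
have [_ [C0 [C1 [C00 _ uC]]]] := hu.
apply: (conjugate_fin eta C00); first by rewrite quadpot0.
by move=> v; exact: (uC q v).1.
Qed.

(** The case distinction on real numbers: a and b stand for the potentials of the
    velocity, W and X for the conjugates at the force. *)
Definition M0red_fin (tau a b W X : R) : \bar R :=
  if (0 < tau)%R then if (W == 0) && (X == 0) then 0%E else +oo%E
  else if (1 < alpha)%R then
    if a == 0 then (2 * Num.sqrt b * Num.sqrt X)%:E
    else if X == 0 then (2 * Num.sqrt a * Num.sqrt W)%:E else +oo%E
  else if alpha == 1 then (2 * Num.sqrt (a + b) * Num.sqrt (W + X))%:E
  else if W == 0 then (2 * Num.sqrt b * Num.sqrt X)%:E
    else if b == 0 then (2 * Num.sqrt a * Num.sqrt W)%:E else +oo%E.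

Lemma M0E q tau (v xi : Q) (W X : R) :
  conjugate (fun z => R0 q z + quadpot (VVz q) z) xi.2 = W%:E ->
  conjugate (quadpot (VVu q)) xi.1 = X%:E ->
  M0 alpha R0 VVz VVu q tau v xi = ((R0 q v.2)%:E +
    M0red_fin tau (quadpot (VVz q) v.2) (quadpot (VVu q) v.1) W X)%E.
Proof. by move=> hW hX; rewrite /M0 /M0red /M0red_fin hW hX /= !eqe -!EFinM. Qed.

(** The Fenchel-Young inequality is applied to all multiples l v of the velocity.
    Optimizing in l turns the sum of a potential and its conjugate into twice the
    product of their square roots, for the two components separately and for their
    sum, as required by the three regimes of alpha. *)
Lemma M0_ge q tau v xi : ((dotQ xi v)%:E <= M0 alpha R0 VVz VVu q tau v xi)%E.
Proof.
have [W [W0 hW Wge _]] := conjugate_z_fin q xi.2; have [X [X0 hX Xge _]] := conjugate_u_fin q xi.1.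
rewrite (M0E _ _ hW hX).
have a0 : 0 <= quadpot (VVz q) v.2 by exact: quadpot_ge0.
have b0 : 0 <= quadpot (VVu q) v.1 by exact: quadpot_ge0.
have hz' (l : R) : 0 <= l -> l * (dotv xi.2 v.2 - R0 q v.2) - l ^+ 2 * quadpot (VVz q) v.2 <= W.
  move=> l0; have := Wge (l *: v.2); rewrite (R0_homog hR)// quadpotZ dotvZr; lra.
have hu' (l : R) : 0 <= l -> l * dotv xi.1 v.1 - l ^+ 2 * quadpot (VVu q) v.1 <= X.
  by move=> l0; have := Xge (l *: v.1); rewrite quadpotZ dotvZr.
have kz := quad_opt a0 W0 hz'; have ku := quad_opt b0 X0 hu'.
have kzu := @quad_opt _ (dotQ xi v - R0 q v.2) _ _ (addr_ge0 a0 b0) (addr_ge0 W0 X0) _.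
have {}kzu : dotQ xi v - R0 q v.2 <= 2 * Num.sqrt (quadpot (VVz q) v.2 + quadpot (VVu q) v.1) *
    Num.sqrt (W + X).
  by apply: kzu => l l0; have := hz' l l0; have := hu' l l0; rewrite /dotQ; lra.
move: a0 b0 kz ku kzu {hz' hu'}; rewrite /dotQ.
set a := quadpot _ _; set b := quadpot _ _; set z := dotv _ _; set u := dotv _ _; set r := R0 _ _.
move=> a0 b0 kz ku kzu; rewrite /M0red_fin.
have st : Num.sqrt 0 = 0 :> R by rewrite sqrtr0.
case: ifP => _; [|case: ifP => _; [|case: ifP => _]].
- case: ifP => [/andP[/eqP W00 /eqP X00]|_]; last by rewrite addey ?leey.
  by move: kz ku; rewrite W00 X00 st !mulr0 adde0 lee_fin; lra.
- case: ifP => [/eqP az|_]; first by move: kz; rewrite az st mulr0 mul0r -EFinD lee_fin; lra.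
  case: ifP => [/eqP Xz|_]; last by rewrite addey ?leey.
  by move: ku; rewrite Xz st mulr0 -EFinD lee_fin; lra.
- by rewrite -EFinD lee_fin; lra.
- case: ifP => [/eqP Wz|_]; first by move: kz; rewrite Wz st mulr0 -EFinD lee_fin; lra.
  case: ifP => [/eqP bz|_]; last by rewrite addey ?leey.
  by move: ku; rewrite bz st mulr0 mul0r -EFinD lee_fin; lra.
Qed.

(** The bounds on limit velocities inherited from the viscous inclusions. The numbers A
    and B are levels of the two conjugates that test vectors exceed near the limit
    state. The displayed condition says that, for small eps, the viscous
    dissipation together with the reaction of these levels outweighs
    C + kap sqrt (a Vz + b Vu); in the limit, C multiplies the speed tau of the
    external time. *)
Definition lower_bounds (eps : nat -> R) (q : Q) (tau : R) (v xi : Q) : Prop :=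
  forall A B C kap a b : R, 0 <= A -> 0 <= B -> 0 <= kap -> 0 <= a -> 0 <= b ->
  (A = 0 \/ (A%:E < conjugate (fun z => (R0 q z + quadpot (VVz q) z)%R) xi.2)%E) ->
  (B = 0 \/ (B%:E < conjugate (quadpot (VVu q)) xi.1)%E) ->
  (\forall k \near \oo, forall X Y : R, 0 <= X -> 0 <= Y ->
     C + kap * Num.sqrt (a * X + b * Y) <=
     eps k * X + eps k `^ alpha * Y + A / eps k + B / eps k `^ alpha) ->
  qnorm R0 VVz VVu kap a b q v + C * tau <= dotQ xi v.

(** Every case of M0 comes from its own constants. A positive level allows any C for
    small eps, so that tau > 0 forces both conjugates to vanish. Levels close to the
    conjugates with kap close to twice their roots give the finite values, the two
    viscous terms being combined only if alpha = 1. If alpha > 1 and B > 0, the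
    reaction B / eps^alpha exceeds any multiple of 1 / eps, so kap is arbitrary and Vz
    must vanish; the roles are exchanged if alpha < 1. *)
Lemma M0_le (eps : nat -> R) q tau v xi :
  0 < alpha -> (forall k, 0 < eps k) -> eps @ \oo --> (0 : R) ->
  lower_bounds eps q tau v xi ->
  (M0 alpha R0 VVz VVu q tau v xi <= (dotQ xi v)%:E)%E.
Proof.
move=> al0 ep0 ec LB.
have [W [W0 hW _ _]] := conjugate_z_fin q xi.2; have [X [X0 hX _ _]] := conjugate_u_fin q xi.1.
rewrite (M0E _ _ hW hX) /M0red_fin; rewrite /lower_bounds hW hX in LB.
have a0 : 0 <= quadpot (VVz q) v.2 by exact: quadpot_ge0.
have b0 : 0 <= quadpot (VVu q) v.1 by exact: quadpot_ge0.
have r0 : 0 <= R0 q v.2 by exact: R0_ge0.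
have epa k : 0 < eps k `^ alpha by exact: powR_gt0.
rewrite /qnorm in LB; move: LB a0 b0 r0.
set a := quadpot _ _; set b := quadpot _ _; set r := R0 _ _; set c := dotQ _ _.
move=> LB a0 b0 r0.
have sc (l Z : R) : 0 <= l -> l < 1 -> 0 <= Z -> l ^+ 2 * Z = 0 \/ ((l ^+ 2 * Z)%:E < Z%:E)%E.
  move=> l0 l1; rewrite le_eqVlt => /predU1P[<-|Z0]; first by left; rewrite mulr0.
  by right; rewrite lte_fin gtr_pMl// expr_lt1.
have sq0 (l : R) : 0 <= l -> forall Z : R, Num.sqrt (l ^+ 2 * Z) = l * Num.sqrt Z.
  by move=> l0 Z; rewrite sqrtrM ?sqr_ge0// sqrtr_sqr ger0_norm.
have ea : eps k `^ alpha @[k --> \oo] --> (0 : R).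
  apply: (cvg_comp _ _ _ (powR_cvg0 al0)) => A [d d0 dA].
  move/cvgrPdist_lt : ec => /(_ d d0); apply: filterS => k kd; apply: dA => //.
have eps_small (d : R) : 0 < d -> \forall k \near \oo, eps k < d.
  move=> d0; move/cvgrPdist_lt : ec => /(_ d d0); apply: filterS => k.
  by rewrite sub0r normrN gtr0_norm.
have epa_small (d : R) : 0 < d -> \forall k \near \oo, eps k `^ alpha < d.
  move=> d0; move/cvgrPdist_lt : ea => /(_ d d0); apply: filterS => k.
  by rewrite sub0r normrN gtr0_norm.
have base : r <= c.
  have := LB 0 0 0 0 0 0 (lexx _) (lexx _) (lexx _) (lexx _) (lexx _) (or_introl erefl) (or_introl erefl).
  rewrite !mul0r !addr0; apply; apply: nearW => k x y x0 y0.
  by rewrite !mul0r !addr0 addr_ge0// mulr_ge0// ltW.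
have half (Z : R) : 0 <= Z -> Z != 0 -> 0 < Z / 2 /\ ((Z / 2)%:E < Z%:E)%E.
  move=> Z0 Zn; have {Zn}Z0 : 0 < Z by rewrite lt_neqAle eq_sym Zn.
  by rewrite divr_gt0// lte_fin ltr_pdivrMr// ltr_pMr// ltr1n.
have pos_terms k (x y : R) : 0 <= x -> 0 <= y -> 0 <= eps k * x + eps k `^ alpha * y.
  by move=> x0 y0; rewrite addr_ge0// mulr_ge0// ltW.
(* The constant C below would make the left side of the bound equal to c + 1. *)
have tauW : W != 0 -> tau <= 0.
  move=> /(half _ W0)[h1 h2]; rewrite leNgt; apply/negP => tau1.
  pose C := (c - r + 1) / tau; have C0 : 0 < C by rewrite divr_gt0//; lra.
  have := LB (W / 2) 0 C 0 0 0 (ltW h1) (lexx _) (lexx _) (lexx _) (lexx _) (or_intror h2) (or_introl erefl).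
  rewrite !mul0r !addr0 {2}/C divfK ?gt_eqF// => h; suff : r + (c - r + 1) <= c by lra.
  apply: h; apply: filterS (eps_small _ (divr_gt0 h1 C0)) => k hk x y x0 y0.
  rewrite !mul0r !addr0; apply: ler_wpDl; first exact: pos_terms.
  by rewrite ler_pdivlMr// mulrC -ler_pdivlMr// ltW.
have tauX : X != 0 -> tau <= 0.
  move=> /(half _ X0)[h1 h2]; rewrite leNgt; apply/negP => tau1.
  pose C := (c - r + 1) / tau; have C0 : 0 < C by rewrite divr_gt0//; lra.
  have := LB 0 (X / 2) C 0 0 0 (lexx _) (ltW h1) (lexx _) (lexx _) (lexx _) (or_introl erefl) (or_intror h2).
  rewrite !mul0r !addr0 {2}/C divfK ?gt_eqF// => h; suff : r + (c - r + 1) <= c by lra.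
  apply: h; apply: filterS (epa_small _ (divr_gt0 h1 C0)) => k hk x y x0 y0.
  rewrite !mul0r !addr0; apply: ler_wpDl; first exact: pos_terms.
  by rewrite ler_pdivlMr// mulrC -ler_pdivlMr// ltW.
case: ifPn => [tau1|].
  have [_|/tauW] := eqVneq W 0; last by rewrite leNgt tau1.
  have [_|/tauX] := eqVneq X 0; last by rewrite leNgt tau1.
  by rewrite adde0 lee_fin.
move=> _ {tauW tauX}.
have {}LB A B kap a' b' : 0 <= A -> 0 <= B -> 0 <= kap -> 0 <= a' -> 0 <= b' ->
  (A = 0 \/ (A%:E < W%:E)%E) -> (B = 0 \/ (B%:E < X%:E)%E) ->
  (\forall k \near \oo, forall x y : R, 0 <= x -> 0 <= y ->
     kap * Num.sqrt (a' * x + b' * y) <=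
     eps k * x + eps k `^ alpha * y + A / eps k + B / eps k `^ alpha) ->
  r + kap * Num.sqrt (a' * a + b' * b) <= c.
  move=> A0 B0 k0 a1 b1 hA hB hk; have := LB A B 0 kap a' b' A0 B0 k0 a1 b1 hA hB.
  rewrite mul0r addr0; apply; apply: filterS hk => k hk x y x0 y0.
  by rewrite add0r; exact: hk.
have sqX (l Z : R) : 0 <= Z -> (2 * (l * Num.sqrt Z)) ^+ 2 = 4 * (l ^+ 2 * Z).
  by move=> Z0; rewrite !exprMn sqr_sqrtr//; ring.
have rate_u : r + 2 * Num.sqrt b * Num.sqrt X <= c.
  apply: le_scaled_limit => l l0 l1.
  have B0 : 0 <= l ^+ 2 * X by rewrite mulr_ge0 ?sqr_ge0.
  have k0 : 0 <= 2 * (l * Num.sqrt X) by rewrite !mulr_ge0// sqrtr_ge0.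
  have := LB 0 (l ^+ 2 * X) _ 0 1 (lexx _) B0 k0 (lexx _) ler01 (or_introl erefl) (sc _ _ l0 l1 X0).
  rewrite !mul0r mul1r add0r.
  have -> : 2 * (l * Num.sqrt X) * Num.sqrt b = l * (2 * Num.sqrt b * Num.sqrt X) by ring.
  apply; apply: nearW => k x y x0 y0; rewrite !mul0r mul1r add0r addr0.
  rewrite -addrA; apply: ler_wpDl; first by rewrite mulr_ge0// ltW.
  by apply: am_gm_sqrt => //; rewrite sqX.
have rate_z : r + 2 * Num.sqrt a * Num.sqrt W <= c.
  apply: le_scaled_limit => l l0 l1.
  have A0 : 0 <= l ^+ 2 * W by rewrite mulr_ge0 ?sqr_ge0.
  have k0 : 0 <= 2 * (l * Num.sqrt W) by rewrite !mulr_ge0// sqrtr_ge0.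
  have := LB (l ^+ 2 * W) 0 _ 1 0 A0 (lexx _) k0 ler01 (lexx _) (sc _ _ l0 l1 W0) (or_introl erefl).
  rewrite !mul0r mul1r addr0.
  have -> : 2 * (l * Num.sqrt W) * Num.sqrt a = l * (2 * Num.sqrt a * Num.sqrt W) by ring.
  apply; apply: nearW => k x y x0 y0; rewrite !mul0r mul1r !addr0.
  rewrite addrAC; apply: ler_wpDr; first by rewrite mulr_ge0// ltW.
  by apply: am_gm_sqrt => //; rewrite sqX.
(* A bound for all factors kap would fail at the factor below, where it reads
   c + 1 <= c. *)
have no_bound (x : R) : 0 <= x -> (forall kap, 0 <= kap -> r + kap * Num.sqrt x <= c) -> x = 0.
  move=> x0 h; apply/eqP; rewrite eq_le x0 andbT leNgt; apply/negP => x1.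
  have sx : 0 < Num.sqrt x by rewrite sqrtr_gt0.
  have := h ((c - r + 1) / Num.sqrt x); rewrite divfK ?gt_eqF// divr_ge0 ?sqrtr_ge0//; last lra.
  by move=> /(_ isT); lra.
have pow_split k (p : R) : eps k `^ p = eps k * eps k `^ (p - 1).
  rewrite -{2}[eps k]powRr1 ?(ltW (ep0 k))// -powRD; last first.
    by apply/implyP => _; rewrite gt_eqF.
  by rewrite addrC subrK.
case: ifPn => [al1|].
  case: ifPn => [/eqP az|an0]; first by rewrite -EFinD lee_fin.
  case: ifPn => [/eqP Xz|Xn0]; first by rewrite -EFinD lee_fin.
  exfalso; move/eqP: an0; apply; apply: no_bound => // kap k0.
  have [h1 h2] := half _ X0 Xn0.
  have := LB 0 (X / 2) kap 1 0 (lexx _) (ltW h1) k0 ler01 (lexx _) (or_introl erefl) (or_intror h2).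
  rewrite mul1r mul0r addr0; apply.
  have al10 : 0 < alpha - 1 by rewrite subr_gt0.
  have ea1 : eps k `^ (alpha - 1) @[k --> \oo] --> (0 : R).
    apply: (cvg_comp _ _ _ (powR_cvg0 al10)) => A [d d0 dA].
    by apply: filterS (eps_small d d0) => k kd; apply: dA => //=; rewrite sub0r normrN gtr0_norm.
  have d0 : 0 < 2 * X / (kap ^+ 2 + 1).
    by rewrite divr_gt0 ?mulr_gt0 ?ltr_wpDl ?sqr_ge0//; lra.
  move/cvgrPdist_lt : ea1 => /(_ _ d0); apply: filterS => k.
  rewrite sub0r normrN gtr0_norm ?powR_gt0// ltr_pdivlMr ?ltr_wpDl ?sqr_ge0// => hk x y x0 y0.
  rewrite !mul0r mul1r !addr0 addrAC; apply: ler_wpDr; first by rewrite mulr_ge0// ltW.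
  apply: am_gm_sqrt => //; rewrite pow_split mulrCA [leRHS]mulrC ler_wpM2l ?(ltW (ep0 k))//.
  have : 0 <= eps k `^ (alpha - 1) by exact: powR_ge0.
  by move: hk; rewrite mulrDr mulr1 mulrC; lra.
rewrite -leNgt => al1; case: ifPn => [/eqP alE|aln].
  rewrite -EFinD lee_fin; apply: le_scaled_limit => l l0 l1.
  have A0 : 0 <= l ^+ 2 * W by rewrite mulr_ge0 ?sqr_ge0.
  have B0 : 0 <= l ^+ 2 * X by rewrite mulr_ge0 ?sqr_ge0.
  have k0 : 0 <= 2 * (l * Num.sqrt (W + X)) by rewrite !mulr_ge0// sqrtr_ge0.
  have := LB _ _ _ 1 1 A0 B0 k0 ler01 ler01 (sc _ _ l0 l1 W0) (sc _ _ l0 l1 X0).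
  rewrite !mul1r.
  have -> : 2 * (l * Num.sqrt (W + X)) * Num.sqrt (a + b) =
    l * (2 * Num.sqrt (a + b) * Num.sqrt (W + X)) by ring.
  apply; apply: nearW => k x y x0 y0; rewrite !mul1r alE powRr1 ?(ltW (ep0 k))//.
  rewrite -mulrDr -addrA -mulrDl -mulrDr.
  apply: am_gm_sqrt => //; first exact: addr_ge0.
  by rewrite sqX// addr_ge0.
case: ifPn => [/eqP Wz|Wn0]; first by rewrite -EFinD lee_fin.
case: ifPn => [/eqP bz|bn0]; first by rewrite -EFinD lee_fin.
exfalso; move/eqP: bn0; apply; apply: no_bound => // kap k0.
have [h1 h2] := half _ W0 Wn0.
have := LB (W / 2) 0 kap 0 1 (ltW h1) (lexx _) k0 (lexx _) ler01 (or_intror h2) (or_introl erefl).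
rewrite mul1r mul0r add0r; apply.
have al10 : 0 < 1 - alpha by rewrite subr_gt0 lt_neqAle aln.
have ea1 : eps k `^ (1 - alpha) @[k --> \oo] --> (0 : R).
  apply: (cvg_comp _ _ _ (powR_cvg0 al10)) => A [d d0 dA].
  by apply: filterS (eps_small d d0) => k kd; apply: dA => //=; rewrite sub0r normrN gtr0_norm.
have d0 : 0 < 2 * W / (kap ^+ 2 + 1).
  by rewrite divr_gt0 ?mulr_gt0 ?ltr_wpDl ?sqr_ge0//; lra.
move/cvgrPdist_lt : ea1 => /(_ _ d0); apply: filterS => k.
rewrite sub0r normrN gtr0_norm ?powR_gt0// ltr_pdivlMr ?ltr_wpDl ?sqr_ge0// => hk x y x0 y0.
rewrite !mul0r mul1r !addr0 add0r -addrA.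
apply: ler_wpDl; first by rewrite mulr_ge0// ltW.
apply: am_gm_sqrt => //.
have E : eps k = eps k `^ alpha * eps k `^ (1 - alpha).
  rewrite -powRD; last by apply/implyP => _; rewrite gt_eqF.
  by rewrite addrC subrK powRr1// ltW.
rewrite [X in _ * X <= _]E mulrCA [leRHS]mulrC ler_wpM2l ?(ltW (epa k))//.
have : 0 <= eps k `^ (1 - alpha) by exact: powR_ge0.
by move: hk; rewrite mulrDr mulr1 mulrC; lra.
Qed.

End vanishing_viscosity_integrand.

(** * Continuity of the potentials *)

Section potential_continuity.
Context (R : realType) (n m : nat).
Local Notation Q := (Qspace R n m).

Lemma dotv_cvg (T : Type) (F : set_system T) (FF : Filter F) (k : nat)
    (u v : T -> 'rV[R]_k) (u0 v0 : 'rV[R]_k) :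
  u x @[x --> F] --> u0 -> v x @[x --> F] --> v0 ->
  dotv (u x) (v x) @[x --> F] --> dotv u0 v0.
Proof.
move=> uc vc; rewrite /dotv; apply: cvg_sumr => i; apply: cvgM.
- by apply: (cvg_comp _ (fun w : 'rV[R]_k => w 0 i) uc); exact: coord_continuous.
- by apply: (cvg_comp _ (fun w : 'rV[R]_k => w 0 i) vc); exact: coord_continuous.
Qed.

Lemma quadpot_cvg (T : Type) (F : set_system T) (FF : Filter F) (k : nat)
    (A : T -> 'M[R]_k) (v : T -> 'rV[R]_k) (A0 : 'M[R]_k) (v0 : 'rV[R]_k) :
  A x @[x --> F] --> A0 -> v x @[x --> F] --> v0 ->
  quadpot (A x) (v x) @[x --> F] --> quadpot A0 v0.
Proof.
move=> Ac vc; rewrite /quadpot; apply: cvgM; first exact: cvg_cst.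
have vi i : v x 0 i @[x --> F] --> v0 0 i.
  by apply: (cvg_comp _ (fun w : 'rV[R]_k => w 0 i) vc); exact: coord_continuous.
rewrite /dotv; apply: cvg_sumr => i; apply: cvgM; last exact: vi.
rewrite mxE; under eq_fun do rewrite mxE.
apply: cvg_sumr => j; apply: cvgM; first exact: vi.
rewrite mxE; under eq_fun do rewrite mxE.
by apply: (cvg_comp _ (fun B : 'M[R]_k => B i j) Ac); exact: coord_continuous.
Qed.

(** Joint continuity is uniform in the directions w of a compact box, and homogeneity
    extends the estimate to all vectors. *)
Lemma homogeneous_close (F : Q -> Q -> R) (q0 : Q) (d : R) :
  continuous (fun p : Q * Q => F p.1 p.2) ->
  (forall q (l : R) w, 0 <= l -> F q (l *: w) = l * F q w) -> 0 < d ->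
  \forall q \near q0, forall w, F q0 w <= F q w + d * enormQ w.
Proof.
move=> Fc Fh d0; have d20 : 0 < d / 2 by rewrite divr_gt0.
pose P (q w : Q) := `|F q0 w - F q w| < d.
have /compact_near_coveringP cov := @box_compact R n m 1.
have : \forall q \near q0, [set w : Q | forall k, `|crd k w| <= 1] `<=` P q.
  apply: (cov Q (nbhs q0) P (nbhs_filter q0)) => x _; have /cvgrPdist_lt := Fc (q0, x).
  move=> /(_ _ d20)[[A B] /= [qA xB] AB]; exists (B, A); first by split.
  move=> [w q] /= [Bw Aq]; rewrite /P.
  have h1 := AB (q, w) (conj Aq Bw); have h2 := AB (q0, w) (conj (nbhs_singleton qA) Bw).
  rewrite /= in h1 h2.
  have -> : F q0 w - F q w = (F q0 x - F q w) - (F q0 x - F q0 w) by ring.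
  by apply: le_lt_trans (ler_normB _ _) _; rewrite (splitr d) ltrD.
apply: filterS => q hq w; have [w0|w0] := eqVneq (enormQ w) 0.
  have -> : w = 0 *: w.
    apply/esym; rewrite scale0r [w]crd_expand; apply/esym; rewrite big1// => k _.
    have := crd_le_enormQ k w; rewrite w0 normr_le0 => /eqP ->.
    by rewrite scale0r.
  by rewrite !Fh// !mul0r enormQZ normr0 mul0r mulr0 addr0.
have wp : 0 < enormQ w by rewrite lt_neqAle eq_sym w0 enormQ_ge0.
pose u := (enormQ w)^-1 *: w.
have wE : w = enormQ w *: u by rewrite scalerA mulfV// scale1r.
have /hq : forall k, `|crd k u| <= 1.
  move=> k; rewrite /u crdZ normrM gtr0_norm ?invr_gt0// mulrC ler_pdivrMr// mul1r.
  exact: crd_le_enormQ.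
rewrite /P => /ltW/(le_trans (ler_norm _)) h.
have Fw q' : F q' w = enormQ w * F q' u by rewrite {1}wE Fh ?enormQ_ge0.
rewrite !Fw -lerBlDl -mulrBr mulrC ler_wpM2r ?enormQ_ge0//.
Qed.

Context (R0 : Q -> 'rV[R]_m -> R) (VVz : Q -> 'M[R]_m) (VVu : Q -> 'M[R]_n).
Hypotheses (hR : assumption_R0 R0) (hz : assumption_V VVz) (hu : assumption_V VVu).

Lemma R0_cvg (T : Type) (F : set_system T) (FF : Filter F) (q : T -> Q)
    (v : T -> 'rV[R]_m) (q0 : Q) (v0 : 'rV[R]_m) :
  q x @[x --> F] --> q0 -> v x @[x --> F] --> v0 ->
  R0 (q x) (v x) @[x --> F] --> R0 q0 v0.
Proof.
move=> qc vc; have [hc _ _ _] := hR.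
apply: (@cvg_comp _ _ _ (fun x => (q x, v x)) (fun p => R0 p.1 p.2) F (nbhs (q0, v0))).
  move=> A [[A1 A2] /= [qA1 vA2] sub].
  have h := @filterI _ F FF _ _ (qc _ qA1) (vc _ vA2).
  by apply: (@filterS _ F FF _ _ _ h) => x [? ?]; exact: sub.
exact: (hc (q0, v0)).
Qed.

Lemma qnorm_continuous (kap a b : R) :
  continuous (fun p : Q * Q => qnorm R0 VVz VVu kap a b p.1 p.2).
Proof.
move=> p; rewrite /qnorm.
have c1 : x.1 @[x --> p] --> p.1 by exact: cvg_fst.
have c2 : x.2 @[x --> p] --> p.2 by exact: cvg_snd.
have c21 : x.2.1 @[x --> p] --> p.2.1 by apply: (cvg_comp _ fst c2); exact: cvg_fst.
have c22 : x.2.2 @[x --> p] --> p.2.2 by apply: (cvg_comp _ snd c2); exact: cvg_snd.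
have cz : VVz x.1 @[x --> p] --> VVz p.1 by apply: (cvg_comp _ _ c1); exact: hz.1.
have cu : VVu x.1 @[x --> p] --> VVu p.1 by apply: (cvg_comp _ _ c1); exact: hu.1.
apply: cvgD; first exact: R0_cvg.
apply: cvgM; first exact: cvg_cst.
apply: (cvg_comp _ Num.sqrt); last exact: sqrt_continuous.
by apply: cvgD; apply: cvgM; [exact: cvg_cst|exact: quadpot_cvg|exact: cvg_cst|exact: quadpot_cvg].
Qed.

(** The test vector is scaled so that its own viscous dissipation and its pairing with
    the force grow at the same rate, 1 / eps in z and 1 / eps^alpha in u. *)
Lemma subdifferential_lower_bound (alpha eps : R) (q v xi : Q) (wz : 'rV[R]_m) (wu : 'rV[R]_n) :
  0 < eps -> subdifferential (Reps alpha R0 VVz VVu eps q) v xi ->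
  R0 q v.2 + eps * quadpot (VVz q) v.2 + eps `^ alpha * quadpot (VVu q) v.1 +
    (dotv xi.2 wz - (R0 q wz + quadpot (VVz q) wz)) / eps +
    (dotv xi.1 wu - quadpot (VVu q) wu) / eps `^ alpha <= dotQ xi v.
Proof.
move=> e0; have ea0 : 0 < eps `^ alpha by exact: powR_gt0.
move=> /(_ ((eps `^ alpha)^-1 *: wu, eps^-1 *: wz)).
have e1 : 0 <= eps^-1 by rewrite invr_ge0 ltW.
rewrite /Reps dotQBr /dotQ/= (R0_homog hR _ _ e1) !quadpotZ !dotvZr.
have -> : eps * (eps^-1 ^+ 2 * quadpot (VVz q) wz) = eps^-1 * quadpot (VVz q) wz.
  by field; rewrite gt_eqF.
have -> : eps `^ alpha * ((eps `^ alpha)^-1 ^+ 2 * quadpot (VVu q) wu) =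
    (eps `^ alpha)^-1 * quadpot (VVu q) wu.
  by field; rewrite gt_eqF.
lra.
Qed.
End potential_continuity.

(** * Velocity bounds for the viscous inclusion *)

Lemma nbhs_crd (R : realType) (n m : nat) (q0 : Qspace R n m) (B : set (Qspace R n m)) :
  nbhs q0 B -> exists2 r : R, 0 < r & forall q, (forall c, `|crd c q0 - crd c q| < r) -> B q.
Proof.
move=> qB; pose F := filter_from [set r : R | 0 < r]
  (fun r => [set q : Qspace R n m | forall c, `|crd c q0 - crd c q| < r]).
have FF : Filter F.
  apply: filter_from_filter; first by exists 1 => /=.
  move=> r s /= r0 s0; exists (Num.min r s); first by rewrite /= lt_min r0.
  by move=> q /= h; split => c; have := h c; rewrite lt_min => /andP[].
have [|r r0 rB] := (cvg_crd FF id q0).1 _ _ qB; last by exists r.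
by move=> k; apply/cvgrPdist_lt => e e0; exists e => //= q; exact.
Qed.

Section viscous_estimate.
Context (R : realType) (n m : nat) (T alpha : R).
Local Notation Q := (Qspace R n m).
Context (R0 : Q -> 'rV[R]_m -> R) (VVz : Q -> 'M[R]_m) (VVu : Q -> 'M[R]_n).
Context (E : R -> Q -> R).
Hypotheses (hR : assumption_R0 R0) (hz : assumption_V VVz) (hu : assumption_V VVu).
Hypothesis hE : C1_energy T E.

Let D : set (R * Q) := `[0, T]%classic `*` setT.

Lemma near_box (t0 : R) (q0 : Q) (P : R * Q -> Prop) :
  (\forall z \near within D (nbhs (t0, q0)), P z) ->
  exists2 r : R, 0 < r & forall t' q', t' \in `[0, T] -> `|t0 - t'| < r ->
    (forall c, `|crd c q0 - crd c q'| < r) -> P (t', q').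
Proof.
move=> [[A B] /= [[r1 r10 r1A] /nbhs_crd[r2 r20 r2B]] AB].
exists (Num.min r1 r2); first by rewrite lt_min r10.
move=> t' q' tT; rewrite lt_min => /andP[h1 _] h2; apply: (AB (t', q')); last by split.
by split => /=; [exact: r1A|apply: r2B => c; have := h2 c; rewrite lt_min => /andP[]].
Qed.

(** The expressions whose suprema over w are the conjugates at the force - DqE. The
    vector is kept fixed while time and state vary. *)
Definition test_z (w : 'rV[R]_m) (z : R * Q) : R :=
  dotv (- DqE E z.1 z.2).2 w - (R0 z.2 w + quadpot (VVz z.2) w).
Definition test_u (w : 'rV[R]_n) (z : R * Q) : R :=
  dotv (- DqE E z.1 z.2).1 w - quadpot (VVu z.2) w.

Let Dsnd (z0 : R * Q) : z.2 @[z --> within D (nbhs z0)] --> z0.2.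
Proof. by apply: cvg_within_filter; exact: cvg_snd. Qed.

Let DqEc z0 : D z0 -> - DqE E z.1 z.2 @[z --> within D (nbhs z0)] --> - DqE E z0.1 z0.2.
Proof.
move=> Dz; apply: cvgN; have [_ [_ _ c]] := hE.
by move/subspace_continuousP : c; exact.
Qed.

Lemma test_z_cvg w z0 : D z0 -> test_z w z @[z --> within D (nbhs z0)] --> test_z w z0.
Proof.
move=> Dz; apply: cvgB.
  apply: dotv_cvg; last exact: cvg_cst.
  by apply: (cvg_comp _ snd (DqEc Dz)); exact: cvg_snd.
apply: cvgD.
  by apply: (R0_cvg hR); [exact: Dsnd|exact: cvg_cst].
apply: quadpot_cvg; last exact: cvg_cst.
by apply: (cvg_comp _ _ (@Dsnd z0)); exact: hz.1.
Qed.

Lemma test_u_cvg w z0 : D z0 -> test_u w z @[z --> within D (nbhs z0)] --> test_u w z0.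
Proof.
move=> Dz; apply: cvgB.
  apply: dotv_cvg; last exact: cvg_cst.
  by apply: (cvg_comp _ fst (DqEc Dz)); exact: cvg_fst.
apply: quadpot_cvg; last exact: cvg_cst.
by apply: (cvg_comp _ _ (@Dsnd z0)); exact: hu.1.
Qed.

(** A level strictly below the supremum is exceeded by some test vector, and then by
    the same vector at all nearby points; the zero vector realizes the level 0. *)
Lemma test_z_level (A : R) (t0 : R) (q0 : Q) : t0 \in `[0, T] ->
  (A = 0 \/ (A%:E < conjugate (fun z => (R0 q0 z + quadpot (VVz q0) z)%R) (- DqE E t0 q0)%R.2)%E) ->
  exists w, \forall z \near within D (nbhs (t0, q0)), A <= test_z w z.
Proof.
move=> tT [->|].
  exists 0; apply: filterE => z.
  by rewrite /test_z dotv0 (R0_0 hR) quadpot0 addr0 subrr.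
have [W [_ -> _ Wex]] := conjugate_z_fin hR hz q0 (- DqE E t0 q0).2.
rewrite lte_fin => /Wex[w wA]; exists w.
have Dz : D (t0, q0) by split.
by apply: (cvgr_ge _ (test_z_cvg (w := w) Dz)).
Qed.

Lemma test_u_level (B : R) (t0 : R) (q0 : Q) : t0 \in `[0, T] ->
  (B = 0 \/ (B%:E < conjugate (quadpot (VVu q0)) (- DqE E t0 q0)%R.1)%E) ->
  exists w, \forall z \near within D (nbhs (t0, q0)), B <= test_u w z.
Proof.
move=> tT [->|].
  exists 0; apply: filterE => z.
  by rewrite /test_u dotv0 quadpot0 subrr.
have [W [_ -> _ Wex]] := conjugate_u_fin hu q0 (- DqE E t0 q0).1.
rewrite lte_fin => /Wex[w wA]; exists w.
have Dz : D (t0, q0) by split.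
by apply: (cvgr_ge _ (test_u_cvg (w := w) Dz)).
Qed.

(** The dissipation is frozen at (t0, q0) and dtE is replaced by its value there; the
    test vectors are chosen at (t0, q0) as well. By continuity this costs at most
    d + d |v|, for arbitrary d > 0. *)
Lemma viscous_velocity_bound (eps : nat -> R) (A B C kap a b d t0 : R) (q0 : Q) :
  (forall k, 0 < eps k) -> 0 <= A -> 0 <= B -> 0 <= kap -> 0 <= a -> 0 <= b ->
  t0 \in `[0, T] -> 0 < d ->
  (A = 0 \/ (A%:E < conjugate (fun z => (R0 q0 z + quadpot (VVz q0) z)%R) (- DqE E t0 q0)%R.2)%E) ->
  (B = 0 \/ (B%:E < conjugate (quadpot (VVu q0)) (- DqE E t0 q0)%R.1)%E) ->
  (\forall k \near \oo, forall X Y : R, 0 <= X -> 0 <= Y ->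
     C + kap * Num.sqrt (a * X + b * Y) <=
     eps k * X + eps k `^ alpha * Y + A / eps k + B / eps k `^ alpha) ->
  exists2 r : R, 0 < r & \forall k \near \oo, forall t' q' v,
    t' \in `[0, T] -> `|t0 - t'| < r -> (forall c, `|crd c q0 - crd c q'| < r) ->
    (exists2 xi, subdifferential (Reps alpha R0 VVz VVu (eps k) q') v xi & xi + DqE E t' q' = 0) ->
    qnorm R0 VVz VVu kap a b q0 v + C + dtE T E t' q' + dotQ (DqE E t' q') v <=
      dtE T E t0 q0 + d + d * enormQ v.
Proof.
move=> ep0 A0 B0 kap0 a0 b0 tT d0 hA hB hC.
have [wz wzP] := test_z_level tT hA; have [wu wuP] := test_u_level tT hB.
have Dz : D (t0, q0) by split.
have closeP : \forall z \near within D (nbhs (t0, q0)), forall w,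
    qnorm R0 VVz VVu kap a b q0 w <= qnorm R0 VVz VVu kap a b z.2 w + d * enormQ w.
  have nc : continuous (fun p : Q * Q => qnorm R0 VVz VVu kap a b p.1 p.2).
    exact: qnorm_continuous.
  have nh q (l : R) (w : Q) : 0 <= l ->
    qnorm R0 VVz VVu kap a b q (l *: w) = l * qnorm R0 VVz VVu kap a b q w.
    exact: qnorm_homog.
  have h := homogeneous_close q0 nc nh d0.
  exact: (@Dsnd (t0, q0) _ h).
have dtP : \forall z \near within D (nbhs (t0, q0)), dtE T E z.1 z.2 <= dtE T E t0 q0 + d.
  have [_ [_ c _]] := hE; move/subspace_continuousP : c => /(_ _ Dz) c.
  by apply: (cvgr_le _ c); rewrite ltrDl.
have [r r0 rP] := near_box (filterI (filterI wzP wuP) (filterI closeP dtP)).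
exists r => //; apply: filterS hC => k hk t' q' v t'T tr qr [xi xiS xi0].
have [[h1 h2] [h3 h4]] := rP t' q' t'T tr qr.
have xiE : xi = - DqE E t' q' by apply/eqP; rewrite -addr_eq0 xi0.
have := subdifferential_lower_bound hR wz wu (ep0 k) xiS; rewrite xiE dotQNl => h5.
have X0 : 0 <= quadpot (VVz q') v.2 by exact: quadpot_ge0.
have Y0 : 0 <= quadpot (VVu q') v.1 by exact: quadpot_ge0.
have h6 := hk _ _ X0 Y0; have h7 := h3 v; rewrite /= in h4 h7.
have ea : 0 < eps k `^ alpha by exact: powR_gt0.
have h8 : A / eps k <= test_z wz (t', q') / eps k by rewrite ler_wpM2r// invr_ge0 ltW.
have h9 : B / eps k `^ alpha <= test_u wu (t', q') / eps k `^ alpha.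
  by rewrite ler_wpM2r// invr_ge0 ltW.
move: h5 h6 h7 h8 h9 h4; rewrite /qnorm /test_z /test_u.
set sq := Num.sqrt (a * quadpot (VVz q') _ + _); set sq0 := Num.sqrt _.
set u1 := (X in X / eps k); set u2 := (X in X / eps k `^ alpha).
lra.
Qed.
End viscous_estimate.

(** * Increments of the reparameterized viscous solutions *)

(** As tau maps [x, y] onto [tau x, tau y], partitions of the latter lift to
    partitions of the former. *)
Lemma total_variation_reparam (R : realType) (f tau M : R -> R) (x y : R) :
  (forall a b, x <= a -> a <= b -> b <= y -> tau a <= tau b) ->
  (forall z, tau x <= z -> z <= tau y -> exists2 b, x <= b <= y & tau b = z) ->
  (forall a b, x <= a -> a <= b -> b <= y -> `|f (tau b) - f (tau a)| <= M b - M a) ->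
  x <= y -> (total_variation (tau x) (tau y) f <= (M y - M x)%:E)%E.
Proof.
move=> nd surj fM xy; apply: ge_ereal_sup => _ [_ [p [px pl] <-] <-].
rewrite lee_fin variation_steps; have xx := lexx x.
have gen a : x <= a -> a <= y -> path <%R (tau a) p -> last (tau a) p == tau y ->
    \sum_(u <- steps (tau a) p) `|f u.2 - f u.1| <= M y - M a.
  elim: p a {px pl} => [|z p IH] a xa ay /=.
    by move=> _ _; rewrite big_nil; apply: le_trans (fM a y xa ay (lexx _)).
  move=> /andP[az zp] pl; rewrite big_cons/=.
  have [[/allP sall _] zl] := steps_itv zp.
  have zy : z <= tau y.
    rewrite -(eqP pl) -subr_ge0 -zl big_seq; apply: sumr_ge0 => u us.
    by rewrite subr_ge0; have /and3P[] := sall _ us.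
  have xz : tau x <= z by apply: le_trans (nd _ _ xx xa ay) (ltW az).
  have [b /andP[xb bey] bz] := surj z xz zy.
  have ab : a <= b by rewrite leNgt; apply/negP => /ltW ba; have := nd _ _ xb ba ay; rewrite bz leNgt az.
  have := fM a b xa ab bey; rewrite bz => h1.
  have := IH b xb bey; rewrite bz => /(_ zp pl) h2; lra.
exact: gen.
Qed.

Lemma is_derive1_comb (R : realType) (e V : R -> R) (x e' l c d : R) :
  is_derive x (1 : R) e e' -> is_derive x (1 : R) V l ->
  is_derive x (1 : R) (fun y => - e y + c * y + d * V y) (- e' + c + d * l).
Proof.
move=> he hV; have hi := is_derive_id x (1 : R).
have := is_deriveD (is_deriveD (is_deriveN he) (is_deriveZ c hi)) (is_deriveZ d hV).
by rewrite /GRing.scale/= mulr1.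
Qed.

Lemma le_small_multiple (R : realType) (x y c : R) :
  (forall d : R, 0 < d -> x <= y + d * c) -> x <= y.
Proof.
move=> h; apply/ler_addgt0Pr => e e0; have c1 : 0 < `|c| + 1 by rewrite ltr_wpDl.
apply: le_trans (h _ (divr_gt0 e0 c1)) _; rewrite lerD2l mulrAC ler_pdivrMr//.
by rewrite ler_wpM2l ?(ltW e0)// (le_trans (ler_norm _))// lerDl.
Qed.

Section interval_estimate.
Context (R : realType) (n m : nat) (T : R).
Local Notation Q := (Qspace R n m).
Context (E : R -> Q -> R).
Hypothesis hE : C1_energy T E.
Hypothesis T0 : 0 < T.
Context (qs : R -> Q) (ts : R -> R) (Se : R).
Hypothesis ACqs : absolutely_continuous_on (@enormQ R n m) 0 T qs.
Hypothesis hts : parameterization T Se ts.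

Lemma param_nd x y : 0 <= x -> x <= y -> y <= Se -> ts x <= ts y.
Proof.
move=> x0 xy yS; have [_ nd _ _] := hts.
by apply: nd => //; rewrite in_itv/=; apply/andP; split => //; [exact: le_trans xy yS|exact: le_trans x0 xy].
Qed.

Lemma param_in x : 0 <= x -> x <= Se -> 0 <= ts x /\ ts x <= T.
Proof.
move=> x0 xS; have [_ _ f _] := hts.
by have := f x; rewrite /= !in_itv/= x0 xS => /(_ isT)/andP[].
Qed.

(** A preimage of z outside [x, y] would force z = ts x or z = ts y. *)
Lemma param_surj x y z : 0 <= x -> x <= y -> y <= Se -> ts x <= z -> z <= ts y ->
  exists2 b, x <= b <= y & ts b = z.
Proof.
move=> x0 xy yS xz zy; have y0 := le_trans x0 xy; have xS := le_trans xy yS.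
have [zx|zx] := eqVneq z (ts x); first by exists x => //; rewrite lexx xy.
have [zy'|zy'] := eqVneq z (ts y); first by exists y => //; rewrite lexx xy.
have [_ _ _ /(_ z)] := hts.
rewrite /= in_itv/= (le_trans (param_in x0 xS).1 xz) (le_trans zy (param_in y0 yS).2).
move=> /(_ isT)[b /=]; rewrite in_itv/= => /andP[b0 bS] bz; exists b => //.
apply/andP; split; rewrite leNgt; apply/negP => /ltW h.
- by have := param_nd b0 h xS; rewrite bz leNgt lt_neqAle eq_sym zx xz.
- by have := param_nd y0 h bS; rewrite bz leNgt lt_neqAle zy' zy.
Qed.

Lemma param_length_ge0 : 0 <= Se.
Proof.
have [_ _ _ /(_ 0)] := hts; rewrite /= in_itv/= lexx (ltW T0) => /(_ isT)[b /=].
by rewrite in_itv/= => /andP[b0 bS] _; exact: le_trans bS.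
Qed.

Context (Ms : R -> R) (N : Q -> R) (C d dt0 s1 s2 : R).
Hypotheses (Nsub : sublinear N) (d0 : 0 <= d).
Hypotheses (s10 : 0 <= s1) (s12 : s1 <= s2) (s2S : s2 <= Se).
Hypothesis inc : forall x y, 0 <= x -> x <= y -> y <= s2 ->
  enormQ (qs (ts y) - qs (ts x)) <= Ms y - Ms x.
Hypothesis bound : {ae @lebesgue_measure R, forall t', t' \in `]0, T[ ->
  (exists2 s, s1 <= s <= s2 & ts s = t') ->
  N (derive1 qs t') + C + dtE T E t' (qs t') + dotQ (DqE E t' (qs t')) (derive1 qs t') <=
    dt0 + d + d * enormQ (derive1 qs t')}.

(** The pointwise bound is integrated in physical time by [sublinear_mean_value]. The
    chain rule turns the power into the increment of the energy. The error d |q'| is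
    integrated to the variation of the coordinates, which does not depend on the
    parameterization and is bounded by the function Ms that dominates the increments
    of the reparameterized curve. *)
Lemma interval_estimate :
  N (qs (ts s2) - qs (ts s1)) <=
  - (E (ts s2) (qs (ts s2)) - E (ts s1) (qs (ts s1))) + (dt0 + d - C) * (ts s2 - ts s1) +
  d * (#|{: 'I_n + 'I_m}|%:R * (Ms s2 - Ms s1)).
Proof.
have s20 := le_trans s10 s12; have s1S := le_trans s12 s2S.
have [a10 _] := param_in s10 s1S; have [_ a2T] := param_in s20 s2S.
have a12 := param_nd s10 s12 s2S.
have TT : 0 <= T by exact: ltW.
pose e x := E x (qs x); pose V := curve_var 0 qs.
pose f x := - e x + (dt0 + d - C) * x + d * V x.
have ACe : ACR 0 T e.
  apply: (AC_energy hE TT (@AC_id R 0 T)) => // x x0 xT.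
  by rewrite in_itv/= x0 xT.
have ACf : ACR (ts s1) (ts s2) f.
  apply: (AC_subitv a10 a2T); apply: AC_add; last by apply: AC_scale; exact: AC_curve_var.
  apply: AC_add; last by apply: AC_scale; exact: AC_id.
  by have := AC_scale (-1) ACe; congr absolutely_continuous_on; apply/funext => x; rewrite mulN1r.
have [g [_ _ Vg]] := AC_FTC TT (AC_curve_var ACqs).
(* The pointwise bound says that N (q') is at most the derivative of f, once |q'| is
   replaced by the larger derivative of V. *)
have mv : N (qs (ts s2) - qs (ts s1)) <= f (ts s2) - f (ts s1).
  apply: (sublinear_mean_value (AC_subitv a10 a2T ACqs) a12 Nsub ACf).
  apply: aeW (aeI bound Vg) => x [hx Vx] xa v df qv fd.
  have xT : x \in `]0, T[.
    by move: xa; rewrite !in_itv/= => /andP[? ?]; apply/andP; split; lra.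
  have [||b bs bx] := @param_surj s1 s2 x s10 s12 s2S.
  - by move: xa; rewrite in_itv/= => /andP[/ltW].
  - by move: xa; rewrite in_itv/= => /andP[_ /ltW].
  have {}hx := hx xT (ex_intro2 _ _ b bs bx); rewrite (is_derive1_val qv) in hx.
  have Vl := Vx xT; have vl := curve_var_derive ACqs xT qv Vl.
  have ed : is_derive x (1 : R) e (dtE T E x (qs x) * 1 + dotQ (DqE E x (qs x)) v).
    apply: (E_chain hE (t := id)) => //.
    near=> y; suff : y \in `]0, T[ by rewrite !in_itv/= => /andP[/ltW -> /ltW ->].
    by near: y; exact: near_in_itvoo.
  rewrite (is_derive1_unique fd (is_derive1_comb (dt0 + d - C) d ed Vl)).
  by have := ler_wpM2l d0 vl; lra.
have Vle : V (ts s2) - V (ts s1) <= #|{: 'I_n + 'I_m}|%:R * (Ms s2 - Ms s1).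
  rewrite /V /curve_var -sumrB.
  have -> : #|{: 'I_n + 'I_m}|%:R * (Ms s2 - Ms s1) = \sum_(k : 'I_n + 'I_m) (Ms s2 - Ms s1).
    by rewrite sumr_const mulr_natl.
  apply: ler_sum => k _; rewrite -lee_fin (varfunB (AC_crd ACqs k))//.
  apply: total_variation_reparam => //.
  - by move=> a b sa ab bs; apply: param_nd => //; [exact: le_trans s10 sa|exact: le_trans bs s2S].
  - by move=> z; exact: param_surj.
  - move=> a b sa ab bs; apply: le_trans (inc (le_trans s10 sa) ab bs).
    by rewrite /= -crdB; exact: crd_le_enormQ.
have := ler_wpM2l d0 Vle; move: mv; rewrite /f /e; lra.
Unshelve. all: by end_near. Qed.

End interval_estimate.

(** * Velocity bounds in the limit *)

Section vanishing_viscosity_limit.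
Context (R : realType) (n m : nat) (T alpha : R).
Local Notation Q := (Qspace R n m).
Context (R0 : Q -> 'rV[R]_m -> R) (VVz : Q -> 'M[R]_m) (VVu : Q -> 'M[R]_n).
Context (E : R -> Q -> R).
Hypotheses (hR : assumption_R0 R0) (hz : assumption_V VVz) (hu : assumption_V VVu).
Hypothesis hE : C1_energy T E.
Hypothesis T0 : 0 < T.
Context (ep : nat -> R) (qs : nat -> R -> Q) (ts : nat -> R -> R) (Ss : nat -> R).
Context (S : R) (Ms : nat -> R -> R) (t : R -> R) (q : R -> Q) (M : R -> R).
Let tt k := freeze (Ss k) (ts k).
Let qq k := freeze (Ss k) (qs k \o ts k).
Hypothesis ep0 : forall k, 0 < ep k.
Hypothesis ACqs : forall k, absolutely_continuous_on (@enormQ R n m) 0 T (qs k).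
Hypothesis incl : forall k, {ae @lebesgue_measure R, forall x, x \in `]0, T[ ->
  exists2 xi, subdifferential (Reps alpha R0 VVz VVu (ep k) (qs k x)) (derive1 (qs k) x) xi &
    xi + DqE E x (qs k x) = 0}.
Hypothesis hts : forall k, parameterization T (Ss k) (ts k).
Hypothesis hS : Ss @ \oo --> S.
Hypothesis inc : forall k x y, 0 <= x -> x <= y -> y <= S ->
  tt k y - tt k x + enormQ (qq k y - qq k x) <= Ms k y - Ms k x.
Hypothesis MM : forall x, 0 <= x -> x <= S -> Ms k x @[k --> \oo] --> M x.
Hypothesis unif : forall e : R, 0 < e -> \forall k \near \oo, forall s, 0 <= s -> s <= S ->
  `|t s - tt k s| < e /\ forall c, `|crd c (q s) - crd c (qq k s)| < e.
Hypothesis tT : forall s, 0 <= s -> s <= S -> t s \in `[0, T].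

Let D : set (R * Q) := `[0, T]%classic `*` setT.

Let ttc s : 0 <= s -> s <= S -> tt k s @[k --> \oo] --> t s.
Proof.
move=> s0 sS; apply/cvgrPdist_lt => e /unif; apply: filterS => k h.
exact: (h s s0 sS).1.
Qed.

Let qqc s : 0 <= s -> s <= S -> qq k s @[k --> \oo] --> q s.
Proof.
move=> s0 sS; apply/cvg_crd => c; apply/cvgrPdist_lt => e /unif; apply: filterS => k h.
exact: (h s s0 sS).2.
Qed.

Let Se_gt0 k : 0 <= Ss k. Proof. exact: (param_length_ge0 T0 (hts k)). Qed.

Let ttT k s : 0 <= s -> 0 <= tt k s <= T.
Proof.
move=> s0; apply/andP; apply: (param_in (hts k)); first by rewrite le_min s0 Se_gt0.
by rewrite ge_min lexx orbT.
Qed.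

Let Ec s : 0 <= s -> s <= S -> E (tt k s) (qq k s) @[k --> \oo] --> E (t s) (q s).
Proof.
move=> s0 sS; have Ds : D (t s, q s) by split => //; exact: tT.
have [_ [c _ _]] := hE; move/subspace_continuousP : c => /(_ _ Ds) c.
apply: (@cvg_comp _ _ _ (fun k => (tt k s, qq k s)) (fun p => E p.1 p.2) _ (within D (nbhs (t s, q s)))) => //.
move=> A [[B1 B2] /= [h1 h2] AB].
have n1 : \forall k \near \oo, B1 (tt k s) by exact: (ttc s0 sS h1).
have n2 : \forall k \near \oo, B2 (qq k s) by exact: (qqc s0 sS h2).
apply: filterS (filterI n1 n2) => k [h3 h4].
by apply: (AB (tt k s, qq k s)) => //; split => //=; rewrite in_itv/=; exact: ttT.
Qed.

(** The interval estimates contain no derivatives, so they survive uniform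
    convergence. At a point of differentiability of t, q and M they are divided by
    the length of the interval, which leaves the bound on the derivatives up to an
    error of d (tau + K mu), and d is arbitrary. *)
Lemma lower_bounds_limit s0 tau v mu :
  s0 \in `]0, S[ -> is_derive s0 (1 : R) t tau -> is_derive s0 (1 : R) q v ->
  is_derive s0 (1 : R) M mu ->
  lower_bounds alpha R0 VVz VVu ep (q s0) tau v (- DqE E (t s0) (q s0)).
Proof.
rewrite in_itv/= => /andP[s00 s0S] td qd Md A B C kap a b A0 B0 kap0 a0 b0 hA hB hC.
have ts0 : t s0 \in `[0, T] by apply: tT; exact: ltW.
pose N := qnorm R0 VVz VVu kap a b (q s0).
have Nsub : sublinear N by exact: qnorm_sublinear.
pose K : R := #|{: 'I_n + 'I_m}|%:R.
apply: (@le_small_multiple _ _ _ (tau + K * mu)) => d d0.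
have [r r0 rP] := @viscous_velocity_bound _ _ _ T alpha R0 VVz VVu E hR hz hu hE ep
  A B C kap a b d (t s0) (q s0) ep0 A0 B0 kap0 a0 b0 ts0 d0 hA hB hC.
have r20 : 0 < r / 2 by rewrite divr_gt0.
pose dt0 := dtE T E (t s0) (q s0).
pose F s := - E (t s) (q s) + (dt0 + d - C) * t s + d * (K * M s).
have tc : {for s0, continuous t}.
  by apply: differentiable_continuous; apply/derivable1_diffP; apply: ex_derive.
have qc : {for s0, continuous q}.
  by apply: differentiable_continuous; apply/derivable1_diffP; apply: ex_derive.
have near_t : \forall s \near s0, `|t s0 - t s| < r / 2.
  by move/cvgrPdist_lt : tc; exact.
have near_q : \forall s \near s0, forall c, `|crd c (q s0) - crd c (q s)| < r / 2.
  have near_c c : \forall s \near s0, `|crd c (q s0) - crd c (q s)| < r / 2.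
    by have /cvgrPdist_lt := (cvg_crd (nbhs_filter s0) q (q s0)).2 qc c; exact.
  exact: (filter_forall (nbhs_filter s0) near_c).
have [eta eta0 etaP] : exists2 eta : R, 0 < eta & forall s, `|s0 - s| < eta ->
    `|t s0 - t s| < r / 2 /\ forall c, `|crd c (q s0) - crd c (q s)| < r / 2.
  by have [eta eta0 etaP] := filterI near_t near_q; exists eta => // s /etaP.
have incr : \forall h \near (0 : R)^'+, N (q (h + s0) - q s0) <= F (h + s0) - F s0.
  near=> h.
  have h0 : 0 < h by near: h; exact: nbhs_right_gt.
  have heta : h < eta by near: h; exact: nbhs_right_lt.
  have hS' : h + s0 < S by rewrite -ltrBrDr; near: h; apply: nbhs_right_lt; rewrite subr_gt0.
  have s2ge : 0 <= h + s0 by rewrite addr_ge0// ltW.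
  have s12 : s0 <= h + s0 by rewrite lerDr ltW.
  have ineq : \forall k \near \oo, N (qq k (h + s0) - qq k s0) <=
     - (E (tt k (h + s0)) (qq k (h + s0)) - E (tt k s0) (qq k s0)) +
     (dt0 + d - C) * (tt k (h + s0) - tt k s0) + d * (K * (Ms k (h + s0) - Ms k s0)).
    near=> k.
    have kS : h + s0 <= Ss k by near: k; apply: (cvgr_ge _ hS).
    have kU : forall s, 0 <= s -> s <= S ->
      `|t s - tt k s| < r / 2 /\ forall c, `|crd c (q s) - crd c (qq k s)| < r / 2.
      by near: k; exact: unif.
    have kB : forall t' q' v', t' \in `[0, T] -> `|t s0 - t'| < r ->
      (forall c, `|crd c (q s0) - crd c q'| < r) ->
      (exists2 xi, subdifferential (Reps alpha R0 VVz VVu (ep k) q') v' xi & xi + DqE E t' q' = 0) ->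
      N v' + C + dtE T E t' q' + dotQ (DqE E t' q') v' <= dt0 + d + d * enormQ v'.
      by near: k; exact: rP.
    (* The parameter lengths converge to S > s0 + h, so both curves are frozen only
   beyond the interval. *)
have frz x : x <= h + s0 -> tt k x = ts k x /\ qq k x = qs k (ts k x).
      by move=> xh; rewrite /tt /qq /freeze min_l// (le_trans xh).
    have [e1 e2] := frz _ s12; have [e3 e4] := frz _ (lexx _); rewrite e1 e2 e3 e4.
    apply: (@interval_estimate _ _ _ T E hE T0 (qs k) (ts k) (Ss k)) => //.
    - exact: ltW.
    - exact: ltW.
    - move=> x y x0 xy yh; have yS := le_trans yh (ltW hS').
      have := inc k x0 xy yS; have [-> ->] := frz _ yh; have [-> ->] := frz _ (le_trans xy yh).
      have := param_nd (hts k) x0 xy (le_trans yh kS); lra.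
    - apply: aeW (incl k) => x hx xT [s /andP[s0s sh] sx].
      have x0T : x \in `[0, T] by move: xT; rewrite !in_itv/= => /andP[/ltW -> /ltW ->].
      have sS : s <= S by exact: le_trans sh (ltW hS').
      have [u1 u2] := kU s (le_trans (ltW s00) s0s) sS.
      have [|w1 w2] := etaP s; first by rewrite distrC ger0_norm ?subr_ge0//; lra.
      have [g1 g2] := frz _ sh; rewrite g1 g2 sx in u1 u2.
      apply: kB => //; last exact: hx.
        have -> : t s0 - x = (t s0 - t s) + (t s - x) by ring.
        by apply: le_lt_trans (ler_normD _ _) _; rewrite (splitr r) ltrD.
      move=> c; have -> : crd c (q s0) - crd c (qs k x) =
        (crd c (q s0) - crd c (q s)) + (crd c (q s) - crd c (qs k x)) by ring.
      by apply: le_lt_trans (ler_normD _ _) _; rewrite (splitr r) ltrD.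
  have lhs : N (qq k (h + s0) - qq k s0) @[k --> \oo] --> N (q (h + s0) - q s0).
    apply: (@cvg_comp _ _ _ (fun k => qq k (h + s0) - qq k s0) N _ (nbhs (q (h + s0) - q s0))).
      by apply: cvgB; apply: qqc => //; exact: ltW.
    exact: sublinear_continuous.
  have rhs : - (E (tt k (h + s0)) (qq k (h + s0)) - E (tt k s0) (qq k s0)) +
     (dt0 + d - C) * (tt k (h + s0) - tt k s0) + d * (K * (Ms k (h + s0) - Ms k s0)) @[k --> \oo] -->
     - (E (t (h + s0)) (q (h + s0)) - E (t s0) (q s0)) +
     (dt0 + d - C) * (t (h + s0) - t s0) + d * (K * (M (h + s0) - M s0)).
    apply: cvgD; [apply: cvgD|].
    - by apply: cvgN; apply: cvgB; apply: Ec => //; exact: ltW.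
    - by apply: cvgM; [exact: cvg_cst|apply: cvgB; apply: ttc => //; exact: ltW].
    - apply: cvgM; [exact: cvg_cst|apply: cvgM; first exact: cvg_cst].
      by apply: cvgB; apply: MM => //; exact: ltW.
  apply: le_trans (ler_cvg_to lhs rhs ineq) _; rewrite /F le_eqVlt; apply/orP; left.
  by apply/eqP; ring.
have Ed : is_derive s0 (1 : R) (fun s => E (t s) (q s))
    (dt0 * tau + dotQ (DqE E (t s0) (q s0)) v).
  apply: (E_chain hE) => //; near=> s; apply: tT.
    by apply: ltW; near: s; exact: lt_nbhsr.
  by apply: ltW; near: s; exact: lt_nbhsl.
have Fd : is_derive s0 (1 : R) F (- (dt0 * tau + dotQ (DqE E (t s0) (q s0)) v) +
    (dt0 + d - C) * tau + d * (K * mu)).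
  have := is_deriveD (is_deriveD (is_deriveN Ed) (is_deriveZ (dt0 + d - C) td))
    (is_deriveZ d (is_deriveZ K Md)).
  by rewrite /GRing.scale.
have := sublinear_derive_le Nsub qd Fd incr; rewrite dotQNl /N; lra.
Unshelve. all: by end_near. Qed.

End vanishing_viscosity_limit.

(** * From the pointwise identity to the energy identity *)

Section ae_integral.
Context (R : realType).
Local Notation mu := (@lebesgue_measure R).
Local Open Scope ereal_scope.
Implicit Types f g h : measurableTypeR R -> \bar R.

(** The integral of a nonnegative function is a supremum over the simple functions
    below it. *)
Lemma ge0_le_integral_any f g : (forall x, 0 <= f x) -> (forall x, f x <= g x) ->
  \int[mu]_x f x <= \int[mu]_x g x.
Proof.
move=> f0 fg; have g0 x : 0 <= g x by exact: le_trans (fg x).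
rewrite !ge0_integralTE//; apply: ereal_sup_le => _ [h /= hf <-].
by exists h => //= x; exact: le_trans (fg x).
Qed.

(** f lies between two measurable functions that agree with h outside a null set and
    equal 0, respectively + oo, on it. *)
Lemma ge0_ae_eq_integral_any f h : (forall x, 0 <= f x) -> (forall x, 0 <= h x) ->
  measurable_fun setT h -> {ae mu, forall x, f x = h x} ->
  \int[mu]_x f x = \int[mu]_x h x.
Proof.
move=> f0 h0 mh [N [mN N0 fhN]].
pose g1 := h \_ (~` N); pose g2 x := g1 x + (cst +oo \_ N) x.
have mg1 : measurable_fun setT g1.
  apply/(measurable_restrict _ (measurableC mN) measurableT).
  exact: measurable_funS mh.
have mg2 : measurable_fun setT g2.
  apply: emeasurable_funD => //.
  by apply/(measurable_restrict _ mN measurableT); exact: measurable_cst.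
have g1in x : N x -> g1 x = 0 by move=> Nx; rewrite /g1 patchE memNset.
have g1out x : ~ N x -> g1 x = h x by move=> Nx; rewrite /g1 patchE mem_set.
have g2in x : N x -> g2 x = +oo by move=> Nx; rewrite /g2 g1in// patchE mem_set// add0e.
have g2out x : ~ N x -> g2 x = h x by move=> Nx; rewrite /g2 g1out// patchE memNset// adde0.
have fout x : ~ N x -> f x = h x by apply: contra_notP => ?; exact: fhN.
have g10 x : 0 <= g1 x by have [/g1in ->|/g1out ->] := pselect (N x).
have g20 x : 0 <= g2 x by have [/g2in ->|/g2out ->] := pselect (N x).
have e1 : \int[mu]_x g1 x = \int[mu]_x h x.
  apply: ge0_ae_eq_integral => //; exists N; split => // x /=.
  by apply: contra_notP => Nx _; exact: g1out.
have e2 : \int[mu]_x g2 x = \int[mu]_x h x.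
  apply: ge0_ae_eq_integral => //; exists N; split => // x /=.
  by apply: contra_notP => Nx _; exact: g2out.
apply/eqP; rewrite eq_le; apply/andP; split.
- rewrite -e2; apply: ge0_le_integral_any => // x.
  by have [/g2in ->|Nx] := pselect (N x); [rewrite leey|rewrite g2out// fout].
- rewrite -e1; apply: ge0_le_integral_any => // x.
  by have [/g1in ->|Nx] := pselect (N x); [|rewrite g1out// fout].
Qed.

(** This applies to M0 along a curve, which is known only almost everywhere, where it
    equals the power of the forces. *)
Lemma ae_eq_integral_any (D : set (measurableTypeR R)) f h : measurable D ->
  measurable_fun D h -> {ae mu, forall x, D x -> f x = h x} ->
  \int[mu]_(x in D) f x = \int[mu]_(x in D) h x.
Proof.
move=> mD mh fh; rewrite [LHS]integral_mkcond [RHS]integral_mkcond.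
have mhD : measurable_fun setT (h \_ D).
  by apply/(measurable_restrict _ mD measurableT); rewrite setTI.
have fhD : {ae mu, forall x, (f \_ D) x = (h \_ D) x}.
  apply: aeW fh => x fh; rewrite !patchE; case: ifP => // /set_mem; exact: fh.
rewrite [LHS]integralE [RHS]integralE; congr (_ - _).
- apply: ge0_ae_eq_integral_any => //; first exact: measurable_funepos.
  by apply: aeW fhD => x fhx; rewrite !funeposE fhx.
- apply: ge0_ae_eq_integral_any => //; first exact: measurable_funeneg.
  by apply: aeW fhD => x fhx; rewrite !funenegE fhx.
Qed.

End ae_integral.

Section freezing.
Context (R : realType).

Lemma AC_freeze (V : zmodType) (N : V -> R) (Se b : R) (f : R -> V) :
  N 0 = 0 -> 0 <= Se -> absolutely_continuous_on N 0 Se f ->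
  absolutely_continuous_on N 0 b (freeze Se f).
Proof.
move=> N0 S0 ACf; apply: (AC_comp_mono (tau := fun s => Num.min s Se) N0 ACf).
- by move=> x x0 _; rewrite le_min x0 S0 ge_min lexx orbT.
- by move=> x y _ xy _; rewrite le_min ge_min xy /= ge_min lexx orbT.
- apply: (@AC_dom _ _ _ _ _ _ id); last exact: AC_id.
  move=> x y _ xy _; case: (leP y Se) => yS; case: (leP x Se) => xS; rewrite ger0_norm; lra.
Qed.

Lemma uniform_cvg_crd (n m : nat) (A : set R) (u : nat -> R -> R * Qspace R n m)
    (f : R -> R * Qspace R n m) :
  (forall e : R, 0 < e -> \forall k \near \oo, forall s, A s ->
    `|(f s).1 - (u k s).1| < e /\ forall c, `|crd c (f s).2 - crd c (u k s).2| < e) ->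
  {uniform A, u @ \oo --> f}.
Proof.
move=> h P /uniform_nbhs[X [entX XP]].
move: entX; rewrite -entourage_ballE => -[e /= e0 eX].
apply: filterS (h e e0) => k hk; apply: XP => s As; apply: eX.
have [h1 h2] := hk s As; split; first exact: h1.
split; split => // i j /=; rewrite (ord1 i).
- exact: (h2 (inl j)).
- exact: (h2 (inr j)).
Qed.

End freezing.

Lemma AC_within_cvg (R : realType) (a b : R) (f : R -> R) (s : R) : ACR a b f ->
  s \in `[a, b] -> f x @[x --> within `[a, b]%classic (nbhs s)] --> f s.
Proof.
move=> ACf; rewrite in_itv/= => /andP[as_ sb]; apply/cvgrPdist_lt => e e0.
have [d d0 dP] := AC_unif ACf e0; exists d => // x /= sx; rewrite in_itv/= => /andP[ax xb].
have [xs|/ltW xs] := leP s x.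
- by rewrite distrC; apply: dP => //; rewrite distrC ger0_norm ?subr_ge0 in sx.
- by apply: dP => //; rewrite ger0_norm ?subr_ge0 in sx.
Qed.

Section energy_balance.
Context (R : realType) (n m : nat) (T alpha : R).
Local Notation Q := (Qspace R n m).
Local Notation mu := (@lebesgue_measure R).
Context (R0 : Q -> 'rV[R]_m -> R) (VVz : Q -> 'M[R]_m) (VVu : Q -> 'M[R]_n).
Context (E : R -> Q -> R).
Hypothesis hE : C1_energy T E.
Context (S : R) (t : R -> R) (q : R -> Q).
Hypothesis S0 : 0 <= S.
Hypothesis ACt : ACR 0 S t.
Hypothesis ACq : absolutely_continuous_on (@enormQ R n m) 0 S q.
Hypothesis tT : forall s, 0 <= s -> s <= S -> t s \in `[0, T].

Let D : set (R * Q) := `[0, T]%classic `*` setT.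

Lemma dtE_curve_continuous : {within `[0, S], continuous (fun s => dtE T E (t s) (q s))}.
Proof.
apply/subspace_continuousP => s /= sS.
have [s0 s1] : 0 <= s /\ s <= S by move: sS; rewrite in_itv/= => /andP[].
have Ds : D (t s, q s) by split => //; exact: tT.
have [_ [_ c _]] := hE; move/subspace_continuousP : c => /(_ _ Ds) c.
apply: (@cvg_comp _ _ _ (fun s => (t s, q s)) (fun p => dtE T E p.1 p.2) _ (within D (nbhs (t s, q s)))) => //.
move=> A [[B1 B2] /= [h1 h2] AB].
pose W := within `[0, S]%classic (nbhs s); have FW : Filter W by exact: within_filter.
have n1 : \forall x \near W, B1 (t x) by exact: (AC_within_cvg ACt sS h1).
have qc : q x @[x --> within `[0, S]%classic (nbhs s)] --> q s.
  apply: (proj1 (cvg_crd _ _ _)) => c'.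
  exact: (AC_within_cvg (AC_crd ACq c') sS).
have n2 : \forall x \near W, B2 (q x) by exact: (qc _ h2).
have wf : \forall x \near W, `[0, S]%classic x.
  exact: withinT.
apply: filterS (filterI (filterI n1 n2) wf) => x [[h3 h4]] /=; rewrite in_itv/= => /andP[x0 xS].
by apply: (AB (t x, q x)) => //; split => //=; exact: tT.
Qed.

(** By the chain rule, - < DqE, q' > is dtE t' minus the derivative of the energy,
    which is integrable and has the energy as a primitive. *)
Lemma energy_identity_of_pointwise :
  {ae mu, forall s, s \in `]0, S[ -> forall tau v,
    is_derive s (1 : R) t tau -> is_derive s (1 : R) q v ->
    M0 alpha R0 VVz VVu (q s) tau v (- DqE E (t s) (q s)) =
      (dotQ (- DqE E (t s) (q s)) v)%:E} ->
  forall s1 s2 : R, 0 <= s1 -> s1 <= s2 -> s2 <= S ->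
    energy_identity T alpha R0 VVz VVu E t q s1 s2.
Proof.
move=> hM s1 s2 s10 s12 s2S.
pose J : set (measurableTypeR R) := `[s1, s2]%classic.
have mJ : measurable J by exact: measurable_itv.
have JS : J `<=` `[0, S].
  by move=> x; rewrite /J /= !in_itv/= => /andP[? ?]; apply/andP; split; lra.
have [gt [igt _ gtP]] := AC_FTC S0 ACt.
pose e s := E (t s) (q s).
have ACe : ACR 0 S e := AC_energy hE S0 ACt tT ACq.
have [g [ig gE gP]] := AC_FTC S0 ACe.
pose P s := dtE T E (t s) (q s).
have Pc : {within J, continuous P} by exact: continuous_subspaceW JS dtE_curve_continuous.
have mP : measurable_fun J P by exact: subspace_continuous_measurable_fun.
have bP : [bounded P x | x in J].
  have [L [Lr LP]] := compact_bounded (continuous_compact Pc (@segment_compact _ _ _)).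
  by exists L; split => // M LM x Jx; apply: (LP M LM); exists x.
have igtJ : mu.-integrable J (EFin \o gt) by apply: integrableS igt.
have igJ : mu.-integrable J (EFin \o g) by apply: integrableS ig.
pose H s := P s * gt s.
have iH : mu.-integrable J (EFin \o H) by exact: (integrableMr mJ mP bP igtJ).
have iHg : mu.-integrable J (EFin \o (fun s => H s - g s)).
  by have := integrableB mJ iH igJ; apply: eq_integrable.
have aeJ (B : R -> Prop) : {ae mu, forall s, s \in `]0, S[ -> B s} -> {ae mu, forall s, J s -> B s}.
  move=> h; apply: aeW (aeI h (aeI (ae_neq 0) (ae_neq S))) => s [hs [sn0 snS]] /JS /=.
  rewrite in_itv/= => /andP[s0 sS]; apply: hs.
  by rewrite in_itv/= !lt_neqAle eq_sym sn0 s0 snS sS.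
have I1 : (\int[mu]_(r in J) M0 alpha R0 VVz VVu (q r) (derive1 t r) (derive1 q r)
      (- DqE E (t r) (q r))%R = \int[mu]_(r in J) (H r - g r)%:E)%E.
  apply: ae_eq_integral_any => //; first exact: measurable_int iHg.
  apply: aeJ; apply: aeW (aeI (aeI hM gtP) (aeI gP (AC_curve_derive ACq S0))).
  move=> s [[h1 h2] [h3 h4]] sS; have [v qv] := h4 sS.
  have td := h2 sS; have ed := h3 sS.
  rewrite (is_derive1_val td) (is_derive1_val qv) (h1 sS _ _ td qv) dotQNl; congr EFin.
  have cd : is_derive s (1 : R) e (P s * gt s + dotQ (DqE E (t s) (q s)) v).
    apply: (E_chain hE) => //; near=> x.
    have : x \in `]0, S[ by near: x; exact: near_in_itvoo.
    by rewrite in_itv/= => /andP[/ltW ? /ltW ?]; exact: tT.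
  by rewrite (is_derive1_unique ed cd) /H; ring.
have I2 : (\int[mu]_(r in J) (dtE T E (t r) (q r) * derive1 t r)%:E =
           \int[mu]_(r in J) (H r)%:E)%E.
  apply: ae_eq_integral_any => //; first exact: measurable_int iH.
  by apply: aeJ; apply: aeW gtP => s h sS; rewrite (is_derive1_val (h sS)).
rewrite /energy_identity; rewrite /J in I1 I2; rewrite I1 I2 -/J.
have fH : (\int[mu]_(r in J) (H r)%:E = (\int[mu]_(r in J) H r)%R%:E)%E.
  by rewrite /Rintegral fineK//; apply: integrable_fin_num.
have fHg : (\int[mu]_(r in J) (H r - g r)%:E = (\int[mu]_(r in J) (H r - g r))%R%:E)%E.
  by rewrite /Rintegral fineK//; apply: integrable_fin_num.
rewrite fH fHg -!EFinD; congr EFin.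
rewrite RintegralB//.
have <- : e s2 - e s1 = \int[mu]_(r in J) g r.
  rewrite gE// /J Rintegral_itv_obnd_cbnd//.
  by apply: integrableS igJ => //; exact: subset_itv_oc_cc.
by move: (\int[mu]_(r in J) H r) => x; rewrite /e; ring.
Unshelve. all: by end_near. Qed.

End energy_balance.

(** * The vanishing-viscosity limit *)

Theorem theorem4p5 (R : realType) (n m : nat) (T alpha : R)
    (R0 : Qspace R n m -> 'rV[R]_m -> R)
    (VVz : Qspace R n m -> 'M[R]_m) (VVu : Qspace R n m -> 'M[R]_n)
    (E : R -> Qspace R n m -> R)
    (eps : nat -> R) (qin : nat -> Qspace R n m) (q_ : nat -> R -> Qspace R n m)
    (S_ : nat -> R) (t_ : nat -> R -> R)
    (phi : nat -> nat) (Sl : R) (q0 : Qspace R n m) (mlim : R -> R) :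
  let tt_ := fun k => freeze (S_ k) (t_ k) in
  let qq_ := fun k => freeze (S_ k) (q_ k \o t_ k) in
  0 < T -> 0 < alpha ->
  assumption_R0 R0 -> assumption_V VVz -> assumption_V VVu ->
  assumption_E T E ->
  (forall k, 0 < eps k) -> eps @ \oo --> (0 : R) ->
  (forall k, cauchy_solution T alpha R0 VVz VVu E (eps k) (qin k) (q_ k)) ->
  (forall k, parameterization T (S_ k) (t_ k)) ->
  {homo phi : i j / (i < j)%N} ->
  (fun k => S_ (phi k)) @ \oo --> Sl ->
  (fun k => qq_ (phi k) 0) @ \oo --> q0 ->
  weak_cvg_L1 `]0, Sl[%classic
    (fun k s => derive1 (tt_ (phi k)) s + enormQ (derive1 (qq_ (phi k)) s)) mlim ->
  exists psi : nat -> nat, {homo psi : i j / (i < j)%N} /\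
  exists (t : R -> R) (q : R -> Qspace R n m),
    (absolutely_continuous_on (fun x : R => `|x|) 0 Sl t /\
     absolutely_continuous_on (@enormQ R n m) 0 Sl q /\
     set_fun `[0, Sl]%classic `[0, T]%classic t /\
     {in `[0, Sl] &, {homo t : x y / x <= y}}) /\
    {uniform `[0, Sl]%classic,
       (fun k s => (tt_ (phi (psi k)) s, qq_ (phi (psi k)) s)) @ \oo
         --> (fun s => (t s, q s))} /\
    {ae @lebesgue_measure R, forall s, s \in `]0, Sl[ ->
       derive1 t s + enormQ (derive1 q s) <= mlim s} /\
    (forall s1 s2 : R, 0 <= s1 -> s1 <= s2 -> s2 <= Sl ->
       energy_identity T alpha R0 VVz VVu E t q s1 s2).
Proof.
move=> tt_ qq_ T0 al0 hR hz hu hEn ep0 epc sol par phiS SS qq0c weak.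
have [hE _ _ _] := hEn.
pose tt k := tt_ (phi k); pose qq k := qq_ (phi k).
have Se0 k : 0 <= S_ k by exact: (param_length_ge0 T0 (par k)).
have S0 : 0 <= Sl by apply: (cvgr_to_ge SS); apply: nearW => k; exact: Se0.
have mD : measurable (`]0, Sl[%classic : set (measurableTypeR R)) by exact: measurable_itv.
pose f_ k s := derive1 (tt k) s + enormQ (derive1 (qq k) s).
have [fi_ mi _] := weak.
pose Ms k := prim `]0, Sl[ (f_ k); pose M := prim `]0, Sl[ mlim.
have ACq k : absolutely_continuous_on (@enormQ R n m) 0 T (q_ k) by have [[]] := sol k.
have e00 : enormQ (0 : Qspace R n m) = 0 by rewrite -[0](scale0r 0) enormQZ normr0 mul0r.
have ACtt k b : ACR 0 b (tt k).
  by apply: AC_freeze => //; [rewrite normr0|have [] := par (phi k)].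
have ACqq k b : absolutely_continuous_on (@enormQ R n m) 0 b (qq k).
  apply: AC_freeze => //; apply: (AC_comp_mono (a' := 0) (b' := T) e00 (ACq _)).
  - by move=> x; exact: (param_in (par (phi k))).
  - by move=> x y; exact: (param_nd (par (phi k))).
  - by have [] := par (phi k).
have inc k x y : 0 <= x -> x <= y -> y <= Sl ->
    tt k y - tt k x + enormQ (qq k y - qq k x) <= Ms k y - Ms k x.
  by apply: (increment_le_prim (ACtt k Sl) (ACqq k Sl) (fi_ k)); apply: aeT.
have MM (x : R) : Ms k x @[k --> \oo] --> M x by exact: (weak_cvg_prim weak).
have tt_nd k x y : 0 <= x -> x <= y -> tt k x <= tt k y.
  move=> x0 xy; apply: (param_nd (par (phi k))).
  - by rewrite le_min x0 Se0.
  - by rewrite le_min !ge_min xy lexx orbT.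
  - by rewrite ge_min lexx orbT.
have tt_in k x : 0 <= x -> 0 <= tt k x /\ tt k x <= T.
  move=> x0; apply: (param_in (par (phi k))); first by rewrite le_min x0 Se0.
  by rewrite ge_min lexx orbT.
have Ms_nd k x y : 0 <= x -> x <= y -> y <= Sl -> Ms k x <= Ms k y.
  move=> x0 xy yS; rewrite -subr_ge0; apply: le_trans (inc k x y x0 xy yS).
  by rewrite addr_ge0 ?enormQ_ge0// subr_ge0 tt_nd.
have qq_inc k c x y : 0 <= x -> x <= y -> y <= Sl ->
    `|crd c (qq k y) - crd c (qq k x)| <= Ms k y - Ms k x.
  move=> x0 xy yS; rewrite -crdB; apply: (le_trans (crd_le_enormQ _ _)).
  apply: le_trans (inc k x y x0 xy yS); by rewrite lerDr subr_ge0 tt_nd.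
have bounded_seq (u : nat -> R) (l : R) : u k @[k --> \oo] --> l ->
    exists B : R, forall k, `|u k| <= B.
  move=> ul; have /cvg_seq_bounded[B [_ BP]] : cvgn u by apply/cvg_ex; exists l.
  by exists (B + 1) => k; apply: BP => //; rewrite ltrDl.
have [B1 B1P] : exists B : R, forall k, `|enormQ (qq k 0)| <= B.
  apply: (bounded_seq _ (enormQ q0)).
  by apply: (@cvg_comp _ _ _ (fun k => qq k 0) (@enormQ R n m) _ (nbhs q0)) => //;
    exact: enormQ_continuous.
have [B2 B2P] : exists B : R, forall k, `|Ms k Sl - Ms k 0| <= B.
  by apply: (bounded_seq _ (M Sl - M 0)); apply: cvgB.
(* Time and the coordinates of the state form one finite family of real functions. *)
pose v k (c : option ('I_n + 'I_m)) s :=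
  if c is Some c' then crd c' (qq k s) else tt k s.
have vB k c s : 0 <= s -> s <= Sl -> `|v k c s| <= T + (B1 + B2).
  have B10 : 0 <= B1 by apply: le_trans (B1P 0%N).
  have B20 : 0 <= B2 by apply: le_trans (B2P 0%N).
  move=> s0 sS; case: c => [c|] /=.
    have := qq_inc k c 0 s (lexx _) s0 sS; have := B1P k; have := B2P k.
    have := Ms_nd k s Sl s0 sS (lexx _); have := crd_le_enormQ c (qq k 0).
    rewrite [`|enormQ _|]ger0_norm ?enormQ_ge0// => h1 h2 h3 h4 h5.
    have -> : crd c (qq k s) = (crd c (qq k s) - crd c (qq k 0)) + crd c (qq k 0) by ring.
    apply: (le_trans (ler_normD _ _)); have := le_trans (ler_norm _) h3.
    by move: h1 h2 h4 h5 (ltW T0); lra.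
  by have [? ?] := tt_in k s s0; rewrite ger0_norm//; lra.
have vM k c x y : 0 <= x -> x <= y -> y <= Sl -> `|v k c y - v k c x| <= Ms k y - Ms k x.
  case: c => [c|] x0 xy yS /=; first exact: qq_inc.
  rewrite ger0_norm ?subr_ge0 ?tt_nd//; apply: le_trans (inc k x y x0 xy yS).
  by rewrite lerDl enormQ_ge0.
have ACM : ACR 0 Sl M := prim_AC mD Sl mi.
have [psi [psi_nd [w wP]]] := uniform_selection S0 vB vM Ms_nd (fun x _ _ => MM x) ACM.
exists psi; split => //.
pose t := w None.
pose q s : Qspace R n m := (\row_i w (Some (inl i)) s, \row_j w (Some (inr j)) s).
have qE c s : crd c (q s) = w (Some c) s by case: c => i /=; rewrite mxE.
have unif (e : R) : 0 < e -> \forall k \near \oo, forall s, 0 <= s -> s <= Sl ->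
    `|t s - tt (psi k) s| < e /\ forall c, `|crd c (q s) - crd c (qq (psi k) s)| < e.
  move=> /wP; apply: filterS => k h s s0 sS.
  by split=> [|c]; [exact: (h None s s0 sS)|rewrite qE; exact: (h (Some c) s s0 sS)].
have subseq (g : nat -> nat) : {homo g : i j / (i < j)%N} -> g k @[k --> \oo] --> \oo.
  move=> gS A [N _ NA]; exists N => // k /= Nk; apply: NA => /=.
  apply: leq_trans Nk _; elim: k => // k IH; exact: leq_ltn_trans IH (gS _ _ _).
have psio := subseq _ psi_nd.
have MMp x : Ms (psi k) x @[k --> \oo] --> M x by apply: cvg_comp psio (MM x).
have ttc s : 0 <= s -> s <= Sl -> tt (psi k) s @[k --> \oo] --> t s.
  move=> s0 sS; apply/cvgrPdist_lt => e /unif; apply: filterS => k h.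
  exact: (h s s0 sS).1.
have qqc s : 0 <= s -> s <= Sl -> qq (psi k) s @[k --> \oo] --> q s.
  move=> s0 sS; apply/cvg_crd => c; apply/cvgrPdist_lt => e /unif; apply: filterS => k h.
  exact: (h s s0 sS).2.
have t_in s : 0 <= s -> s <= Sl -> 0 <= t s /\ t s <= T.
  move=> s0 sS; split.
    by apply: (cvgr_to_ge (ttc s s0 sS)); apply: nearW => k; exact: (tt_in _ _ s0).1.
  by apply: (cvgr_to_le (ttc s s0 sS)); apply: nearW => k; exact: (tt_in _ _ s0).2.
have t_nd x y : 0 <= x -> x <= y -> y <= Sl -> t x <= t y.
  move=> x0 xy yS; apply: (ler_cvg_to (ttc x x0 (le_trans xy yS)) (ttc y (le_trans x0 xy) yS)).
  by apply: nearW => k; exact: tt_nd.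
have incl x y : 0 <= x -> x <= y -> y <= Sl ->
    t y - t x + enormQ (q y - q x) <= M y - M x.
  move=> x0 xy yS; have y0 := le_trans x0 xy; have xS := le_trans xy yS.
  have lhs : tt (psi k) y - tt (psi k) x + enormQ (qq (psi k) y - qq (psi k) x) @[k --> \oo] -->
      t y - t x + enormQ (q y - q x).
    apply: cvgD; first by apply: cvgB; exact: ttc.
    apply: (@cvg_comp _ _ _ (fun k => qq (psi k) y - qq (psi k) x) (@enormQ R n m) _ (nbhs (q y - q x))).
      by apply: cvgB; exact: qqc.
    exact: enormQ_continuous.
  have rhs : Ms (psi k) y - Ms (psi k) x @[k --> \oo] --> M y - M x by apply: cvgB.
  by apply: (ler_cvg_to lhs rhs); apply: nearW => k; exact: inc.
have AClt : ACR 0 Sl t.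
  apply: (@AC_dom _ _ _ _ _ _ M) => // x y x0 xy yS; rewrite ger0_norm ?subr_ge0 ?t_nd//.
  by apply: le_trans (incl x y x0 xy yS); rewrite lerDl enormQ_ge0.
have AClq : absolutely_continuous_on (@enormQ R n m) 0 Sl q.
  apply: (@AC_dom _ _ _ _ _ _ M) => // x y x0 xy yS.
  by apply: le_trans (incl x y x0 xy yS); rewrite lerDr subr_ge0 t_nd.
have tT s : 0 <= s -> s <= Sl -> t s \in `[0, T].
  by move=> s0 sS; rewrite in_itv/=; apply/andP; exact: t_in.
exists t, q; split; [|split; [|split]].
- split=> //; split=> //; split.
    by move=> s /=; rewrite in_itv/= => /andP[s0 sS]; exact: tT.
  move=> x y; rewrite !in_itv/= => /andP[x0 _] /andP[_ yS] xy; exact: t_nd.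
- apply: uniform_cvg_crd => e e0; apply: filterS (unif e e0) => k h s /=.
  by rewrite in_itv/= => /andP[s0 sS]; exact: h.
- have [gt [_ _ gtP]] := AC_FTC S0 AClt.
  apply: aeW (aeI (aeI gtP (AC_curve_derive AClq S0)) (prim_derive mD Sl mi)).
  move=> s [[h1 h2] h3] sS; have [d qd] := h2 sS; have td := h1 sS; have Md := h3 sS.
  rewrite (is_derive1_val td) (is_derive1_val qd) -lerBrDl.
  rewrite patchE mem_set// in Md.
  apply: (sublinear_derive_le (@sublinear_enormQ R n m) qd (is_deriveB Md td)).
  move: sS; rewrite in_itv/= => /andP[s0 sS]; near=> h.
  have h0 : 0 < h by near: h; exact: nbhs_right_gt.
  have hS : h + s <= Sl by rewrite -lerBrDr; near: h; apply: nbhs_right_le; rewrite subr_gt0.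
  rewrite !fctE; have := incl s (h + s) (ltW s0) _ hS; rewrite lerDr (ltW h0) => /(_ isT).
  by rewrite -/M; lra.
apply: (energy_identity_of_pointwise hE S0 AClt AClq tT).
apply: aeW (prim_derive mD Sl mi) => s h3 sS tau u td qd; have Md := h3 sS.
pose ep k := eps (phi (psi k)).
have epc' : ep @ \oo --> (0 : R).
  by apply: (@cvg_comp _ _ _ (fun k => phi (psi k)) eps _ \oo) => //;
    apply: cvg_comp psio (subseq _ phiS).
apply/eqP; rewrite eq_le (M0_ge _ hR hz hu) andbT.
apply: (M0_le hR hz hu al0 _ epc') => [k|]; first exact: ep0.
have incl' k : {ae @lebesgue_measure R, forall x, x \in `]0, T[ ->
    exists2 xi, subdifferential (Reps alpha R0 VVz VVu (ep k) (q_ (phi (psi k)) x))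
      (derive1 (q_ (phi (psi k))) x) xi & xi + DqE E x (q_ (phi (psi k)) x) = 0}.
  by have [_ _] := sol (phi (psi k)).
have SS' : (fun k => S_ (phi (psi k))) @ \oo --> Sl by apply: cvg_comp psio SS.
exact: (@lower_bounds_limit _ _ _ T alpha R0 VVz VVu E hR hz hu hE T0 ep
  (fun k => q_ (phi (psi k))) (fun k => t_ (phi (psi k))) (fun k => S_ (phi (psi k)))
  Sl (fun k => Ms (psi k)) t q M (fun k => ep0 _) (fun k => ACq _) incl' (fun k => par _) SS'
  (fun k x y => inc (psi k) x y) (fun x _ _ => MMp x) unif tT s tau u _ sS td qd Md).
Unshelve. all: by end_near. Qed.
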